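(* Let $k$ be a positive integer with $k \equiv 0 \pmod 4$, let $\ell = \dim S_k$, and let $F_{k,0}(z) \in M_k$ be the unique holomorphic modular form of weight $k$ for $\mathrm{SL}_2(\mathbb{Z})$ with Fourier expansion \[ F_{k,0}(z) = 1 + O(q^{\ell+1}) = \sum_{n=0}^{\infty} a(n) q^n, \qquad q = e^{2\pi i z}. \] Then $a(n) > 0$ for every integer $n$ satisfying \[ n \geq e^{58.366/(k-2)} \left(\ell^{3} \log(k)\right)^{\frac{1}{k-2}} \cdot 1.0242382\, \ell. \]
   Context: $M_k$ is the space of holomorphic modular forms of weight $k$ for $\mathrm{SL}_2(\mathbb{Z})$ and $S_k$ its subspace of cusp forms. For even $k \geq 4$, $\ell = \dim S_k$ equals $\lfloor k/12 \rfloor$ if $k \not\equiv 2 \pmod{12}$ and $\lfloor k/12\rfloor - 1$ if $k \equiv 2 \pmod{12}$. The notation $1 + O(q^{\ell+1})$ means the coefficients of $q^1, \dots, q^{\ell}$ vanish and the constant term is $1$. $\log$ is the natural logarithm. *)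

(* Defs.v *)
(* Stdlib real numbers with Coquelicot's complex numbers. *)
From Stdlib Require Export Reals ZArith.
From Coquelicot Require Export Coquelicot.
Open Scope R_scope.

(* Functions on the upper half plane are total functions C -> C whose values
   off the half plane are never inspected; two of them are identified when
   they agree on it. *)
Definition upper_half_plane (z : C) : Prop := 0 < Im z.

Definition holomorphic_on_H (f : C -> C) : Prop :=
  forall z : C, upper_half_plane z ->
    ex_derive (K := C_AbsRing) (V := C_NormedModule) f z.

Definition weight_invariant (k : nat) (f : C -> C) : Prop :=
  forall a b c d : Z, (a * d - b * c = 1)%Z ->
  forall z : C, upper_half_plane z ->
    f ((IZR a * z + IZR b) / (IZR c * z + IZR d))%C
      = ((IZR c * z + IZR d) ^ k * f z)%C.

Definition Cexp (z : C) : C :=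
  (RtoC (exp (Re z)) * (cos (Im z), sin (Im z)))%C.

Definition nome (z : C) : C := Cexp (RtoC (2 * PI) * Ci * z)%C.

Definition has_q_expansion (f : C -> C) (a : nat -> C) : Prop :=
  forall z : C, upper_half_plane z ->
    is_pseries (K := C_AbsRing) (V := C_NormedModule) a (nome z) (f z).

(* Holomorphy at the cusp is the existence of a q-expansion with no negative
   powers of q. *)
Definition modular_form (k : nat) (f : C -> C) : Prop :=
  holomorphic_on_H f /\ weight_invariant k f /\
  exists a : nat -> C, has_q_expansion f a.

Definition cusp_form (k : nat) (f : C -> C) : Prop :=
  modular_form k f /\
  exists a : nat -> C, has_q_expansion f a /\ a 0%nat = RtoC 0.

(* The sum over 1 <= i <= l, equal to 0 when l = 0. *)
Definition lincomb (l : nat) (c : nat -> C) (b : nat -> C -> C) (z : C) : C :=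
  sum_n_m (G := C_AbelianMonoid) (fun i => (c i * b i z)%C) 1 l.

(* [V], a linear space of functions on the upper half plane, has a basis
   b 1, ..., b l over C. *)
Definition has_dimension (V : (C -> C) -> Prop) (l : nat) : Prop :=
  exists b : nat -> C -> C,
    (forall i : nat, (1 <= i <= l)%nat -> V (b i)) /\
    (forall c : nat -> C,
       (forall z : C, upper_half_plane z -> lincomb l c b z = RtoC 0) ->
       forall i : nat, (1 <= i <= l)%nat -> c i = RtoC 0) /\
    (forall f : C -> C, V f ->
       exists c : nat -> C,
         forall z : C, upper_half_plane z -> f z = lincomb l c b z).

(* For 0 < x this is the real power x ^ y; Stdlib's Rpower has the junk value
   Rpower 0 y = 1, whereas 0 ^ y = 0 for 0 < y. *)
Definition rpow (x y : R) : R :=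
  if Req_EM_T x 0 then 0 else Rpower x y.

Definition threshold (k l : nat) : R :=
  exp (58.366 / (INR k - 2))
  * rpow (INR l ^ 3 * ln (INR k)) (1 / (INR k - 2))
  * (1.0242382 * INR l).

(* Main.v *)
Require Import Defs.
From Stdlib Require Import Lra Lia Psatz.

(** Write F = E_k + g with E_k the Eisenstein series and g a cusp form, and put
    l = k / 12. For 1 <= m <= l the coefficient of q^m in g is minus that of E_k,
    so it suffices to bound a cusp form by its first l coefficients.
    Let Delta = q prod (1 - q^n)^24. The function |g| / |Delta|^(k/12) is invariant
    under the modular group and equals |U| |q|^(-k/12) for a power series U in q.
    Split U = U_A + U_T, where U_A collects the powers q^i with i <= l. On a line
    Im z = y1 < 1 every point is equivalent to one lying higher, so there |U_T| is
    controlled by the maximum N of the invariant function on a compact strip and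
    by U_A; as U_T vanishes to order l + 1 > k/12, it gets smaller by a fixed factor
    on passing from the line to the strip. Hence N is bounded by a multiple of the
    maximum of |U_A| |q|^(-k/12), and Hecke's estimate of the coefficients of g
    follows with explicit constants. If the first l coefficients vanish,
    this gives g = 0; applied to the difference of F and its complex conjugate,
    it shows that F has real coefficients.
    Two classical facts are needed along the way. The Lipschitz formula comes from
    the functional equation f(z/2) + f((z+1)/2) = 4 f(z), shared by the sum of
    (z+d)^(-2) and its q-series, which forces a bounded solution to vanish.
    The forms Delta^m E_(k-12m), for 1 <= m <= l, show that dim S_k >= l. *)

(** * Complex series *)

(** Divisibility of k by 4 enters twice. It makes (2 pi i)^k positive, so E_k has positive
    coefficients, and it leaves k mod 12 in {0, 4, 8}, so that l + 1 - k/12 >= 1/3: this exponent is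
    what the tail U_T gains between the line and the strip, and without a gap bounded below there
    would be no fixed factor. The coefficients of g up to q^l and those of E_k carry the same factor
    [eis_const], which cancels. What remains is n^(k-1) against l^(k/2+1) n^(k/2) exp(14 + 2k (hF +
    2 hY)), where hF and hY bound the logarithm of prod (1 - q^n) at heights 43/50 and 20/11.
    Dividing by n^(k/2) and taking the root of order k/2 - 1 gives the shape of the threshold:
    1.0242382 pays for the exponential rate in k, exp(58.366/(k-2)) for the fixed constants, and
    (l^3 log k)^(1/(k-2)) for most of the factor (l+1)^2. Contour integrals are avoided throughout:
    coefficients come from averages over roots of unity, identities between functions from a
    vanishing derivative, and Taylor estimates from a complex mean value inequality. *)

Lemma ex_series_pos_bounded (a : nat -> R) (M : R) :
  (forall n, 0 <= a n) -> (forall n, sum_n a n <= M) ->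
  ex_series a /\ Series a <= M.
Proof.
intros Hp HM.
assert (Hex : ex_finite_lim_seq (sum_n a)).
{ apply (ex_finite_lim_seq_incr _ M); [ | exact HM].
  intros n; rewrite sum_Sn; unfold plus; simpl; specialize (Hp (S n)); lra. }
assert (Hs : ex_series a).
{ destruct Hex as [l Hl]; exists l; exact Hl. }
split; [exact Hs | ].
apply (is_lim_seq_le (sum_n a) (fun _ => M) (Series a) M HM).
- exact (Series_correct a Hs).
- apply is_lim_seq_const.
Qed.

Lemma sum_n_pos_mono (a : nat -> R) (n m : nat) :
  (forall i, 0 <= a i) -> (n <= m)%nat -> sum_n a n <= sum_n a m.
Proof.
intros Hp; induction 1; [lra | ].
rewrite sum_Sn; unfold plus; simpl; specialize (Hp (S m)); lra.
Qed.

Lemma Series_pos_partial (a : nat -> R) (n : nat) :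
  (forall i, 0 <= a i) -> ex_series a -> sum_n a n <= Series a.
Proof.
intros Hp Hs.
apply (is_lim_seq_le_loc (fun _ => sum_n a n) (sum_n a) (sum_n a n) (Series a)).
- exists n; intros m Hm; apply sum_n_pos_mono; auto.
- apply is_lim_seq_const.
- exact (Series_correct a Hs).
Qed.

Lemma Series_pos_term (a : nat -> R) (n : nat) :
  (forall i, 0 <= a i) -> ex_series a -> a n <= Series a.
Proof.
intros Hp Hs; apply Rle_trans with (sum_n a n).
- destruct n; [rewrite sum_O; lra | ].
  rewrite sum_Sn; unfold plus; simpl.
  assert (0 <= sum_n a n); [ | lra].
  apply Rle_trans with (sum_n a 0); [rewrite sum_O; auto | ].
  apply sum_n_pos_mono; auto; lia.
- apply Series_pos_partial; auto.
Qed.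

Lemma Series_pos (a : nat -> R) : (forall i, 0 <= a i) -> ex_series a -> 0 <= Series a.
Proof. intros Hp Hs; apply Rle_trans with (a 0%nat); auto; apply Series_pos_term; auto. Qed.

Lemma Series_mono (a b : nat -> R) :
  (forall n, a n <= b n) -> ex_series a -> ex_series b -> Series a <= Series b.
Proof.
intros H Ha Hb.
apply (is_lim_seq_le (sum_n a) (sum_n b) (Series a) (Series b)).
- intros n; induction n; [rewrite !sum_O; auto | ].
  rewrite !sum_Sn; unfold plus; simpl; specialize (H (S n)); lra.
- exact (Series_correct a Ha).
- exact (Series_correct b Hb).
Qed.

Lemma ex_series_le_pos (a b : nat -> R) :
  (forall n, 0 <= a n <= b n) -> ex_series b -> ex_series a.
Proof.
intros H; apply (ex_series_le (K := R_AbsRing) (V := R_CompleteNormedModule) a).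
intros n; unfold norm; simpl; unfold abs; simpl; rewrite Rabs_pos_eq; apply H.
Qed.

Lemma Series_sum_swap (u : nat -> nat -> R) (J : nat) :
  (forall j, ex_series (fun i => u i j)) ->
  ex_series (fun i => sum_n (u i) J) /\
  Series (fun i => sum_n (u i) J) = sum_n (fun j => Series (fun i => u i j)) J.
Proof.
intros H; induction J as [|J [IH1 IH2]].
- split.
  + apply ex_series_ext with (fun i => u i 0%nat); auto.
    intros; rewrite sum_O; reflexivity.
  + rewrite sum_O; apply Series_ext; intros; apply sum_O.
- split.
  + apply ex_series_ext with (fun i => plus (sum_n (u i) J) (u i (S J))).
    * intros; rewrite sum_Sn; reflexivity.
    * apply (ex_series_plus (fun i => sum_n (u i) J) (fun i => u i (S J))); auto.
  + rewrite sum_Sn, <- IH2; unfold plus; simpl.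
    rewrite <- Series_plus; auto.
    apply Series_ext; intros; rewrite sum_Sn; reflexivity.
Qed.

(** A partial sum of the column sums is a sum over the rows of partial row sums, hence at most the
    total of the row sums. Applied to the transpose as well, the inequality becomes an equality. *)
Lemma Fubini_pos_le (u : nat -> nat -> R) :
  (forall i j, 0 <= u i j) ->
  (forall i, ex_series (u i)) -> ex_series (fun i => Series (u i)) ->
  (forall j, ex_series (fun i => u i j)) /\
  ex_series (fun j => Series (fun i => u i j)) /\
  Series (fun j => Series (fun i => u i j)) <= Series (fun i => Series (u i)).
Proof.
intros Hp Hi Hs.
assert (Hj : forall j, ex_series (fun i => u i j)).
{ intros j; apply ex_series_le_pos with (fun i => Series (u i)); auto.
  intros i; split; auto; apply Series_pos_term; auto. }
split; [exact Hj | ].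
apply ex_series_pos_bounded.
- intros j; apply Series_pos; auto.
- intros J; destruct (Series_sum_swap u J Hj) as [E1 E2]; rewrite <- E2.
  apply Series_mono; auto.
  intros i; apply Series_pos_partial; auto.
Qed.

Lemma Fubini_pos (u : nat -> nat -> R) :
  (forall i j, 0 <= u i j) ->
  (forall i, ex_series (u i)) -> ex_series (fun i => Series (u i)) ->
  (forall j, ex_series (fun i => u i j)) /\
  ex_series (fun j => Series (fun i => u i j)) /\
  Series (fun i => Series (u i)) = Series (fun j => Series (fun i => u i j)).
Proof.
intros Hp Hi Hs.
destruct (Fubini_pos_le u Hp Hi Hs) as (A & B & D).
destruct (Fubini_pos_le (fun j i => u i j)) as (_ & _ & D'); auto.
repeat split; auto; apply Rle_antisym; auto.
Qed.

(** Both [v + w] and [w] are nonnegative, so the nonnegative case applies to each, and [v] is their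
    difference. *)
Lemma Fubini_real (v w : nat -> nat -> R) :
  (forall i j, Rabs (v i j) <= w i j) ->
  (forall i, ex_series (w i)) -> ex_series (fun i => Series (w i)) ->
  Series (fun i => Series (v i)) = Series (fun j => Series (fun i => v i j)).
Proof.
intros Hv Hi Hs.
assert (Hb : forall i j, 0 <= v i j + w i j <= 2 * w i j).
{ intros i j; specialize (Hv i j); apply Rabs_le_between in Hv; lra. }
assert (Hw : forall i j, 0 <= w i j).
{ intros i j; specialize (Hb i j); lra. }
assert (Hi2 : forall i, ex_series (fun j => v i j + w i j)).
{ intros i; apply ex_series_le_pos with (fun j => 2 * w i j); auto.
  apply (ex_series_scal_l 2 (w i)); auto. }
destruct (Fubini_pos w) as (A & B & D); auto.
destruct (Fubini_pos (fun i j => v i j + w i j)) as (A' & B' & D'); auto.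
{ intros i j; apply Hb. }
{ apply ex_series_le_pos with (fun i => 2 * Series (w i)).
  - intros i; split; [apply Series_pos; auto; intros; apply Hb | ].
    rewrite <- Series_scal_l; apply Series_mono; auto.
    + intros; apply Hb.
    + apply (ex_series_scal_l 2 (w i)); auto.
  - apply (ex_series_scal_l 2 (fun i => Series (w i))); auto. }
assert (Hsi : ex_series (fun i => Series (fun j => v i j + w i j))).
{ apply ex_series_le_pos with (fun i => 2 * Series (w i)).
  - intros i; split; [apply Series_pos; auto; intros; apply Hb | ].
    rewrite <- Series_scal_l; apply Series_mono; auto.
    + intros; apply Hb.
    + apply (ex_series_scal_l 2 (w i)); auto.
  - apply (ex_series_scal_l 2 (fun i => Series (w i))); auto. }
rewrite (Series_ext (fun i => Series (v i))
  (fun i => Series (fun j => v i j + w i j) - Series (w i))).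
2:{ intros i; rewrite <- Series_minus; auto; apply Series_ext; intros; ring. }
rewrite (Series_ext (fun j => Series (fun i => v i j))
  (fun j => Series (fun i => v i j + w i j) - Series (fun i => w i j))).
2:{ intros j; rewrite <- Series_minus; auto; apply Series_ext; intros; ring. }
rewrite !Series_minus; auto.
rewrite D, D'; reflexivity.
Qed.

(* Complex series are handled through absolute convergence; [csum] is only
   meaningful for sequences satisfying [acv]. *)
Definition acv (a : nat -> C) : Prop := ex_series (fun n => Cmod (a n)).
Definition csum (a : nat -> C) : C :=
  (Series (fun n => Re (a n)), Series (fun n => Im (a n))).

Fixpoint csumn (a : nat -> C) (n : nat) : C :=
  match n with O => RtoC 0 | S m => (csumn a m + a m)%C end.

Lemma C_eq (a b : C) : Re a = Re b -> Im a = Im b -> a = b.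
Proof. destruct a, b; simpl; intros; subst; reflexivity. Qed.

Lemma Re_le_Cmod (z : C) : Rabs (Re z) <= Cmod z.
Proof. apply re_le_Cmod. Qed.

Lemma Im_le_Cmod (z : C) : Rabs (Im z) <= Cmod z.
Proof.
apply Rle_trans with (Rmax (Rabs (fst z)) (Rabs (snd z))).
- apply Rmax_r.
- apply Rmax_Cmod.
Qed.

Lemma Cmod_le_ReIm (z : C) : Cmod z <= Rabs (Re z) + Rabs (Im z).
Proof.
destruct z as [x y]; unfold Re, Im; simpl.
replace (x, y) with (RtoC x + Ci * RtoC y)%C.
2:{ apply C_eq; simpl; ring. }
eapply Rle_trans; [apply Cmod_triangle | ].
rewrite Cmod_mult, Cmod_Ci, !Cmod_R; lra.
Qed.

Lemma acv_ex_Re (a : nat -> C) : acv a -> ex_series (fun n => Re (a n)).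
Proof.
apply (ex_series_le (K := R_AbsRing) (V := R_CompleteNormedModule)).
intros n; apply Re_le_Cmod.
Qed.

Lemma acv_ex_Im (a : nat -> C) : acv a -> ex_series (fun n => Im (a n)).
Proof.
apply (ex_series_le (K := R_AbsRing) (V := R_CompleteNormedModule)).
intros n; apply Im_le_Cmod.
Qed.

Lemma acv_le (a : nat -> C) (b : nat -> R) :
  (forall n, Cmod (a n) <= b n) -> ex_series b -> acv a.
Proof.
intros H; apply ex_series_le_pos; intros n; split; auto; apply Cmod_ge_0.
Qed.

Lemma acv_ext (a b : nat -> C) : (forall n, a n = b n) -> acv a -> acv b.
Proof. intros H; apply ex_series_ext; intros; rewrite H; reflexivity. Qed.

Lemma csum_ext (a b : nat -> C) : (forall n, a n = b n) -> csum a = csum b.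
Proof.
intros H; unfold csum; f_equal; apply Series_ext; intros; rewrite H; reflexivity.
Qed.

Lemma acv_plus (a b : nat -> C) : acv a -> acv b -> acv (fun n => a n + b n)%C.
Proof.
intros Ha Hb; apply acv_le with (fun n => Cmod (a n) + Cmod (b n)).
- intros; apply Cmod_triangle.
- apply (ex_series_plus _ _ Ha Hb).
Qed.

Lemma acv_scal (c : C) (a : nat -> C) : acv a -> acv (fun n => c * a n)%C.
Proof.
intros Ha; apply acv_le with (fun n => Cmod c * Cmod (a n)).
- intros; rewrite Cmod_mult; lra.
- apply (ex_series_scal_l (Cmod c) _ Ha).
Qed.

Lemma csum_plus (a b : nat -> C) : acv a -> acv b ->
  csum (fun n => a n + b n)%C = (csum a + csum b)%C.
Proof.
intros Ha Hb; apply C_eq; simpl.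
- rewrite <- Series_plus; auto using acv_ex_Re.
- rewrite <- Series_plus; auto using acv_ex_Im.
Qed.

Lemma csum_scal (c : C) (a : nat -> C) : acv a ->
  csum (fun n => c * a n)%C = (c * csum a)%C.
Proof.
intros Ha; destruct c as [x y]; pose proof (acv_ex_Re a Ha); pose proof (acv_ex_Im a Ha).
assert (E : forall t (b : nat -> R), ex_series b -> ex_series (fun n => t * b n)).
{ intros t b Hb; apply (ex_series_scal_l t b Hb). }
apply C_eq; simpl.
- rewrite <- !Series_scal_l, <- Series_minus; auto.
- rewrite <- !Series_scal_l, <- Series_plus; auto.
Qed.

Lemma acv_opp (a : nat -> C) : acv a -> acv (fun n => - a n)%C.
Proof. apply ex_series_ext; intros; rewrite Cmod_opp; reflexivity. Qed.

Lemma csum_opp (a : nat -> C) : acv a -> csum (fun n => - a n)%C = (- csum a)%C.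
Proof.
intros Ha; rewrite (csum_ext _ (fun n => (-1) * a n)%C) by (intros; ring).
rewrite csum_scal by auto; ring.
Qed.

Lemma acv_minus (a b : nat -> C) : acv a -> acv b -> acv (fun n => a n - b n)%C.
Proof. intros; apply acv_plus; auto; apply acv_opp; auto. Qed.

Lemma csum_minus (a b : nat -> C) : acv a -> acv b ->
  csum (fun n => a n - b n)%C = (csum a - csum b)%C.
Proof.
intros; unfold Cminus; rewrite csum_plus, csum_opp; auto; apply acv_opp; auto.
Qed.

Lemma acv_incr (a : nat -> C) : acv a <-> acv (fun n => a (S n)).
Proof. apply (ex_series_incr_1 (fun n => Cmod (a n))). Qed.

Lemma csum_incr (a : nat -> C) : acv a ->
  csum a = (a 0%nat + csum (fun n => a (S n)))%C.
Proof.
intros Ha; apply C_eq; simpl; rewrite Series_incr_1; auto using acv_ex_Re, acv_ex_Im.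
Qed.

Lemma csumn_ext (a b : nat -> C) (n : nat) :
  (forall i, (i < n)%nat -> a i = b i) -> csumn a n = csumn b n.
Proof.
induction n; intros H; simpl; auto.
rewrite IHn, H; auto.
Qed.

Lemma acv_shift (a : nat -> C) (N : nat) : acv a -> acv (fun n => a (N + n)%nat).
Proof.
intros Ha; induction N; [exact Ha | ].
apply acv_incr in IHN; revert IHN; apply acv_ext; intros; f_equal; lia.
Qed.

Lemma acv_unshift (a : nat -> C) (N : nat) : acv (fun n => a (N + n)%nat) -> acv a.
Proof.
induction N; [auto | ].
intros H; apply IHN; apply acv_incr; revert H; apply acv_ext; intros; f_equal; lia.
Qed.

Lemma csum_shift (a : nat -> C) (N : nat) : acv a ->
  csum a = (csumn a N + csum (fun n => a (N + n)%nat))%C.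
Proof.
intros Ha; induction N; simpl csumn.
- change (fun n => a (0 + n)%nat) with a; ring.
- rewrite IHN, (csum_incr (fun n => a (N + n)%nat)) by (apply acv_shift; auto).
  rewrite Nat.add_0_r.
  rewrite (csum_ext (fun n => a (S N + n)%nat) (fun n => a (N + S n)%nat)); [ring | ].
  intros; f_equal; lia.
Qed.

Lemma is_series_0 (a : nat -> R) : (forall n, a n = 0) -> is_series a 0.
Proof.
intros H; assert (E : is_lim_seq (sum_n a) 0); [ | exact E].
apply (is_lim_seq_ext (fun _ => 0)); [ | apply is_lim_seq_const].
intros n; induction n; [rewrite sum_O | rewrite sum_Sn, <- IHn]; rewrite H;
  unfold plus; simpl; ring.
Qed.

Lemma csum_0 (a : nat -> C) : (forall n, a n = RtoC 0) -> csum a = RtoC 0.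
Proof.
intros H; apply C_eq; simpl; apply is_series_unique, is_series_0;
  intros; rewrite H; reflexivity.
Qed.

Lemma acv_0 (a : nat -> C) : (forall n, a n = RtoC 0) -> acv a.
Proof.
intros H; exists 0; apply is_series_0; intros; rewrite H, Cmod_0; reflexivity.
Qed.

Lemma acv_finite (a : nat -> C) (N : nat) :
  (forall n, (N <= n)%nat -> a n = RtoC 0) -> acv a.
Proof. intros H; apply acv_unshift with N, acv_0; intros; apply H; lia. Qed.

Lemma csum_finite (a : nat -> C) (N : nat) :
  (forall n, (N <= n)%nat -> a n = RtoC 0) -> csum a = csumn a N.
Proof.
intros H; rewrite (csum_shift a N) by (apply acv_finite with N; auto).
rewrite (csum_0 (fun n => a (N + n)%nat)); [ring | intros; apply H; lia].
Qed.

Lemma is_series_csum (a : nat -> C) : acv a ->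
  is_series (K := C_AbsRing) (V := C_NormedModule) a (csum a).
Proof.
intros Ha; unfold is_series.
assert (E : forall n, sum_n (G := C_NormedModule) a n
   = (sum_n (fun n => Re (a n)) n, sum_n (fun n => Im (a n)) n)).
{ intros n; induction n; [rewrite !sum_O; destruct (a 0%nat); reflexivity | ].
  rewrite !sum_Sn, IHn; destruct (a (S n)); reflexivity. }
apply (proj2 (filterlim_locally (U := C_NormedModule) (F := eventually) _ (csum a))).
intros eps.
generalize (proj1 (filterlim_locally (F := eventually) _ _) (Series_correct _ (acv_ex_Re a Ha)) eps).
generalize (proj1 (filterlim_locally (F := eventually) _ _) (Series_correct _ (acv_ex_Im a Ha)) eps).
intros [N1 H1] [N2 H2]; exists (N1 + N2)%nat; intros n Hn; rewrite E; split; simpl.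
- apply H2; lia.
- apply H1; lia.
Qed.

Lemma sum_n_csumn (a : nat -> C) (n : nat) :
  sum_n (G := C_NormedModule) a n = csumn a (S n).
Proof.
induction n.
- rewrite sum_O; simpl; change (a 0%nat = 0 + a 0%nat)%C; ring.
- rewrite sum_Sn, IHn; reflexivity.
Qed.

Lemma csumn_lim (a : nat -> C) (eps : R) : acv a -> 0 < eps ->
  exists N, forall n, (N <= n)%nat -> Cmod (csum a - csumn a n) < eps.
Proof.
intros Ha He.
assert (He2 : 0 < eps / 2) by lra.
generalize (proj1 (filterlim_locally (U := C_NormedModule) (F := eventually) _ _) (is_series_csum a Ha) (mkposreal _ He2)).
intros [N HN]; exists (S N); intros n Hn.
destruct n as [|n]; [lia | ].
specialize (HN n ltac:(lia)); rewrite sum_n_csumn in HN.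
destruct HN as [H1 H2].
change (Rabs (Re (csumn a (S n)) + - Re (csum a)) < eps / 2) in H1.
change (Rabs (Im (csumn a (S n)) + - Im (csum a)) < eps / 2) in H2.
eapply Rle_lt_trans; [apply Cmod_le_ReIm | ].
change (Rabs (Re (csum a) + - Re (csumn a (S n))) + Rabs (Im (csum a) + - Im (csumn a (S n))) < eps).
rewrite <- Rabs_Ropp in H1; rewrite <- Rabs_Ropp in H2.
replace (Re (csum a) + - Re (csumn a (S n))) with (- (Re (csumn a (S n)) + - Re (csum a))) by ring.
replace (Im (csum a) + - Im (csumn a (S n))) with (- (Im (csumn a (S n)) + - Im (csum a))) by ring.
lra.
Qed.

Lemma Cmod_csumn_le (a : nat -> C) (n : nat) :
  acv a -> Cmod (csumn a n) <= Series (fun n => Cmod (a n)).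
Proof.
intros Ha.
assert (H : forall n, Cmod (csumn a (S n)) <= sum_n (fun n => Cmod (a n)) n).
{ clear n; intros n; induction n.
  - rewrite sum_O; simpl; rewrite Cplus_0_l; lra.
  - rewrite sum_Sn; unfold plus; simpl.
    eapply Rle_trans; [apply Cmod_triangle | ]; simpl in IHn; lra. }
destruct n.
- simpl; rewrite Cmod_0; apply Series_pos; auto; intros; apply Cmod_ge_0.
- eapply Rle_trans; [apply H | apply Series_pos_partial; auto]; intros; apply Cmod_ge_0.
Qed.

Lemma Rle_eps (x y : R) : (forall eps, 0 < eps -> x <= y + eps) -> x <= y.
Proof.
intros H; destruct (Rle_dec x y); auto.
specialize (H ((x - y) / 2)); lra.
Qed.

Lemma Cmod_csum_le_partial (a : nat -> C) (M : R) :
  acv a -> (forall n, exists m, (n <= m)%nat /\ Cmod (csumn a m) <= M) -> Cmod (csum a) <= M.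
Proof.
intros Ha H; apply Rle_eps; intros eps He.
destruct (csumn_lim a eps Ha He) as [N HN].
destruct (H N) as (m & Hm & HM); specialize (HN m Hm).
replace (csum a) with ((csum a - csumn a m) + csumn a m)%C by ring.
eapply Rle_trans; [apply Cmod_triangle | lra].
Qed.

Lemma Cmod_csum_le (a : nat -> C) : acv a -> Cmod (csum a) <= Series (fun n => Cmod (a n)).
Proof.
intros Ha; apply Cmod_csum_le_partial; auto.
intros n; exists n; split; auto; apply Cmod_csumn_le; auto.
Qed.

Lemma Cmod_csum_le_maj (a : nat -> C) (b : nat -> R) :
  (forall n, Cmod (a n) <= b n) -> ex_series b -> Cmod (csum a) <= Series b.
Proof.
intros H Hb; pose proof (acv_le a b H Hb) as Ha.
eapply Rle_trans; [apply Cmod_csum_le; auto | apply Series_mono; auto].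
Qed.

Lemma Cminus_eq_0 (a b : C) : (forall eps, 0 < eps -> Cmod (a - b) <= eps) -> a = b.
Proof.
intros H.
assert (E : Cmod (a - b) = 0).
{ apply Rle_antisym; [ | apply Cmod_ge_0].
  apply Rle_eps; intros eps He; specialize (H eps He); lra. }
apply Cmod_eq_0 in E; replace a with ((a - b) + b)%C by ring; rewrite E; ring.
Qed.

(** Convergence being known, it suffices that partial sums come near [l] arbitrarily far out. This
    fits telescoping and reindexed series, whose partial sums are computed only along some indices
    or up to a small remainder. *)
Lemma csum_unique (a : nat -> C) (l : C) : acv a ->
  (forall eps, 0 < eps -> forall N, exists n, (N <= n)%nat /\ Cmod (csumn a n - l) <= eps) ->
  csum a = l.
Proof.
intros Ha H; apply Cminus_eq_0; intros eps He.
destruct (csumn_lim a (eps / 2) Ha ltac:(lra)) as [N HN].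
destruct (H (eps / 2) ltac:(lra) N) as (n & Hn & Hm); specialize (HN n Hn).
replace (csum a - l)%C with ((csum a - csumn a n) + (csumn a n - l))%C by ring.
eapply Rle_trans; [apply Cmod_triangle | lra].
Qed.

Lemma csum_Fubini (u : nat -> nat -> C) :
  (forall i, acv (u i)) -> ex_series (fun i => Series (fun j => Cmod (u i j))) ->
  (forall j, acv (fun i => u i j)) /\
  acv (fun i => csum (u i)) /\
  acv (fun j => csum (fun i => u i j)) /\
  ex_series (fun j => Series (fun i => Cmod (u i j))) /\
  csum (fun i => csum (u i)) = csum (fun j => csum (fun i => u i j)).
Proof.
intros Hi Hs.
destruct (Fubini_pos (fun i j => Cmod (u i j))) as (A & B & D); auto.
{ intros; apply Cmod_ge_0. }
repeat split; auto.
- apply acv_le with (fun i => Series (fun j => Cmod (u i j))); auto.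
  intros; apply Cmod_csum_le; auto.
- apply acv_le with (fun j => Series (fun i => Cmod (u i j))); auto.
  intros; apply Cmod_csum_le; auto; apply A.
- apply C_eq; simpl.
  + apply Fubini_real with (fun i j => Cmod (u i j)); auto; intros; apply Re_le_Cmod.
  + apply Fubini_real with (fun i j => Cmod (u i j)); auto; intros; apply Im_le_Cmod.
Qed.

Lemma csumn_plus (a b : nat -> C) (n : nat) :
  csumn (fun i => a i + b i)%C n = (csumn a n + csumn b n)%C.
Proof. induction n; simpl; [ring | rewrite IHn; ring]. Qed.

Lemma csumn_scal (c : C) (a : nat -> C) (n : nat) :
  csumn (fun i => c * a i)%C n = (c * csumn a n)%C.
Proof. induction n; simpl; [ring | rewrite IHn; ring]. Qed.

Lemma csumn_csum (u : nat -> nat -> C) (n : nat) :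
  (forall j, acv (u j)) ->
  acv (fun i => csumn (fun j => u j i) n) /\
  csumn (fun j => csum (u j)) n = csum (fun i => csumn (fun j => u j i) n).
Proof.
intros H; induction n as [|n [IH1 IH2]]; simpl.
- split; [apply acv_0; auto | rewrite csum_0; auto].
- split; [apply acv_plus; auto | rewrite csum_plus, IH2; auto].
Qed.

Lemma csumn_swap (u : nat -> nat -> C) (n m : nat) :
  csumn (fun i => csumn (u i) m) n = csumn (fun j => csumn (fun i => u i j) n) m.
Proof.
induction n; simpl.
- induction m; simpl; [auto | rewrite <- IHm; ring].
- rewrite IHn, <- csumn_plus; reflexivity.
Qed.

(** * Complex derivatives and power series *)

(* Complex differentiability with a quadratic error term: every function met
   here satisfies it, and it is easier to combine than little-o estimates. *)
Definition qderiv (f : C -> C) (x l : C) : Prop :=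
  exists K d : R, 0 <= K /\ 0 < d /\
    forall h : C, Cmod h <= d -> Cmod (f (x + h) - f x - h * l)%C <= K * Cmod h ^ 2.

Lemma qderiv_ext_loc (f g : C -> C) (x l : C) :
  (exists d, 0 < d /\ forall h, Cmod h <= d -> f (x + h)%C = g (x + h)%C) ->
  qderiv f x l -> qderiv g x l.
Proof.
intros (d & Hd & He) (K & d' & HK & Hd' & H).
exists K, (Rmin d d'); repeat split; auto.
- apply Rmin_glb_lt; auto.
- intros h Hh.
  assert (E : f x = g x).
  { specialize (He 0%C); rewrite Cmod_0, Cplus_0_r in He; apply He; lra. }
  rewrite <- He, <- E by (eapply Rle_trans; [apply Hh | apply Rmin_l]).
  apply H; eapply Rle_trans; [apply Hh | apply Rmin_r].
Qed.

Lemma qderiv_ext (f g : C -> C) (x l : C) :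
  (forall y, f y = g y) -> qderiv f x l -> qderiv g x l.
Proof. intros H; apply qderiv_ext_loc; exists 1; split; [lra | auto]. Qed.

Lemma qderiv_eq (f : C -> C) (x l m : C) : qderiv f x l -> l = m -> qderiv f x m.
Proof. intros H E; subst; auto. Qed.

Lemma qderiv_const (c x : C) : qderiv (fun _ => c) x 0.
Proof.
exists 0, 1; repeat split; try lra; intros h _.
replace (c - c - h * 0)%C with (RtoC 0) by ring; rewrite Cmod_0; lra.
Qed.

Lemma qderiv_id (x : C) : qderiv (fun y => y) x 1.
Proof.
exists 0, 1; repeat split; try lra; intros h _.
replace (x + h - x - h * 1)%C with (RtoC 0) by ring; rewrite Cmod_0; lra.
Qed.

(** A single pair [K], [d] serves the second-order, Lipschitz and boundedness estimates, which is
    what the product and chain rules combine. *)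
Lemma qderiv_lip (f : C -> C) (x l : C) : qderiv f x l ->
  exists K d : R, 0 <= K /\ 0 < d <= 1 /\
    (forall h : C, Cmod h <= d -> Cmod (f (x + h) - f x - h * l)%C <= K * Cmod h ^ 2) /\
    (forall h : C, Cmod h <= d -> Cmod (f (x + h) - f x)%C <= K * Cmod h) /\
    (forall h : C, Cmod h <= d -> Cmod (f (x + h))%C <= K).
Proof.
intros (K & d & HK & Hd & H).
pose proof (Cmod_ge_0 l) as Hl; pose proof (Cmod_ge_0 (f x)) as Hf.
exists (K + Cmod l + Cmod (f x)), (Rmin d 1).
assert (Hm : 0 < Rmin d 1 <= 1) by (split; [apply Rmin_glb_lt; lra | apply Rmin_r]).
assert (B1 : forall h, Cmod h <= Rmin d 1 -> Cmod (f (x + h) - f x - h * l)%C <= K * Cmod h ^ 2).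
{ intros h Hh; apply H; eapply Rle_trans; [apply Hh | apply Rmin_l]. }
assert (B2 : forall h, Cmod h <= Rmin d 1 -> Cmod (f (x + h) - f x)%C <= (K + Cmod l) * Cmod h).
{ intros h Hh; specialize (B1 h Hh); pose proof (Cmod_ge_0 h).
  replace (f (x + h) - f x)%C with ((f (x + h) - f x - h * l) + h * l)%C by ring.
  eapply Rle_trans; [apply Cmod_triangle | rewrite Cmod_mult].
  assert (Cmod h <= 1) by lra.
  assert (K * Cmod h ^ 2 <= K * Cmod h) by (apply Rmult_le_compat_l; nra); lra. }
split; [lra | split; [auto | split; [ | split]]].
- intros h Hh; specialize (B1 h Hh); pose proof (Cmod_ge_0 h); nra.
- intros h Hh; specialize (B2 h Hh); pose proof (Cmod_ge_0 h); nra.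
- intros h Hh; specialize (B2 h Hh); pose proof (Cmod_ge_0 h).
  replace (f (x + h)%C) with ((f (x + h) - f x) + f x)%C by ring.
  eapply Rle_trans; [apply Cmod_triangle | ].
  assert (Cmod h <= 1) by lra; nra.
Qed.

Lemma qderiv_plus (f g : C -> C) (x l m : C) :
  qderiv f x l -> qderiv g x m -> qderiv (fun y => f y + g y)%C x (l + m)%C.
Proof.
intros (K & d & HK & Hd & H) (K' & d' & HK' & Hd' & H').
exists (K + K'), (Rmin d d'); repeat split; [lra | apply Rmin_glb_lt; auto | ].
intros h Hh.
replace (f (x + h) + g (x + h) - (f x + g x) - h * (l + m))%C
  with ((f (x + h) - f x - h * l) + (g (x + h) - g x - h * m))%C by ring.
eapply Rle_trans; [apply Cmod_triangle | ].
assert (A : Cmod h <= d) by (eapply Rle_trans; [apply Hh | apply Rmin_l]).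
assert (B : Cmod h <= d') by (eapply Rle_trans; [apply Hh | apply Rmin_r]).
specialize (H h A); specialize (H' h B); lra.
Qed.

Lemma qderiv_mult (f g : C -> C) (x l m : C) :
  qderiv f x l -> qderiv g x m -> qderiv (fun y => f y * g y)%C x (l * g x + f x * m)%C.
Proof.
intros Hf Hg.
destruct (qderiv_lip f x l Hf) as (K & d & HK & Hd & F1 & F2 & F3).
destruct (qderiv_lip g x m Hg) as (K' & d' & HK' & Hd' & G1 & G2 & G3).
pose proof (Cmod_ge_0 l) as Hl; pose proof (Cmod_ge_0 (f x)) as Hfx.
exists (K * K' + Cmod l * K' + Cmod (f x) * K'), (Rmin d d').
repeat split; [ | apply Rmin_glb_lt; lra | ].
{ apply Rplus_le_le_0_compat; [apply Rplus_le_le_0_compat | ]; apply Rmult_le_pos; auto. }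
intros h Hh.
assert (A : Cmod h <= d) by (eapply Rle_trans; [apply Hh | apply Rmin_l]).
assert (B : Cmod h <= d') by (eapply Rle_trans; [apply Hh | apply Rmin_r]).
specialize (F1 h A); specialize (G1 h B); specialize (G2 h B); specialize (G3 h B).
replace (f (x + h) * g (x + h) - f x * g x - h * (l * g x + f x * m))%C
  with ((f (x + h) - f x - h * l) * g (x + h) + l * (h * (g (x + h) - g x))
        + f x * (g (x + h) - g x - h * m))%C by ring.
eapply Rle_trans; [apply Cmod_triangle | ].
eapply Rle_trans; [apply Rplus_le_compat_r, Cmod_triangle | ].
rewrite !Cmod_mult.
pose proof (Cmod_ge_0 h) as H0.
set (N := Cmod h) in *.
assert (T1 : Cmod (f (x + h) - f x - h * l)%C * Cmod (g (x + h)%C) <= (K * N ^ 2) * K').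
{ apply Rmult_le_compat; auto using Cmod_ge_0. }
assert (T2 : Cmod l * (N * Cmod (g (x + h) - g x)%C) <= Cmod l * (N * (K' * N))).
{ apply Rmult_le_compat_l; auto; apply Rmult_le_compat_l; auto. }
assert (T3 : Cmod (f x) * Cmod (g (x + h) - g x - h * m)%C <= Cmod (f x) * (K' * N ^ 2)).
{ apply Rmult_le_compat_l; auto. }
eapply Rle_trans; [apply Rplus_le_compat; [apply Rplus_le_compat | ]; eassumption | ].
apply Req_le; ring.
Qed.

Lemma qderiv_scal (c : C) (f : C -> C) (x l : C) :
  qderiv f x l -> qderiv (fun y => c * f y)%C x (c * l)%C.
Proof.
intros H; eapply qderiv_eq; [apply qderiv_mult; [apply (qderiv_const c) | apply H] | ].
cbv beta; ring.
Qed.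

Lemma qderiv_opp (f : C -> C) (x l : C) : qderiv f x l -> qderiv (fun y => - f y)%C x (- l)%C.
Proof.
intros H; apply qderiv_ext with (fun y => (-1) * f y)%C; [intros; ring | ].
eapply qderiv_eq; [apply qderiv_scal, H | ring].
Qed.

Lemma qderiv_minus (f g : C -> C) (x l m : C) :
  qderiv f x l -> qderiv g x m -> qderiv (fun y => f y - g y)%C x (l - m)%C.
Proof. intros; apply qderiv_plus; auto; apply qderiv_opp; auto. Qed.

Lemma qderiv_comp (f g : C -> C) (x l m : C) :
  qderiv g x l -> qderiv f (g x) m -> qderiv (fun y => f (g y)) x (m * l)%C.
Proof.
intros Hg (K & d & HK & Hd & H).
destruct (qderiv_lip g x l Hg) as (K' & d' & HK' & Hd' & G1 & G2 & _).
pose proof (Cmod_ge_0 m) as Hm.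
exists (K * K' ^ 2 + Cmod m * K'), (Rmin d' (d / (K' + 1))).
repeat split.
- apply Rplus_le_le_0_compat; apply Rmult_le_pos; auto; apply pow_le; auto.
- apply Rmin_glb_lt; [lra | ]; apply Rdiv_lt_0_compat; lra.
- intros h Hh.
  assert (A : Cmod h <= d') by (eapply Rle_trans; [apply Hh | apply Rmin_l]).
  assert (B : Cmod h <= d / (K' + 1)) by (eapply Rle_trans; [apply Hh | apply Rmin_r]).
  specialize (G1 h A); specialize (G2 h A).
  set (k := (g (x + h) - g x)%C) in *.
  pose proof (Cmod_ge_0 h) as H0.
  assert (Hk : Cmod k <= d).
  { eapply Rle_trans; [apply G2 | ].
    apply Rle_trans with ((K' + 1) * Cmod h); [nra | ].
    apply (Rmult_le_compat_l (K' + 1)) in B; [ | lra].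
    replace ((K' + 1) * (d / (K' + 1))) with d in B by (field; lra); auto. }
  specialize (H k Hk).
  replace (g x + k)%C with (g (x + h)%C) in H by (unfold k; ring).
  replace (f (g (x + h)) - f (g x) - h * (m * l))%C
    with ((f (g (x + h)) - f (g x) - k * m) + m * (k - h * l))%C by ring.
  eapply Rle_trans; [apply Cmod_triangle | rewrite Cmod_mult].
  assert (T : Cmod k ^ 2 <= (K' * Cmod h) ^ 2) by (apply pow_incr; split; auto; apply Cmod_ge_0).
  assert (T2 : K * Cmod k ^ 2 <= K * (K' * Cmod h) ^ 2) by (apply Rmult_le_compat_l; auto).
  assert (T3 : Cmod m * Cmod (k - h * l)%C <= Cmod m * (K' * Cmod h ^ 2)) by (apply Rmult_le_compat_l; auto).
  eapply Rle_trans; [apply Rplus_le_compat; [eapply Rle_trans; [exact H | exact T2] | exact T3] | ].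
  apply Req_le; ring.
Qed.

Lemma Cmod_triangle_inv (a b : C) : Cmod a - Cmod b <= Cmod (a + b).
Proof.
replace a with ((a + b) + - b)%C at 1 by ring.
pose proof (Cmod_triangle (a + b) (- b)); rewrite Cmod_opp in H; lra.
Qed.

Lemma Cmod_pos (x : C) : x <> 0%C -> 0 < Cmod x.
Proof. apply Cmod_gt_0. Qed.

Lemma Cmod_neq_0 (x : C) : 0 < Cmod x -> x <> 0%C.
Proof. apply Cmod_gt_0. Qed.

Lemma qderiv_inv (x : C) : x <> 0%C -> qderiv (fun y => / y)%C x (- (/ (x * x)))%C.
Proof.
intros Hx; pose proof (Cmod_pos x Hx) as Hp.
exists (2 / Cmod x ^ 3), (Cmod x / 2).
assert (P3 : 0 < Cmod x ^ 3) by (apply pow_lt; auto).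
repeat split; [apply Rlt_le, Rdiv_lt_0_compat; lra | lra | ].
intros h Hh.
pose proof (Cmod_triangle_inv x h) as T.
assert (Hxh : (x + h)%C <> 0%C) by (apply Cmod_neq_0; lra).
replace (/ (x + h) - / x - h * - / (x * x))%C with (h * h / (x * x * (x + h)))%C by (field; auto).
rewrite Cmod_div by (repeat apply Cmult_neq_0; auto).
rewrite !Cmod_mult.
replace (2 / Cmod x ^ 3 * Cmod h ^ 2)
  with (Cmod h * Cmod h * / (Cmod x * Cmod x * (Cmod x / 2))) by (field; lra).
unfold Rdiv at 1; apply Rmult_le_compat_l; [apply Rmult_le_pos; apply Cmod_ge_0 | ].
apply Rinv_le_contravar; [repeat apply Rmult_lt_0_compat; lra | ].
apply Rmult_le_compat_l; [apply Rmult_le_pos; lra | lra].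
Qed.

Lemma qderiv_unique (f : C -> C) (x l m : C) : qderiv f x l -> qderiv f x m -> l = m.
Proof.
intros (K & d & HK & Hd & H) (K' & d' & HK' & Hd' & H').
apply Cminus_eq_0; intros eps He.
set (t := Rmin (Rmin d d') (eps / (K + K' + 1))).
assert (Ht : 0 < t).
{ apply Rmin_glb_lt; [apply Rmin_glb_lt; auto | apply Rdiv_lt_0_compat; lra]. }
assert (Ct : Cmod (RtoC t) = t) by (rewrite Cmod_R; apply Rabs_pos_eq; lra).
assert (A1 : t <= d) by (eapply Rle_trans; [apply Rmin_l | apply Rmin_l]).
assert (A2 : t <= d') by (eapply Rle_trans; [apply Rmin_l | apply Rmin_r]).
assert (A3 : t <= eps / (K + K' + 1)) by apply Rmin_r.
specialize (H (RtoC t)); specialize (H' (RtoC t)); rewrite Ct in H, H'.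
specialize (H A1); specialize (H' A2).
assert (E : Cmod (RtoC t * (l - m)) <= (K + K') * t ^ 2).
{ replace (RtoC t * (l - m))%C
    with ((f (x + RtoC t) - f x - RtoC t * m) + - (f (x + RtoC t) - f x - RtoC t * l))%C by ring.
  eapply Rle_trans; [apply Cmod_triangle | rewrite Cmod_opp; lra]. }
rewrite Cmod_mult, Ct in E.
assert (E2 : Cmod (l - m)%C <= (K + K') * t).
{ apply Rmult_le_reg_l with t; auto; eapply Rle_trans; [exact E | apply Req_le; ring]. }
eapply Rle_trans; [exact E2 | ].
apply (Rmult_le_compat_l (K + K' + 1)) in A3; [ | lra].
replace ((K + K' + 1) * (eps / (K + K' + 1))) with eps in A3 by (field; lra).
nra.
Qed.

Lemma qderiv_ex_derive (f : C -> C) (x l : C) : qderiv f x l ->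
  ex_derive (K := C_AbsRing) (V := C_NormedModule) f x.
Proof.
intros (K & d & HK & Hd & H); exists l; split.
- apply (is_linear_scal_l (K := C_AbsRing) (V := C_NormedModule) l).
- intros y Hy.
  assert (Ey : y = x).
  { symmetry; apply (is_filter_lim_locally_unique (K := C_AbsRing)
      (V := AbsRing_NormedModule C_AbsRing) x y); auto. }
  subst y; intros eps.
  set (t := Rmin d (eps / (K + 1))).
  assert (Ht : 0 < t).
  { apply Rmin_glb_lt; auto; apply Rdiv_lt_0_compat; [apply cond_pos | lra]. }
  assert (G : forall y : C, Cmod (y - x)%C < t ->
    Cmod (f y - f x - (y - x) * l)%C <= eps * Cmod (y - x)%C);
    [ | exists (mkposreal _ Ht); intros y Hy'; exact (G y Hy')].
  intros y Hy'.
  assert (A1 : Cmod (y - x)%C <= d) by (eapply Rle_trans; [apply Rlt_le, Hy' | apply Rmin_l]).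
  assert (A2 : Cmod (y - x)%C <= eps / (K + 1)) by (eapply Rle_trans; [apply Rlt_le, Hy' | apply Rmin_r]).
  specialize (H _ A1).
  replace (x + (y - x))%C with y in H by ring.
  eapply Rle_trans; [exact H | ].
  pose proof (Cmod_ge_0 (y - x)%C).
  apply (Rmult_le_compat_l (K + 1)) in A2; [ | lra].
  replace ((K + 1) * (eps / (K + 1))) with (pos eps) in A2 by (field; lra).
  set (N := Cmod (y - x)%C) in *; nra.
Qed.

Lemma is_derive_quad (phi : R -> R) (t l K d : R) : 0 <= K -> 0 < d ->
  (forall s, Rabs s <= d -> Rabs (phi (t + s) - phi t - s * l) <= K * s ^ 2) ->
  is_derive phi t l.
Proof.
intros HK Hd H; apply is_derive_Reals; intros eps He.
assert (Ht : 0 < Rmin d (eps / (K + 1))).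
{ apply Rmin_glb_lt; auto; apply Rdiv_lt_0_compat; lra. }
exists (mkposreal _ Ht); intros s Hs Hsd; simpl in Hsd.
assert (A1 : Rabs s <= d) by (eapply Rle_trans; [apply Rlt_le, Hsd | apply Rmin_l]).
assert (A2 : Rabs s < eps / (K + 1)) by (eapply Rlt_le_trans; [apply Hsd | apply Rmin_r]).
specialize (H s A1).
replace ((phi (t + s) - phi t) / s - l) with ((phi (t + s) - phi t - s * l) / s) by (field; auto).
unfold Rdiv; rewrite Rabs_mult, Rabs_inv.
assert (Ps : 0 < Rabs s) by (apply Rabs_pos_lt; auto).
apply Rmult_lt_reg_r with (Rabs s); auto.
rewrite Rmult_assoc, Rinv_l, Rmult_1_r by lra.
eapply Rle_lt_trans; [exact H | ].
rewrite <- (pow2_abs s).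
apply (Rmult_lt_compat_l (K + 1)) in A2; [ | lra].
replace ((K + 1) * (eps / (K + 1))) with eps in A2 by (field; lra).
nra.
Qed.

(** The real mean value theorem is applied to the real part of [f] along the segment times the
    conjugate of the total increment [D]. That real function increases by [Cmod D ^ 2], and one
    factor [Cmod D] cancels. *)
Lemma Cmvt (f : C -> C) (f' : R -> C) (x y : C) (M : R) :
  (forall t, 0 <= t <= 1 ->
     qderiv f (x + RtoC t * (y - x))%C (f' t) /\ Cmod (f' t) <= M) ->
  Cmod (f y - f x)%C <= M * Cmod (y - x)%C.
Proof.
intros H.
set (v := (y - x)%C); set (D := (f y - f x)%C).
set (phi := fun t : R => Re (Cconj D * f (x + RtoC t * v)%C)%C).
assert (Hd : forall t, 0 <= t <= 1 -> is_derive phi t (Re (Cconj D * (v * f' t))%C)).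
{ intros t Ht; destruct (H t Ht) as [(K & d & HK & Hd & Hq) _].
  pose proof (Cmod_ge_0 v) as Hv; pose proof (Cmod_ge_0 D) as HD.
  apply (is_derive_quad phi t _ (Cmod D * (K * Cmod v ^ 2)) (d / (Cmod v + 1))).
  - apply Rmult_le_pos; auto; apply Rmult_le_pos; auto; apply pow_le; auto.
  - apply Rdiv_lt_0_compat; lra.
  - intros s Hs.
    assert (A : Cmod (RtoC s * v)%C <= d).
    { rewrite Cmod_mult, Cmod_R.
      apply (Rmult_le_compat_l (Cmod v + 1)) in Hs; [ | lra].
      replace ((Cmod v + 1) * (d / (Cmod v + 1))) with d in Hs by (field; lra).
      pose proof (Rabs_pos s); nra. }
    specialize (Hq _ A); fold v in Hq.
    unfold phi.
    replace (x + RtoC (t + s) * v)%C with (x + RtoC t * v + RtoC s * v)%C by (rewrite RtoC_plus; ring).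
    set (a := f (x + RtoC t * v + RtoC s * v)%C) in *.
    set (b := f (x + RtoC t * v)%C) in *.
    replace (Re (Cconj D * a)%C - Re (Cconj D * b)%C - s * Re (Cconj D * (v * f' t))%C)
      with (Re (Cconj D * (a - b - RtoC s * v * f' t))%C).
    2:{ unfold Re, Im; simpl; ring. }
    eapply Rle_trans; [apply Re_le_Cmod | ].
    rewrite Cmod_mult, Cmod_conj, Rmult_assoc.
    apply Rmult_le_compat_l; auto.
    eapply Rle_trans; [exact Hq | ].
    rewrite Cmod_mult, Cmod_R, Rpow_mult_distr, pow2_abs; apply Req_le; ring. }
destruct (MVT_gen phi 0 1 (fun t => Re (Cconj D * (v * f' t))%C)) as (c & Hc & E).
- intros t Ht; rewrite Rmin_left, Rmax_right in Ht by lra; apply Hd; lra.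
- intros t Ht; rewrite Rmin_left, Rmax_right in Ht by lra.
  apply derivable_continuous_pt.
  exists (Re (Cconj D * (v * f' t))%C); apply is_derive_Reals, Hd; lra.
- rewrite Rmin_left, Rmax_right in Hc by lra.
  destruct (H c Hc) as [_ HM].
  assert (E1 : phi 1 - phi 0 = Cmod D ^ 2).
  { unfold phi.
    replace (x + RtoC 1 * v)%C with y by (unfold v; ring).
    replace (x + RtoC 0 * v)%C with x by (unfold v; ring).
    rewrite Cmod2_alt; unfold D, Re, Im; simpl; ring. }
  rewrite E1 in E.
  assert (E2 : Cmod D ^ 2 <= Cmod D * (M * Cmod v)).
  { rewrite E; eapply Rle_trans; [apply Rle_abs | ].
    rewrite Rminus_0_r, Rmult_1_r.
    eapply Rle_trans; [apply Re_le_Cmod | ].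
    rewrite !Cmod_mult, Cmod_conj.
    apply Rmult_le_compat_l; [apply Cmod_ge_0 | ].
    rewrite Rmult_comm; apply Rmult_le_compat_r; auto; apply Cmod_ge_0. }
  destruct (Req_dec (Cmod D) 0) as [Z | Z].
  + rewrite Z; apply Rmult_le_pos; [ | apply Cmod_ge_0].
    eapply Rle_trans; [apply Cmod_ge_0 | exact HM].
  + assert (0 < Cmod D) by (pose proof (Cmod_ge_0 D); lra).
    apply Rmult_le_reg_l with (Cmod D); auto.
    eapply Rle_trans; [ | exact E2]; apply Req_le; ring.
Qed.

Lemma qderiv_0_const (f : C -> C) (x y : C) :
  (forall t, 0 <= t <= 1 -> qderiv f (x + RtoC t * (y - x))%C 0) -> f y = f x.
Proof.
intros H; apply Cminus_eq_0; intros eps He.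
eapply Rle_trans; [apply (Cmvt f (fun _ => RtoC 0) x y 0) | ].
- intros t Ht; split; [apply H; auto | rewrite Cmod_0; lra].
- lra.
Qed.

(** * Power series inside their disc of convergence *)

Definition conv_on (a : nat -> C) (r0 : R) : Prop :=
  forall r, 0 <= r < r0 -> ex_series (fun n => Cmod (a n) * r ^ n).

Definition ps (a : nat -> C) (q : C) : C := csum (fun n => a n * q ^ n)%C.

Lemma conv_on_acv (a : nat -> C) (r0 : R) (q : C) : conv_on a r0 -> Cmod q < r0 ->
  acv (fun n => a n * q ^ n)%C.
Proof.
intros Ha Hq; generalize (Ha (Cmod q) (conj (Cmod_ge_0 q) Hq)); apply ex_series_ext.
intros n; rewrite Cmod_mult, Cmod_pow; reflexivity.
Qed.

(** Bernoulli's inequality for [r' / r = 1 + d]: a slightly larger radius absorbs the linear factor.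
    Every differentiated series converges for this reason. *)
Lemma S_pow_bound (r r' : R) : 0 <= r < r' ->
  exists K, 0 < K /\ forall n, INR (S n) * r ^ n <= K * r' ^ n.
Proof.
intros [Hr Hr'].
destruct (Req_dec r 0) as [E | E].
- exists 1; split; [lra | ]; intros n; subst r; destruct n.
  + simpl; lra.
  + rewrite pow_i by lia; rewrite Rmult_0_r, Rmult_1_l; apply pow_le; lra.
- set (d := r' / r - 1).
  assert (Hd : 0 < d).
  { unfold d; apply Rmult_lt_reg_r with r; [lra | ].
    replace ((r' / r - 1) * r) with (r' - r) by (field; auto); lra. }
  exists (1 + / d); split.
  + pose proof (Rinv_0_lt_compat d Hd); lra.
  + intros n.
    replace (r' ^ n) with (r ^ n * (1 + d) ^ n).
    2:{ rewrite <- Rpow_mult_distr; f_equal; unfold d; field; auto. }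
    pose proof (poly n d Hd) as P.
    pose proof (pow_le r n Hr) as Q.
    pose proof (Rinv_0_lt_compat d Hd) as I.
    assert (T : INR (S n) <= (1 + / d) * (1 + d) ^ n).
    { rewrite S_INR; apply Rle_trans with ((1 + / d) * (1 + INR n * d)).
      - replace ((1 + / d) * (1 + INR n * d)) with (1 + INR n * d + / d + INR n) by (field; lra).
        pose proof (pos_INR n); nra.
      - apply Rmult_le_compat_l; lra. }
    rewrite Rmult_comm, <- Rmult_assoc.
    rewrite (Rmult_comm (1 + / d)), Rmult_assoc; apply Rmult_le_compat_l; auto.
Qed.

Lemma conv_on_S (a : nat -> C) (r0 : R) : conv_on a r0 ->
  conv_on (fun n => RtoC (INR (S n)) * a n)%C r0.
Proof.
intros Ha r Hr.
destruct (S_pow_bound r ((r + r0) / 2) ltac:(lra)) as (K & HK & H).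
apply ex_series_le_pos with (fun n => K * (Cmod (a n) * ((r + r0) / 2) ^ n)).
- intros n; split.
  + apply Rmult_le_pos; [apply Cmod_ge_0 | apply pow_le; lra].
  + rewrite Cmod_mult, Cmod_R, Rabs_pos_eq by apply pos_INR.
    specialize (H n); pose proof (Cmod_ge_0 (a n)).
    replace (INR (S n) * Cmod (a n) * r ^ n) with (Cmod (a n) * (INR (S n) * r ^ n)) by ring.
    replace (K * (Cmod (a n) * ((r + r0) / 2) ^ n)) with (Cmod (a n) * (K * ((r + r0) / 2) ^ n)) by ring.
    apply Rmult_le_compat_l; auto.
- apply (ex_series_scal_l K (fun n => Cmod (a n) * ((r + r0) / 2) ^ n)).
  apply Ha; lra.
Qed.

Lemma conv_on_shift (a : nat -> C) (r0 : R) : conv_on a r0 -> conv_on (fun n => a (S n)) r0.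
Proof.
intros Ha r Hr; set (r' := (r + r0) / 2).
assert (Hr' : 0 < r' < r0) by (unfold r'; lra).
apply ex_series_le_pos with (fun n => / r' * (Cmod (a (S n)) * r' ^ S n)).
- intros n; split; [apply Rmult_le_pos; [apply Cmod_ge_0 | apply pow_le; lra] | ].
  replace (/ r' * (Cmod (a (S n)) * r' ^ S n)) with (Cmod (a (S n)) * r' ^ n) by (simpl; field; lra).
  apply Rmult_le_compat_l; [apply Cmod_ge_0 | apply pow_incr; unfold r'; lra].
- apply (ex_series_scal_l (/ r') (fun n => Cmod (a (S n)) * r' ^ S n)).
  apply (ex_series_incr_1 (fun n => Cmod (a n) * r' ^ n)); apply Ha; lra.
Qed.

Definition dcoef (a : nat -> C) (n : nat) : C := (RtoC (INR (S n)) * a (S n))%C.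

Lemma conv_on_le (a b : nat -> C) (r0 : R) :
  (forall n, Cmod (a n) <= Cmod (b n)) -> conv_on b r0 -> conv_on a r0.
Proof.
intros H Hb r Hr; generalize (Hb r Hr); apply ex_series_le_pos; intros n; split.
- apply Rmult_le_pos; [apply Cmod_ge_0 | apply pow_le; lra].
- apply Rmult_le_compat_r; [apply pow_le; lra | auto].
Qed.

Lemma conv_on_dcoef (a : nat -> C) (r0 : R) : conv_on a r0 -> conv_on (dcoef a) r0.
Proof.
intros Ha; apply conv_on_S, conv_on_shift in Ha; revert Ha.
apply conv_on_le; intros n; unfold dcoef; rewrite !Cmod_mult, !Cmod_R.
apply Rmult_le_compat_r; [apply Cmod_ge_0 | ].
rewrite !Rabs_pos_eq by apply pos_INR; apply le_INR; lia.
Qed.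

(** Second-order Taylor remainder of a power. The factor [rho] on the left stands in for an exponent
    [n - 1] on the right, which would be awkward at [n = 0]. *)
Lemma pow_quad (q h : C) (rho : R) (n : nat) : 0 < rho -> Cmod q <= rho -> Cmod (q + h) <= rho ->
  rho * Cmod ((q + h) ^ (S n) - q ^ (S n) - h * (RtoC (INR (S n)) * q ^ n))%C
  <= INR (S n) ^ 2 * Cmod h ^ 2 * rho ^ n.
Proof.
intros Hr H1 H2; induction n as [|n IH].
- simpl; replace ((q + h) * 1 - q * 1 - h * (1 * 1))%C with (RtoC 0) by ring.
  rewrite Cmod_0; pose proof (Cmod_ge_0 h); nra.
- set (D := ((q + h) ^ (S n) - q ^ (S n) - h * (RtoC (INR (S n)) * q ^ n))%C) in *.
  replace ((q + h) ^ (S (S n)) - q ^ (S (S n)) - h * (RtoC (INR (S (S n))) * q ^ (S n)))%C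
    with ((q + h) * D + RtoC (INR (S n)) * (h * h * q ^ n))%C.
  2:{ unfold D; rewrite (S_INR (S n)), RtoC_plus; simpl Cpow; ring. }
  apply Rle_trans with (rho * (rho * Cmod D + INR (S n) * (Cmod h ^ 2 * rho ^ n))).
  + apply Rmult_le_compat_l; [lra | ].
    eapply Rle_trans; [apply Cmod_triangle | ].
    rewrite !Cmod_mult, Cmod_R, Cmod_pow, (Rabs_pos_eq (INR _)) by apply pos_INR.
    apply Rplus_le_compat; [apply Rmult_le_compat_r; auto; apply Cmod_ge_0 | ].
    apply Rmult_le_compat_l; [apply pos_INR | ].
    replace (Cmod h * Cmod h) with (Cmod h ^ 2) by ring.
    apply Rmult_le_compat_l; [apply pow2_ge_0 | ].
    apply pow_incr; split; auto; apply Cmod_ge_0.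
  + replace (rho * (rho * Cmod D + INR (S n) * (Cmod h ^ 2 * rho ^ n)))
      with (rho * (rho * Cmod D) + INR (S n) * (Cmod h ^ 2 * rho ^ S n)) by (simpl; ring).
    apply Rle_trans with (rho * (INR (S n) ^ 2 * Cmod h ^ 2 * rho ^ n) + INR (S n) * (Cmod h ^ 2 * rho ^ S n)).
    { apply Rplus_le_compat_r, Rmult_le_compat_l; [lra | exact IH]. }
    replace (rho * (INR (S n) ^ 2 * Cmod h ^ 2 * rho ^ n) + INR (S n) * (Cmod h ^ 2 * rho ^ S n))
      with ((INR (S n) ^ 2 + INR (S n)) * (Cmod h ^ 2 * rho ^ S n)) by (simpl; ring).
    rewrite Rmult_assoc; apply Rmult_le_compat_r.
    * apply Rmult_le_pos; [apply pow2_ge_0 | apply pow_le; lra].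
    * rewrite (S_INR (S n)); pose proof (pos_INR (S n)); nra.
Qed.

Lemma qderiv_ps (a : nat -> C) (r0 : R) (q : C) : conv_on a r0 -> Cmod q < r0 ->
  qderiv (ps a) q (ps (dcoef a) q).
Proof.
intros Ha Hq.
pose proof (Cmod_ge_0 q) as Hq0.
set (rho := (Cmod q + r0) / 2).
assert (Hrho : Cmod q < rho < r0) by (unfold rho; lra).
assert (Hc : conv_on (fun n => RtoC (INR (S n)) * (RtoC (INR (S n)) * a (S n)))%C r0).
{ apply (conv_on_S (fun n => RtoC (INR (S n)) * a (S n))%C), (conv_on_dcoef a r0 Ha). }
assert (Hs : ex_series (fun n => Cmod (a (S n)) * (INR (S n) ^ 2 * rho ^ n))).
{ generalize (Hc rho ltac:(lra)); apply ex_series_ext; intros n.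
  rewrite !Cmod_mult, Cmod_R, Rabs_pos_eq by apply pos_INR.
  match goal with |- @eq _ ?a ?b => change (@eq R a b) end; ring. }
set (S0 := Series (fun n => Cmod (a (S n)) * (INR (S n) ^ 2 * rho ^ n))).
assert (HS0 : 0 <= S0).
{ apply Series_pos; auto; intros n; apply Rmult_le_pos; [apply Cmod_ge_0 | ].
  apply Rmult_le_pos; [apply pow2_ge_0 | apply pow_le; lra]. }
exists (S0 / rho), (rho - Cmod q); repeat split; [apply Rdiv_le_0_compat; lra | lra | ].
intros h Hh.
assert (Hqh : Cmod (q + h)%C <= rho) by (eapply Rle_trans; [apply Cmod_triangle | lra]).
assert (A1 : acv (fun n => a n * (q + h) ^ n)%C) by (apply conv_on_acv with r0; auto; lra).
assert (A2 : acv (fun n => a n * q ^ n)%C) by (apply conv_on_acv with r0; auto).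
assert (A3 : acv (fun n => dcoef a n * q ^ n)%C).
{ apply conv_on_acv with r0; auto; apply conv_on_dcoef; auto. }
unfold ps.
rewrite (csum_incr _ A1), (csum_incr _ A2); simpl Cpow.
rewrite <- (csum_scal h _ A3).
apply acv_incr in A1; apply acv_incr in A2.
replace (a 0%nat * 1 + csum (fun n => a (S n) * ((q + h) * (q + h) ^ n))
   - (a 0%nat * 1 + csum (fun n => a (S n) * (q * q ^ n)))
   - csum (fun n => h * (dcoef a n * q ^ n)))%C
 with (csum (fun n => a (S n) * (q + h) ^ (S n)) - csum (fun n => a (S n) * q ^ (S n))
    - csum (fun n => h * (dcoef a n * q ^ n)))%C by (simpl Cpow; ring).
rewrite <- !csum_minus; auto using acv_scal, acv_minus.
replace (S0 / rho * Cmod h ^ 2) with ((Cmod h ^ 2 / rho) * S0) by (unfold Rdiv; ring).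
unfold S0; rewrite <- Series_scal_l.
apply Cmod_csum_le_maj.
2:{ apply (ex_series_scal_l (Cmod h ^ 2 / rho) _ Hs). }
intros n.
replace (a (S n) * (q + h) ^ S n - a (S n) * q ^ S n - h * (dcoef a n * q ^ n))%C
  with (a (S n) * ((q + h) ^ (S n) - q ^ (S n) - h * (RtoC (INR (S n)) * q ^ n)))%C
  by (unfold dcoef; ring).
rewrite Cmod_mult.
pose proof (pow_quad q h rho n ltac:(lra) ltac:(lra) Hqh) as P.
replace (Cmod h ^ 2 / rho * (Cmod (a (S n)) * (INR (S n) ^ 2 * rho ^ n)))
  with (Cmod (a (S n)) * ((INR (S n) ^ 2 * Cmod h ^ 2 * rho ^ n) / rho)) by (field; lra).
apply Rmult_le_compat_l; [apply Cmod_ge_0 | ].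
apply Rmult_le_reg_l with rho; [lra | ].
eapply Rle_trans; [exact P | apply Req_le; field; lra].
Qed.

(** * The exponential function *)

Lemma Cexp_plus (a b : C) : Cexp (a + b) = (Cexp a * Cexp b)%C.
Proof.
destruct a as [a1 a2], b as [b1 b2]; unfold Cexp; apply C_eq; simpl;
  rewrite ?exp_plus, ?cos_plus, ?sin_plus; ring.
Qed.

Lemma Cexp_0 : Cexp 0 = 1%C.
Proof. unfold Cexp; apply C_eq; simpl; rewrite exp_0, ?cos_0, ?sin_0; ring. Qed.

Lemma Cexp_R (x : R) : Cexp (RtoC x) = RtoC (exp x).
Proof. unfold Cexp; apply C_eq; simpl; rewrite ?cos_0, ?sin_0; ring. Qed.

Lemma Cmod_Cexp (z : C) : Cmod (Cexp z) = exp (Re z).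
Proof.
unfold Cexp; rewrite Cmod_mult, Cmod_R, Rabs_pos_eq by (apply Rlt_le, exp_pos).
replace (Cmod (cos (Im z), sin (Im z))) with 1; [ring | ].
unfold Cmod; symmetry; transitivity (sqrt 1); [f_equal | apply sqrt_1].
pose proof (sin2_cos2 (Im z)) as H; unfold Rsqr in H; simpl; lra.
Qed.

Lemma Cexp_neq_0 (z : C) : Cexp z <> 0%C.
Proof. apply Cmod_neq_0; rewrite Cmod_Cexp; apply exp_pos. Qed.

Lemma Cexp_opp (z : C) : Cexp (- z) = (/ Cexp z)%C.
Proof.
assert (E : (Cexp z * Cexp (- z))%C = 1%C).
{ rewrite <- Cexp_plus; replace (z + - z)%C with (RtoC 0) by ring; apply Cexp_0. }
pose proof (Cexp_neq_0 z); replace (Cexp (- z)) with ((Cexp z * Cexp (- z)) / Cexp z)%C by (field; auto).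
rewrite E; field; auto.
Qed.

Lemma Cexp_pow (z : C) (n : nat) : Cexp (RtoC (INR n) * z) = (Cexp z ^ n)%C.
Proof.
induction n.
- replace (RtoC (INR 0) * z)%C with (RtoC 0) by (simpl; ring); rewrite Cexp_0; reflexivity.
- rewrite S_INR, RtoC_plus.
  replace ((RtoC (INR n) + 1) * z)%C with (z + RtoC (INR n) * z)%C by ring.
  rewrite Cexp_plus, IHn; reflexivity.
Qed.

Definition I2pi : C := (RtoC (2 * PI) * Ci)%C.

Lemma Cexp_2piZ (n : Z) : Cexp (I2pi * RtoC (IZR n)) = 1%C.
Proof.
unfold Cexp, I2pi; apply C_eq; simpl.
- replace (2 * PI * 0 - 0 * 1) with 0 by ring.
  replace (0 * IZR n - (2 * PI * 1 + 0 * 0) * 0) with 0 by ring.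
  replace (0 * 0 + (2 * PI * 1 + 0 * 0) * IZR n) with (0 + 2 * IZR n * PI) by ring.
  rewrite exp_0, Rmult_0_l, Rminus_0_r, Rmult_1_l.
  destruct (Z_le_dec 0 n) as [Hn | Hn].
  + rewrite <- (Z2Nat.id n Hn), <- INR_IZR_INZ, cos_period; apply cos_0.
  + rewrite <- cos_neg.
    replace (- (0 + 2 * IZR n * PI)) with (0 + 2 * IZR (- n) * PI) by (rewrite opp_IZR; ring).
    rewrite <- (Z2Nat.id (- n)) by lia; rewrite <- INR_IZR_INZ, cos_period; apply cos_0.
- replace (2 * PI * 0 - 0 * 1) with 0 by ring.
  replace (0 * IZR n - (2 * PI * 1 + 0 * 0) * 0) with 0 by ring.
  replace (0 * 0 + (2 * PI * 1 + 0 * 0) * IZR n) with (0 + 2 * IZR n * PI) by ring.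
  rewrite exp_0, Rmult_1_l, Rmult_0_l, Rplus_0_r.
  destruct (Z_le_dec 0 n) as [Hn | Hn].
  + rewrite <- (Z2Nat.id n Hn), <- INR_IZR_INZ, sin_period; apply sin_0.
  + rewrite <- (Ropp_involutive (sin _)), <- sin_neg.
    replace (- (0 + 2 * IZR n * PI)) with (0 + 2 * IZR (- n) * PI) by (rewrite opp_IZR; ring).
    rewrite <- (Z2Nat.id (- n)) by lia; rewrite <- INR_IZR_INZ, sin_period, sin_0; ring.
Qed.

Lemma sin_abs_le (x : R) : Rabs (sin x) <= Rabs x.
Proof.
destruct (MVT_gen sin 0 x cos) as (c & _ & E).
- intros; apply is_derive_sin.
- intros; apply continuity_sin.
- rewrite sin_0, !Rminus_0_r in E; rewrite E, Rabs_mult.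
  assert (Rabs (cos c) <= 1) by (apply Rabs_le; apply COS_bound).
  pose proof (Rabs_pos x); nra.
Qed.

Lemma cos_m1_abs_le (x : R) : Rabs (cos x - 1) <= x ^ 2 / 2.
Proof.
replace (cos x - 1) with (- (2 * sin (x / 2) ^ 2)).
2:{ replace (cos x) with (cos (2 * (x / 2))) by (f_equal; field).
    rewrite cos_2a_sin; ring. }
rewrite Rabs_Ropp, Rabs_pos_eq by (pose proof (pow2_ge_0 (sin (x / 2))); lra).
assert (sin (x / 2) ^ 2 <= (x / 2) ^ 2); [ | lra].
rewrite <- (pow2_abs (sin _)), <- (pow2_abs (x / 2)).
apply pow_incr; split; [apply Rabs_pos | apply sin_abs_le].
Qed.

Lemma sin_m_abs_le (x : R) : Rabs (sin x - x) <= Rabs x ^ 3.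
Proof.
destruct (MVT_gen (fun t => sin t - t) 0 x (fun t => cos t - 1)) as (c & Hc & E).
- intros; auto_derive; auto; ring.
- intros; apply continuity_pt_minus; [apply continuity_sin | apply continuity_pt_id].
- rewrite sin_0, !Rminus_0_r in E; rewrite E, Rabs_mult.
  pose proof (cos_m1_abs_le c) as B.
  assert (Hcx : Rabs c <= Rabs x).
  { unfold Rmin, Rmax in Hc; destruct (Rle_dec 0 x);
    unfold Rabs; destruct (Rcase_abs c), (Rcase_abs x); lra. }
  assert (c ^ 2 <= Rabs x ^ 2).
  { rewrite <- (pow2_abs c); apply pow_incr; split; [apply Rabs_pos | auto]. }
  pose proof (Rabs_pos x); pose proof (pow2_ge_0 (Rabs x)).
  apply Rle_trans with (Rabs x ^ 2 * Rabs x); [ | apply Req_le; ring].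
  apply Rmult_le_compat_r; lra.
Qed.

Lemma exp_m1_abs_le (a : R) : Rabs a <= / 2 -> Rabs (exp a - 1 - a) <= 2 * a ^ 2.
Proof.
intros H; apply Rabs_le_between in H.
pose proof (exp_ineq1_le a) as H1; pose proof (exp_ineq1_le (- a)) as H2.
rewrite Rabs_pos_eq by lra.
assert (E : exp a * exp (- a) = 1) by (rewrite <- exp_plus, Rplus_opp_r; apply exp_0).
pose proof (exp_pos a) as P.
assert (exp a * (1 - a) <= 1) by nra.
assert (exp a <= / (1 - a)).
{ apply Rmult_le_reg_r with (1 - a); [lra | rewrite Rinv_l; lra]. }
assert (/ (1 - a) <= 1 + a + 2 * a ^ 2); [ | lra].
apply Rmult_le_reg_r with (1 - a); [lra | rewrite Rinv_l by lra].
assert (0 <= a ^ 2 * (1 - 2 * a)) by (apply Rmult_le_pos; [apply pow2_ge_0 | lra]).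
nra.
Qed.

Lemma Cexp_m1_le (h : C) : Cmod h <= / 2 -> Cmod (Cexp h - 1 - h) <= 10 * Cmod h ^ 2.
Proof.
intros Hh.
pose proof (Re_le_Cmod h) as Ha; pose proof (Im_le_Cmod h) as Hb.
pose proof (Cmod_ge_0 h) as H0.
destruct h as [a b]; unfold Re, Im in Ha, Hb; simpl in Ha, Hb.
set (N := Cmod (a, b)) in *.
eapply Rle_trans; [apply Cmod_le_ReIm | ].
replace (Re (Cexp (a, b) - 1 - (a, b))%C) with ((exp a - 1 - a) + exp a * (cos b - 1)).
2:{ unfold Cexp; simpl; ring. }
replace (Im (Cexp (a, b) - 1 - (a, b))%C) with ((exp a - 1) * sin b + (sin b - b)).
2:{ unfold Cexp; simpl; ring. }
assert (A1 : Rabs (exp a - 1 - a) <= 2 * a ^ 2) by (apply exp_m1_abs_le; lra).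
pose proof (cos_m1_abs_le b) as A2; pose proof (sin_abs_le b) as A3; pose proof (sin_m_abs_le b) as A4.
assert (Q1 : a ^ 2 <= N ^ 2) by (rewrite <- (pow2_abs a); apply pow_incr; split; auto; apply Rabs_pos).
assert (Q2 : b ^ 2 <= N ^ 2) by (rewrite <- (pow2_abs b); apply pow_incr; split; auto; apply Rabs_pos).
assert (Q3 : Rabs b ^ 3 <= N ^ 3) by (apply pow_incr; split; auto; apply Rabs_pos).
assert (NN : N ^ 2 <= N / 2) by nra.
assert (N3 : N ^ 3 <= N ^ 2) by nra.
assert (A5 : Rabs (exp a - 1) <= 2 * N).
{ replace (exp a - 1) with ((exp a - 1 - a) + a) by ring.
  eapply Rle_trans; [apply Rabs_triang | ]; nra. }
assert (A6 : exp a <= 3).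
{ apply Rabs_le_between in A5; lra. }
pose proof (exp_pos a) as P.
assert (T1 : Rabs (exp a - 1 - a + exp a * (cos b - 1)) <= 2 * N ^ 2 + 3 * (N ^ 2 / 2)).
{ eapply Rle_trans; [apply Rabs_triang | ]; rewrite Rabs_mult, (Rabs_pos_eq (exp a)) by lra.
  pose proof (Rabs_pos (cos b - 1)).
  apply Rplus_le_compat; [lra | ].
  apply Rmult_le_compat; lra. }
assert (T2 : Rabs ((exp a - 1) * sin b + (sin b - b)) <= 2 * N * N + N ^ 2).
{ eapply Rle_trans; [apply Rabs_triang | ]; rewrite Rabs_mult.
  apply Rplus_le_compat; [ | lra].
  apply Rmult_le_compat; try apply Rabs_pos; lra. }
nra.
Qed.

Lemma qderiv_Cexp (z : C) : qderiv Cexp z (Cexp z).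
Proof.
exists (Cmod (Cexp z) * 10), (/ 2); repeat split; [ | lra | ].
- apply Rmult_le_pos; [apply Cmod_ge_0 | lra].
- intros h Hh; rewrite Cexp_plus.
  replace (Cexp z * Cexp h - Cexp z - h * Cexp z)%C with (Cexp z * (Cexp h - 1 - h))%C by ring.
  rewrite Cmod_mult, Rmult_assoc; apply Rmult_le_compat_l; [apply Cmod_ge_0 | ].
  apply Cexp_m1_le; auto.
Qed.

Lemma qderiv_Cexp_comp (f : C -> C) (x l : C) :
  qderiv f x l -> qderiv (fun y => Cexp (f y)) x (Cexp (f x) * l)%C.
Proof. intros; apply qderiv_comp; auto; apply qderiv_Cexp. Qed.

Definition expcoef (n : nat) : C := RtoC (/ INR (fact n)).

Lemma conv_on_expcoef (r0 : R) : conv_on expcoef r0.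
Proof.
intros r Hr.
assert (E : is_series (fun n => r ^ n * / INR (fact n)) (exp r)).
{ generalize (is_exp_Reals r); apply is_series_ext; intros n.
  rewrite pow_n_pow; reflexivity. }
apply ex_series_ext with (fun n => r ^ n * / INR (fact n)); [ | exists (exp r); exact E].
intros n; unfold expcoef; rewrite Cmod_R, Rabs_pos_eq.
- apply Rmult_comm.
- apply Rlt_le, Rinv_0_lt_compat, INR_fact_lt_0.
Qed.

Lemma ps_0 (a : nat -> C) : ps a 0 = a 0%nat.
Proof.
unfold ps; rewrite (csum_finite _ 1).
- simpl; ring.
- intros n Hn; destruct n; [lia | simpl; ring].
Qed.

(** The series is its own derivative, so its product with [Cexp (- x)] has derivative zero and keeps
    its value 1 at the origin. *)
Lemma Cexp_series (u : C) : Cexp u = ps expcoef u.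
Proof.
assert (D : forall x, qderiv (ps expcoef) x (ps expcoef x)).
{ intros x; eapply qderiv_eq.
  - apply qderiv_ps with (Cmod x + 1); [apply conv_on_expcoef | lra].
  - unfold ps; apply csum_ext; intros n; f_equal; unfold dcoef, expcoef.
    rewrite <- RtoC_mult; f_equal; rewrite fact_simpl, mult_INR; field.
    split; [apply INR_fact_neq_0 | apply not_0_INR; lia]. }
set (f := fun x => (ps expcoef x * Cexp (- x))%C).
assert (E : f u = f 0%C).
{ apply qderiv_0_const; intros t _; set (x := (0 + RtoC t * (u - 0))%C).
  unfold f; eapply qderiv_eq.
  - apply qderiv_mult; [apply D | ].
    apply (qderiv_Cexp_comp (fun y => - y)%C), qderiv_opp, qderiv_id.
  - cbv beta; ring. }
unfold f in E; rewrite ps_0 in E.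
replace (- 0)%C with (RtoC 0) in E by ring.
rewrite Cexp_0 in E; unfold expcoef at 2 in E; simpl in E.
rewrite Rinv_1, Cexp_opp in E.
pose proof (Cexp_neq_0 u) as Hu.
replace (ps expcoef u) with ((ps expcoef u * / Cexp u) * Cexp u)%C by (field; auto).
rewrite E; ring.
Qed.

(** Each application raises the order of vanishing at 0 by one; iterated, it yields Taylor estimates
    from a bound on the highest derivative. *)
Lemma Cmvt_0 (f f' : C -> C) (r M : R) (n : nat) (u : C) :
  f 0%C = 0%C -> 0 <= M ->
  (forall v, Cmod v <= r -> qderiv f v (f' v)) ->
  (forall v, Cmod v <= r -> Cmod (f' v) <= M * Cmod v ^ n) ->
  Cmod u <= r -> Cmod (f u) <= M * Cmod u ^ S n.
Proof.
intros H0 HM Hd Hb Hu.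
replace (f u) with (f u - f 0%C)%C by (rewrite H0; ring).
eapply Rle_trans; [apply (Cmvt f (fun t => f' (0 + RtoC t * (u - 0))%C) 0 u (M * Cmod u ^ n)) | ].
- intros t Ht.
  assert (Hv : Cmod (0 + RtoC t * (u - 0))%C <= Cmod u).
  { replace (0 + RtoC t * (u - 0))%C with (RtoC t * u)%C by ring.
    rewrite Cmod_mult, Cmod_R, Rabs_pos_eq by lra.
    pose proof (Cmod_ge_0 u); nra. }
  split; [apply Hd; lra | ].
  eapply Rle_trans; [apply Hb; lra | ].
  apply Rmult_le_compat_l; auto; apply pow_incr; split; auto; apply Cmod_ge_0.
- replace (u - 0)%C with u by ring; apply Req_le; simpl; ring.
Qed.

Lemma Cmod_Cexp_le (u : C) (r : R) : Cmod u <= r -> Cmod (Cexp u) <= exp r.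
Proof.
intros H; rewrite Cmod_Cexp.
assert (Re u <= r) by (pose proof (Re_le_Cmod u); pose proof (Rle_abs (Re u)); lra).
destruct (Req_dec (Re u) r) as [E | E]; [rewrite E; lra | ].
apply Rlt_le, exp_increasing; lra.
Qed.

Lemma qderiv_Cexp_opp (v : C) : qderiv (fun y => Cexp (- y)) v (- Cexp (- v))%C.
Proof.
eapply qderiv_eq; [apply (qderiv_Cexp_comp (fun y => - y)%C), qderiv_opp, qderiv_id | ring].
Qed.

Ltac qd_step :=
  lazymatch goal with
  | |- qderiv (fun v => v) _ _ => apply qderiv_id
  | |- qderiv (fun v => Cexp v) _ _ => apply qderiv_Cexp
  | |- qderiv (fun v => Cexp (Copp v)) _ _ => apply qderiv_Cexp_opp
  | |- qderiv (fun v => Cminus (@?f v) (@?g v)) _ _ => apply (qderiv_minus f g)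
  | |- qderiv (fun v => Cplus (@?f v) (@?g v)) _ _ => apply (qderiv_plus f g)
  | |- qderiv (fun v => Cmult (@?f v) (@?g v)) _ _ => apply (qderiv_mult f g)
  | _ => apply qderiv_const
  end.
Ltac qd := eapply qderiv_eq; [ repeat qd_step | cbv beta; field; auto ].

(** Four integrations starting from the bound on [Cexp u + Cexp (- u)]. The order 4 is what lets the
    double pole of the squared cosecant at 0 cancel with a bounded remainder. *)
Lemma cosh_quartic (r : R) (u : C) : Cmod u <= r ->
  Cmod (Cexp u + Cexp (- u) - 2 - u * u) <= 2 * exp r * Cmod u ^ 4.
Proof.
intros Hu.
assert (HM : 0 <= 2 * exp r) by (pose proof (exp_pos r); lra).
assert (B0 : forall v, Cmod v <= r -> Cmod (Cexp v + Cexp (- v))%C <= 2 * exp r * Cmod v ^ 0).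
{ intros v Hv; eapply Rle_trans; [apply Cmod_triangle | ].
  pose proof (Cmod_Cexp_le v r Hv); rewrite <- Cmod_opp in Hv.
  pose proof (Cmod_Cexp_le _ r Hv); simpl; lra. }
assert (Z : Cexp (- 0) = 1%C) by (replace (- 0)%C with (RtoC 0) by ring; apply Cexp_0).
assert (B1 : forall v, Cmod v <= r -> Cmod (Cexp v - Cexp (- v))%C <= 2 * exp r * Cmod v ^ 1).
{ intros v Hv; apply (Cmvt_0 (fun v => Cexp v - Cexp (- v))%C (fun v => Cexp v + Cexp (- v))%C r); auto.
  - rewrite Z, Cexp_0; ring.
  - intros w _; qd. }
assert (B2 : forall v, Cmod v <= r -> Cmod (Cexp v + Cexp (- v) - 2)%C <= 2 * exp r * Cmod v ^ 2).
{ intros v Hv; apply (Cmvt_0 (fun v => Cexp v + Cexp (- v) - 2)%C (fun v => Cexp v - Cexp (- v))%C r); auto.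
  - rewrite Z, Cexp_0; ring.
  - intros w _; qd. }
assert (B3 : forall v, Cmod v <= r -> Cmod (Cexp v - Cexp (- v) - 2 * v)%C <= 2 * exp r * Cmod v ^ 3).
{ intros v Hv; apply (Cmvt_0 (fun v => Cexp v - Cexp (- v) - 2 * v)%C (fun v => Cexp v + Cexp (- v) - 2)%C r); auto.
  - rewrite Z, Cexp_0; ring.
  - intros w _; qd. }
apply (Cmvt_0 (fun v => Cexp v + Cexp (- v) - 2 - v * v)%C (fun v => Cexp v - Cexp (- v) - 2 * v)%C r); auto.
- rewrite Z, Cexp_0; ring.
- intros w _; qd.
Qed.

(** * Coefficients of q-expansions *)

Lemma nome_Cexp (z : C) : nome z = Cexp (I2pi * z).
Proof. reflexivity. Qed.

Lemma nome_xy (x y : R) : nome (x, y) = (RtoC (exp (- (2 * PI * y))) * Cexp (I2pi * RtoC x))%C.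
Proof.
rewrite nome_Cexp, <- Cexp_R, <- Cexp_plus; f_equal.
unfold I2pi; apply C_eq; simpl; ring.
Qed.

Lemma Cmod_nome (z : C) : Cmod (nome z) = exp (- (2 * PI * Im z)).
Proof.
rewrite nome_Cexp, Cmod_Cexp; f_equal; unfold I2pi, Re, Im; simpl; ring.
Qed.

Lemma exp_lt_1 (x : R) : x < 0 -> exp x < 1.
Proof. intros; rewrite <- exp_0; apply exp_increasing; auto. Qed.

Lemma exp_le (x y : R) : x <= y -> exp x <= exp y.
Proof. intros [H | H]; [left; apply exp_increasing; auto | subst; lra]. Qed.

Lemma Cmod_nome_lt_1 (z : C) : upper_half_plane z -> Cmod (nome z) < 1.
Proof.
intros H; unfold upper_half_plane in H; rewrite Cmod_nome; apply exp_lt_1.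
pose proof PI_RGT_0; nra.
Qed.

Lemma nome_real (r : R) : 0 < r < 1 ->
  exists z, upper_half_plane z /\ nome z = RtoC r.
Proof.
intros Hr; pose proof PI_RGT_0.
exists (0, - ln r / (2 * PI)); split.
- unfold upper_half_plane; simpl.
  apply Rdiv_lt_0_compat; [ | lra].
  pose proof (ln_increasing r 1); rewrite ln_1 in *; lra.
- rewrite nome_xy; replace (I2pi * RtoC 0)%C with (RtoC 0) by ring; rewrite Cexp_0.
  replace (- (2 * PI * (- ln r / (2 * PI)))) with (ln r) by (field; lra).
  rewrite exp_ln by lra; ring.
Qed.

Lemma Cexp_2pi_eq_1 (t : R) : -1 < t < 1 -> Cexp (I2pi * RtoC t) = 1%C -> t = 0.
Proof.
intros Ht H; apply (f_equal Re) in H.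
unfold Cexp, I2pi in H; simpl in H.
replace (2 * PI * 0 - 0 * 1) with 0 in H by ring.
replace (0 * t - (2 * PI * 1 + 0 * 0) * 0) with 0 in H by ring.
replace (0 * 0 + (2 * PI * 1 + 0 * 0) * t) with (2 * (PI * t)) in H by ring.
rewrite exp_0, cos_2a_sin in H.
assert (S0 : sin (PI * t) = 0) by nra.
pose proof PI_RGT_0.
destruct (Rtotal_order t 0) as [L | [E | G]]; auto.
- assert (0 < sin (- (PI * t))) by (apply sin_gt_0; nra).
  rewrite sin_neg in H1; lra.
- assert (0 < sin (PI * t)) by (apply sin_gt_0; nra); lra.
Qed.

Lemma csumn_geom (w : C) (n : nat) : ((w - 1) * csumn (fun i => w ^ i) n = w ^ n - 1)%C.
Proof. induction n; simpl; [ring | rewrite Cmult_plus_distr_l, IHn; ring]. Qed.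

Lemma csumn_const (c : C) (n : nat) : csumn (fun _ => c) n = (RtoC (INR n) * c)%C.
Proof. induction n; simpl csumn; [simpl; ring | rewrite IHn, S_INR, RtoC_plus; ring]. Qed.

Lemma Cmod_csumn_bound (a : nat -> C) (B : R) (n : nat) :
  (forall i, (i < n)%nat -> Cmod (a i) <= B) -> Cmod (csumn a n) <= INR n * B.
Proof.
induction n; intros H; simpl csumn.
- rewrite Cmod_0; simpl; lra.
- eapply Rle_trans; [apply Cmod_triangle | rewrite S_INR].
  assert (Cmod (csumn a n) <= INR n * B) by (apply IHn; auto).
  specialize (H n ltac:(lia)); lra.
Qed.

Lemma roots_of_unity_sum (N m n : nat) : (m < N)%nat -> (n < N)%nat ->
  csumn (fun j => Cexp (I2pi * RtoC (INR j * ((INR m - INR n) / INR N)))%C) N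
  = if Nat.eqb m n then RtoC (INR N) else RtoC 0.
Proof.
intros Hm Hn.
assert (HN : 0 < INR N) by (apply lt_0_INR; lia).
set (t := (INR m - INR n) / INR N).
assert (Ht : -1 < t < 1).
{ apply lt_INR in Hm; apply lt_INR in Hn.
  pose proof (pos_INR m); pose proof (pos_INR n).
  unfold t; split; apply Rmult_lt_reg_r with (INR N); auto; unfold Rdiv;
    rewrite Rmult_assoc, Rinv_l; lra. }
set (w := Cexp (I2pi * RtoC t)).
rewrite (csumn_ext _ (fun j => (w ^ j)%C)).
2:{ intros j _; unfold w; rewrite <- Cexp_pow; f_equal; rewrite RtoC_mult; ring. }
destruct (Nat.eqb_spec m n) as [E | E].
- assert (t = 0) by (unfold t; subst; unfold Rdiv; ring).
  rewrite (csumn_ext _ (fun _ => RtoC 1)), csumn_const; [ring | ].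
  intros i _; unfold w; rewrite H.
  replace (I2pi * RtoC 0)%C with (RtoC 0) by ring; rewrite Cexp_0.
  clear; induction i; simpl; [auto | rewrite IHi; ring].
- assert (Hw : w <> 1%C).
  { intros Hw; apply Cexp_2pi_eq_1 in Hw; auto.
    apply E, INR_eq; unfold t in Hw.
    apply (f_equal (Rmult (INR N))) in Hw; field_simplify in Hw; lra. }
  pose proof (csumn_geom w N) as G.
  assert (WN : (w ^ N)%C = 1%C).
  { unfold w; rewrite <- Cexp_pow, <- (Cexp_2piZ (Z.of_nat m - Z.of_nat n)); f_equal.
    rewrite minus_IZR, <- !INR_IZR_INZ.
    replace (INR m - INR n) with (INR N * t) by (unfold t; field; lra).
    rewrite RtoC_mult; ring. }
  rewrite WN in G.
  assert (Hw1 : (w - 1)%C <> 0%C).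
  { intros Z; apply Hw; replace w with ((w - 1) + 1)%C by ring; rewrite Z; ring. }
  replace (csumn (fun j => (w ^ j)%C) N)
    with (((w - 1) * csumn (fun j => (w ^ j)%C) N) / (w - 1))%C by (field; auto).
  rewrite G; field; auto.
Qed.

Lemma Series_tail (a : nat -> R) (eps : R) (n : nat) :
  (forall i, 0 <= a i) -> ex_series a -> 0 < eps ->
  exists N, (n < N)%nat /\ Series (fun m => a (N + m)%nat) < eps.
Proof.
intros Hp Ha He.
generalize (proj1 (filterlim_locally (F := eventually) _ _) (Series_correct a Ha) (mkposreal _ He)).
intros [N HN]; exists (S (N + n)); split; [lia | ].
specialize (HN (N + n)%nat ltac:(lia)).
rewrite (Series_incr_n a (S (N + n))) in HN; [ | lia | auto].
unfold ball in HN; simpl in HN; unfold AbsRing_ball, abs, minus, plus, opp in HN; simpl in HN.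
rewrite sum_n_Reals in HN.
rewrite <- Rabs_Ropp in HN.
eapply Rle_lt_trans; [apply Rle_abs | eapply Rle_lt_trans; [ | apply HN]].
apply Req_le; f_equal; simpl; ring.
Qed.

(* Averaging over N-th roots of unity, N large, replaces the contour integral. *)
Lemma coef_bound (a : nat -> C) (y B : R) (n : nat) :
  conv_on a 1 -> 0 < y -> (forall x, Cmod (ps a (nome (x, y))) <= B) ->
  Cmod (a n) * exp (- (2 * PI * y)) ^ n <= B.
Proof.
intros Ha Hy HB; set (r := exp (- (2 * PI * y))).
assert (Hr : 0 < r < 1).
{ split; [apply exp_pos | apply exp_lt_1; pose proof PI_RGT_0; nra]. }
apply Rle_eps; intros eps He.
destruct (Series_tail (fun m => Cmod (a m) * r ^ m) eps n) as (N & HnN & HN); auto.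
{ intros; apply Rmult_le_pos; [apply Cmod_ge_0 | apply pow_le; lra]. }
{ apply Ha; lra. }
assert (PN : 0 < INR N) by (apply lt_0_INR; lia).
set (e := fun t : R => Cexp (I2pi * RtoC t)).
assert (Ee : forall s t, (e s * e t)%C = e (s + t)).
{ intros; unfold e; rewrite <- Cexp_plus, RtoC_plus; f_equal; ring. }
assert (Me : forall t, Cmod (e t) = 1).
{ intros t; unfold e; rewrite Cmod_Cexp, <- exp_0; f_equal; unfold I2pi, Re; simpl; ring. }
set (term := fun (j m : nat) =>
   (e (- (INR j * (INR n / INR N)))%R * (a m * nome ((INR j / INR N)%R, y) ^ m))%C).
assert (Et : forall j m, term j m = (a m * RtoC (r ^ m) * e (INR j * ((INR m - INR n) / INR N))%R)%C).
{ intros j m; unfold term; rewrite nome_xy; fold r.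
  rewrite Cpow_mult_l, <- RtoC_pow, <- (Cexp_pow _ m).
  replace (RtoC (INR m) * (I2pi * RtoC (INR j / INR N)))%C
    with (I2pi * RtoC (INR m * (INR j / INR N)))%C by (rewrite RtoC_mult; ring).
  fold (e (INR m * (INR j / INR N))).
  replace (e (INR j * ((INR m - INR n) / INR N)))
    with (e (- (INR j * (INR n / INR N)))%R * e (INR m * (INR j / INR N))%R)%C; [ring | ].
  rewrite Ee; f_equal; field; lra. }
assert (Hterm : forall j, acv (term j)).
{ intros j; apply acv_scal, conv_on_acv with 1; auto.
  apply Cmod_nome_lt_1; exact Hy. }
destruct (csumn_csum term N Hterm) as [Hacv Hsw].
assert (L : Cmod (csumn (fun j => csum (term j)) N) <= INR N * B).
{ apply Cmod_csumn_bound; intros j _; unfold term.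
  rewrite csum_scal, Cmod_mult, Me, Rmult_1_l.
  - apply HB.
  - apply conv_on_acv with 1; auto; apply Cmod_nome_lt_1; exact Hy. }
rewrite Hsw, (csum_shift _ N Hacv) in L.
(* Below [N] only the index [n] survives the average. The indices from [N] on may alias onto [n],
   and the small tail of the absolute series bounds them. *)
assert (E1 : csumn (fun m => csumn (fun j => term j m) N) N = (RtoC (INR N) * (a n * RtoC (r ^ n)))%C).
{ rewrite (csumn_ext _ (fun m => if Nat.eqb m n then (RtoC (INR N) * (a n * RtoC (r ^ n)))%C else RtoC 0)).
  - assert (G : forall M, csumn (fun m => if Nat.eqb m n then (RtoC (INR N) * (a n * RtoC (r ^ n)))%C else RtoC 0) M
      = if Nat.ltb n M then (RtoC (INR N) * (a n * RtoC (r ^ n)))%C else RtoC 0).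
    { induction M; [reflexivity | ]; simpl csumn; rewrite IHM.
      destruct (Nat.ltb_spec n M), (Nat.eqb_spec M n), (Nat.ltb_spec n (S M)); try lia; ring. }
    rewrite G; destruct (Nat.ltb_spec n N); [auto | lia].
  - intros m Hm.
    rewrite (csumn_ext _ (fun j => (a m * RtoC (r ^ m) * e (INR j * ((INR m - INR n) / INR N))%R)%C)) by (intros; apply Et).
    rewrite (csumn_scal _ (fun j => e (INR j * ((INR m - INR n) / INR N)))).
    unfold e; rewrite roots_of_unity_sum by lia.
    destruct (Nat.eqb_spec m n); [subst; ring | ring]. }
rewrite E1 in L.
assert (T : Cmod (csum (fun m => csumn (fun j => term j (N + m)%nat) N)) <= INR N * eps).
{ eapply Rle_trans; [apply (Cmod_csum_le_maj _ (fun m => INR N * (Cmod (a (N + m)%nat) * r ^ (N + m)))) | ].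
  - intros m; apply Cmod_csumn_bound; intros j _; rewrite Et, !Cmod_mult, Me, Rmult_1_r, Cmod_R.
    rewrite Rabs_pos_eq by (apply pow_le; lra); lra.
  - apply (ex_series_scal_l (INR N) (fun m => Cmod (a (N + m)%nat) * r ^ (N + m))).
    apply (ex_series_incr_n (fun m => Cmod (a m) * r ^ m)); apply Ha; lra.
  - rewrite Series_scal_l; apply Rmult_le_compat_l; lra. }
apply Rmult_le_reg_l with (INR N); auto.
replace (INR N * (Cmod (a n) * r ^ n)) with (Cmod (RtoC (INR N) * (a n * RtoC (r ^ n)))%C).
2:{ rewrite !Cmod_mult, !Cmod_R, !Rabs_pos_eq; auto; [apply pow_le; lra | lra]. }
pose proof (Cmod_triangle_inv (RtoC (INR N) * (a n * RtoC (r ^ n)))%C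
  (csum (fun m => csumn (fun j => term j (N + m)%nat) N))); lra.
Qed.

Lemma Cpow_pow_n (x : C) (n : nat) : pow_n (K := C_AbsRing) x n = (x ^ n)%C.
Proof. induction n; simpl; [reflexivity | rewrite IHn; reflexivity]. Qed.

Lemma is_pseries_C (a : nat -> C) (q l : C) :
  is_pseries (K := C_AbsRing) (V := C_NormedModule) a q l <->
  is_series (K := C_AbsRing) (V := C_NormedModule) (fun n => a n * q ^ n)%C l.
Proof.
assert (E : forall n, (pow_n (K := C_AbsRing) q n * a n)%C = (a n * q ^ n)%C).
{ intros n; rewrite Cpow_pow_n; apply Cmult_comm. }
unfold is_pseries; split; apply is_series_ext; intros n; [ | symmetry]; apply E.
Qed.

(** Abel's lemma: terms bounded at a radius [s] above [r] are dominated at [r] by a geometric series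
    of ratio [r / s]. *)
Lemma conv_on_1_intro (a : nat -> C) :
  (forall r, 0 < r < 1 -> exists K N, forall n, (N <= n)%nat -> Cmod (a n) * r ^ n <= K) ->
  conv_on a 1.
Proof.
intros H r Hr.
set (s := (r + 1) / 2).
assert (Hs : 0 < s < 1 /\ r < s) by (unfold s; lra).
destruct (H s ltac:(lra)) as (K & N & HK).
apply (ex_series_incr_n _ N).
assert (HK0 : 0 <= K).
{ eapply Rle_trans; [ | apply (HK N); lia]; apply Rmult_le_pos; [apply Cmod_ge_0 | apply pow_le; lra]. }
apply ex_series_le_pos with (fun n => K * (r / s) ^ N * (r / s) ^ n).
- intros n; split; [apply Rmult_le_pos; [apply Cmod_ge_0 | apply pow_le; lra] | ].
  rewrite Rmult_assoc, <- pow_add.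
  replace (Cmod (a (N + n)%nat) * r ^ (N + n)) with (Cmod (a (N + n)%nat) * s ^ (N + n) * (r / s) ^ (N + n)).
  + apply Rmult_le_compat_r; [apply pow_le; apply Rdiv_le_0_compat; lra | apply HK; lia].
  + rewrite Rmult_assoc, <- Rpow_mult_distr; f_equal; f_equal; field; lra.
- apply (ex_series_scal_l (K * (r / s) ^ N) (fun n => (r / s) ^ n)).
  apply ex_series_geom; rewrite Rabs_pos_eq by (apply Rdiv_le_0_compat; lra).
  apply Rmult_lt_reg_r with s; [lra | ]; unfold Rdiv; rewrite Rmult_assoc, Rinv_l; lra.
Qed.

(** Two consecutive partial sums lie within 1 of the limit in each coordinate, so each coordinate of
    a late term is at most 2; this is the 4. *)
Lemma is_series_bounded (a : nat -> C) (l : C) :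
  is_series (K := C_AbsRing) (V := C_NormedModule) a l ->
  exists N, forall n, (N <= n)%nat -> Cmod (a n) <= 4.
Proof.
intros H.
generalize (proj1 (filterlim_locally (U := C_NormedModule) (F := eventually) _ _) H (mkposreal _ Rlt_0_1)).
intros [N HN]; exists (S N); intros n Hn.
destruct n as [|n]; [lia | ].
pose proof (HN n ltac:(lia)) as [A1 A2]; pose proof (HN (S n) ltac:(lia)) as [B1 B2].
rewrite sum_n_csumn in A1, A2, B1, B2.
change (Rabs (Re (csumn a (S n)) + - Re l) < 1) in A1.
change (Rabs (Im (csumn a (S n)) + - Im l) < 1) in A2.
change (Rabs (Re (csumn a (S n)) + Re (a (S n)) + - Re l) < 1) in B1.
change (Rabs (Im (csumn a (S n)) + Im (a (S n)) + - Im l) < 1) in B2.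
eapply Rle_trans; [apply Cmod_le_ReIm | ].
apply Rabs_def2 in A1; apply Rabs_def2 in A2; apply Rabs_def2 in B1; apply Rabs_def2 in B2.
assert (Rabs (Re (a (S n))) <= 2) by (apply Rabs_le; lra).
assert (Rabs (Im (a (S n))) <= 2) by (apply Rabs_le; lra).
lra.
Qed.

Lemma q_expansion_conv (f : C -> C) (a : nat -> C) : has_q_expansion f a -> conv_on a 1.
Proof.
intros H; apply conv_on_1_intro; intros r Hr.
destruct (nome_real r Hr) as (z & Hz & E).
specialize (H z Hz); apply is_pseries_C, is_series_bounded in H; destruct H as [N HN].
exists 4, N; intros n Hn; specialize (HN n Hn).
rewrite E, Cmod_mult, Cmod_pow, Cmod_R, Rabs_pos_eq in HN by lra; auto.
Qed.

Lemma q_expansion_ps (f : C -> C) (a : nat -> C) (z : C) : has_q_expansion f a ->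
  upper_half_plane z -> f z = ps a (nome z).
Proof.
intros H Hz.
pose proof (H z Hz) as H1; apply is_pseries_C in H1.
pose proof (is_series_csum _ (conv_on_acv a 1 (nome z) (q_expansion_conv f a H) (Cmod_nome_lt_1 z Hz))) as H2.
apply (filterlim_locally_unique (K := C_AbsRing) (V := C_NormedModule) _ _ _ H1 H2).
Qed.

Lemma q_expansion_intro (f : C -> C) (a : nat -> C) : conv_on a 1 ->
  (forall z, upper_half_plane z -> f z = ps a (nome z)) -> has_q_expansion f a.
Proof.
intros Ha H z Hz; apply is_pseries_C; rewrite (H z Hz).
apply is_series_csum, conv_on_acv with 1; auto; apply Cmod_nome_lt_1; auto.
Qed.

Lemma conv_on_plus (a b : nat -> C) (r0 : R) : conv_on a r0 -> conv_on b r0 ->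
  conv_on (fun n => a n + b n)%C r0.
Proof.
intros Ha Hb r Hr.
apply ex_series_le_pos with (fun n => Cmod (a n) * r ^ n + Cmod (b n) * r ^ n).
- intros n; assert (0 <= r ^ n) by (apply pow_le; lra).
  split; [apply Rmult_le_pos; auto; apply Cmod_ge_0 | ].
  rewrite <- Rmult_plus_distr_r; apply Rmult_le_compat_r; auto; apply Cmod_triangle.
- apply (ex_series_plus (fun n => Cmod (a n) * r ^ n) (fun n => Cmod (b n) * r ^ n)); auto.
Qed.

Lemma conv_on_scal (c : C) (a : nat -> C) (r0 : R) : conv_on a r0 ->
  conv_on (fun n => c * a n)%C r0.
Proof.
intros Ha r Hr.
apply ex_series_ext with (fun n => Cmod c * (Cmod (a n) * r ^ n)).
- intros n; rewrite Cmod_mult.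
  match goal with |- @eq _ ?a ?b => change (@eq R a b) end; ring.
- apply (ex_series_scal_l (Cmod c) (fun n => Cmod (a n) * r ^ n)); auto.
Qed.

Lemma ps_plus (a b : nat -> C) (r0 : R) (q : C) : conv_on a r0 -> conv_on b r0 -> Cmod q < r0 ->
  ps (fun n => a n + b n)%C q = (ps a q + ps b q)%C.
Proof.
intros Ha Hb Hq; unfold ps.
rewrite <- csum_plus by (apply conv_on_acv with r0; auto).
apply csum_ext; intros; ring.
Qed.

Lemma ps_scal (c : C) (a : nat -> C) (r0 : R) (q : C) : conv_on a r0 -> Cmod q < r0 ->
  ps (fun n => c * a n)%C q = (c * ps a q)%C.
Proof.
intros Ha Hq; unfold ps.
rewrite <- csum_scal by (apply conv_on_acv with r0; auto).
apply csum_ext; intros; ring.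
Qed.

Lemma ps_ext (a b : nat -> C) (q : C) : (forall n, a n = b n) -> ps a q = ps b q.
Proof. intros H; apply csum_ext; intros; rewrite H; auto. Qed.

Lemma conv_on_finite (a : nat -> C) (N : nat) (r0 : R) :
  (forall n, (N <= n)%nat -> a n = RtoC 0) -> conv_on a r0.
Proof.
intros H r Hr.
assert (A : acv (fun n => a n * RtoC r ^ n)%C).
{ apply acv_finite with N; intros n Hn; rewrite H by auto; ring. }
revert A; apply ex_series_ext; intros n.
rewrite Cmod_mult, Cmod_pow, Cmod_R, Rabs_pos_eq by lra; reflexivity.
Qed.

Lemma coef_zero (a : nat -> C) : conv_on a 1 ->
  (forall z, upper_half_plane z -> ps a (nome z) = 0%C) -> forall n, a n = 0%C.
Proof.
intros Ha H n; apply Cmod_eq_0.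
assert (B : Cmod (a n) * exp (- (2 * PI * 1)) ^ n <= 0).
{ apply coef_bound; auto; [lra | ]; intros x; rewrite H, Cmod_0; [lra | ].
  unfold upper_half_plane; simpl; lra. }
assert (P : 0 < exp (- (2 * PI * 1)) ^ n) by (apply pow_lt, exp_pos).
pose proof (Cmod_ge_0 (a n)); nra.
Qed.

(** * Products and exponentials of power series *)

Definition cconv (a b : nat -> C) (n : nat) : C := csumn (fun i => a i * b (n - i)%nat)%C (S n).

(** The coefficients of [q ^ i] times the power series with coefficients [f]. *)
Definition delay (f : nat -> C) (i n : nat) : C :=
  if Nat.leb i n then f (n - i)%nat else RtoC 0.

Lemma delay_S (f : nat -> C) (i n : nat) : delay f (S i) (S n) = delay f i n.
Proof. reflexivity. Qed.

Lemma acv_delay (f : nat -> C) (i : nat) : acv f -> acv (delay f i).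
Proof.
intros Hf; induction i.
- revert Hf; apply acv_ext; intros n; unfold delay; simpl; f_equal; lia.
- apply acv_incr; revert IHi; apply acv_ext; intros; rewrite delay_S; auto.
Qed.

Lemma csum_delay (f : nat -> C) (i : nat) : acv f -> csum (delay f i) = csum f.
Proof.
intros Hf; induction i.
- apply csum_ext; intros n; unfold delay; simpl; f_equal; lia.
- rewrite csum_incr by (apply acv_delay; auto).
  rewrite (csum_ext _ (delay f i)) by (intros; apply delay_S).
  rewrite IHi; unfold delay; simpl; ring.
Qed.

Lemma Series_Cmod_delay (f : nat -> C) (i : nat) : acv f ->
  Series (fun n => Cmod (delay f i n)) = Series (fun n => Cmod (f n)).
Proof.
intros Hf; induction i.
- apply Series_ext; intros n; unfold delay; simpl; do 2 f_equal; lia.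
- rewrite Series_incr_1 by (apply (acv_delay f (S i) Hf)).
  rewrite (Series_ext _ (fun n => Cmod (delay f i n))) by (intros; rewrite delay_S; auto).
  rewrite IHi; unfold delay; simpl; rewrite Cmod_0; ring.
Qed.

(** Fubini for the matrix whose row [i] is [a i] times [b] delayed by [i]. The rows sum to multiples
    of [csum b], and the columns are finite and equal to the convolution. *)
Lemma Cauchy_product (a b : nat -> C) : acv a -> acv b ->
  acv (cconv a b) /\ csum (cconv a b) = (csum a * csum b)%C.
Proof.
intros Ha Hb.
set (u := fun i n => (a i * delay b i n)%C).
assert (Hu : forall i, acv (u i)) by (intros; apply acv_scal, acv_delay; auto).
assert (Hs : ex_series (fun i => Series (fun n => Cmod (u i n)))).
{ apply ex_series_ext with (fun i => Series (fun n => Cmod (b n)) * Cmod (a i)).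
  - intros i; unfold u.
    rewrite (Series_ext (fun n => Cmod (a i * delay b i n)%C) (fun n => Cmod (a i) * Cmod (delay b i n)))
      by (intros; apply Cmod_mult).
    rewrite Series_scal_l, Series_Cmod_delay; auto; apply Rmult_comm.
  - apply (ex_series_scal_l (Series (fun n => Cmod (b n))) _ Ha). }
destruct (csum_Fubini u Hu Hs) as (_ & _ & F3 & _ & F5).
assert (E : forall n, csum (fun i => u i n) = cconv a b n).
{ intros n; rewrite (csum_finite _ (S n)).
  - apply csumn_ext; intros i Hi; unfold u, delay.
    destruct (Nat.leb_spec i n); [auto | lia].
  - intros i Hi; unfold u, delay; destruct (Nat.leb_spec i n); [lia | ring]. }
split.
- revert F3; apply acv_ext, E.
- rewrite <- (csum_ext _ _ E), <- F5.
  rewrite (csum_ext _ (fun i => csum b * a i)%C).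
  + rewrite csum_scal by auto; ring.
  + intros i; unfold u; rewrite csum_scal, csum_delay; auto using acv_delay; ring.
Qed.

Lemma cconv_geom (a b : nat -> C) (q : C) (n : nat) :
  (cconv a b n * q ^ n)%C = cconv (fun i => a i * q ^ i)%C (fun i => b i * q ^ i)%C n.
Proof.
unfold cconv; rewrite Cmult_comm, <- csumn_scal; apply csumn_ext; intros i Hi.
replace n with (i + (n - i))%nat at 1 by lia.
rewrite Cpow_add_r; ring.
Qed.

Lemma conv_on_cconv (a b : nat -> C) (r0 : R) : conv_on a r0 -> conv_on b r0 ->
  conv_on (cconv a b) r0.
Proof.
intros Ha Hb r Hr.
assert (M : Cmod (RtoC r) = r) by (rewrite Cmod_R, Rabs_pos_eq; lra).
destruct (Cauchy_product (fun i => a i * RtoC r ^ i)%C (fun i => b i * RtoC r ^ i)%C) as [A _].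
- apply conv_on_acv with r0; auto; lra.
- apply conv_on_acv with r0; auto; lra.
- revert A; apply ex_series_ext; intros n; rewrite <- cconv_geom, Cmod_mult, Cmod_pow, M; auto.
Qed.

Lemma ps_cconv (a b : nat -> C) (r0 : R) (q : C) : conv_on a r0 -> conv_on b r0 -> Cmod q < r0 ->
  ps (cconv a b) q = (ps a q * ps b q)%C.
Proof.
intros Ha Hb Hq.
destruct (Cauchy_product (fun i => a i * q ^ i)%C (fun i => b i * q ^ i)%C) as [_ A].
- apply conv_on_acv with r0; auto; lra.
- apply conv_on_acv with r0; auto; lra.
- unfold ps; rewrite <- A; apply csum_ext; intros; apply cconv_geom.
Qed.

Definition delta0 (n : nat) : C := if Nat.eqb n 0 then RtoC 1 else RtoC 0.

Fixpoint cpow (a : nat -> C) (m : nat) : nat -> C :=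
  match m with O => delta0 | S m => cconv a (cpow a m) end.

Lemma conv_on_delta0 (r0 : R) : conv_on delta0 r0.
Proof. apply conv_on_finite with 1%nat; intros n Hn; destruct n; [lia | reflexivity]. Qed.

Lemma ps_delta0 (q : C) : ps delta0 q = 1%C.
Proof.
unfold ps; rewrite (csum_finite _ 1); [unfold delta0; simpl; ring | ].
intros n Hn; destruct n; [lia | unfold delta0; simpl; ring].
Qed.

Lemma conv_on_cpow (a : nat -> C) (m : nat) (r0 : R) : conv_on a r0 -> conv_on (cpow a m) r0.
Proof.
intros Ha; induction m; [apply conv_on_delta0 | apply conv_on_cconv; auto].
Qed.

Lemma ps_cpow (a : nat -> C) (m : nat) (r0 : R) (q : C) : conv_on a r0 -> Cmod q < r0 ->
  ps (cpow a m) q = (ps a q ^ m)%C.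
Proof.
intros Ha Hq; induction m; simpl.
- apply ps_delta0.
- rewrite (ps_cconv a (cpow a m) r0) by (auto using conv_on_cpow); rewrite IHm; auto.
Qed.

(** A nonnegative real number inside C. In this form a series of such numbers visibly has the sum of
    its moduli as its sum. *)
Definition nnC (x : C) : Prop := x = RtoC (Cmod x).

Lemma nnC_R (x : R) : 0 <= x -> nnC (RtoC x).
Proof. intros; unfold nnC; rewrite Cmod_R, Rabs_pos_eq; auto. Qed.

Lemma nnC_plus (x y : C) : nnC x -> nnC y -> nnC (x + y).
Proof.
unfold nnC at 1 2; intros Hx Hy.
replace (x + y)%C with (RtoC (Cmod x + Cmod y)) by (rewrite RtoC_plus, <- Hx, <- Hy; reflexivity).
apply nnC_R, Rplus_le_le_0_compat; apply Cmod_ge_0.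
Qed.

Lemma nnC_mult (x y : C) : nnC x -> nnC y -> nnC (x * y).
Proof.
unfold nnC at 1 2; intros Hx Hy.
replace (x * y)%C with (RtoC (Cmod x * Cmod y)) by (rewrite RtoC_mult, <- Hx, <- Hy; reflexivity).
apply nnC_R, Rmult_le_pos; apply Cmod_ge_0.
Qed.

Lemma nnC_csumn (a : nat -> C) (n : nat) : (forall i, nnC (a i)) -> nnC (csumn a n).
Proof.
intros H; induction n; simpl; [apply nnC_R; lra | apply nnC_plus; auto].
Qed.

Lemma nnC_csum (a : nat -> C) : (forall i, nnC (a i)) ->
  csum a = RtoC (Series (fun n => Cmod (a n))).
Proof.
intros H; apply C_eq; simpl.
- apply Series_ext; intros n; exact (f_equal Re (H n)).
- apply is_series_unique, is_series_0; intros n; exact (f_equal Im (H n)).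
Qed.

Lemma nnC_csum_nn (a : nat -> C) : (forall i, nnC (a i)) -> acv a -> nnC (csum a).
Proof.
intros H Ha; rewrite nnC_csum by auto; apply nnC_R, Series_pos; auto; intros; apply Cmod_ge_0.
Qed.

Lemma nnC_cpow (l : nat -> C) (m n : nat) : (forall i, nnC (l i)) -> nnC (cpow l m n).
Proof.
intros H; revert n; induction m; intros n; simpl cpow.
- unfold delta0; destruct (Nat.eqb n 0); apply nnC_R; lra.
- apply (nnC_csumn (fun i => l i * cpow l m (n - i))%C); intros; apply nnC_mult; auto.
Qed.

(* The coefficients of exp(c * sum l_n q^n). *)
Definition expser (c : C) (l : nat -> C) (n : nat) : C :=
  csum (fun j => c ^ j * expcoef j * cpow l j n)%C.

(** Fubini over the double series of c^j / j! times the j-th power of the series of [l]. As [l] is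
    nonnegative, the moduli in row [j] add up to the j-th term of the exponential series at [Cmod c]
    times the value of the series at [Cmod q], which gives absolute convergence. *)
Lemma expser_spec (c : C) (l : nat -> C) (q : C) : (forall i, nnC (l i)) -> conv_on l 1 ->
  Cmod q < 1 ->
  (forall n, acv (fun j => c ^ j * expcoef j * cpow l j n * q ^ n)%C) /\
  acv (fun n => csum (fun j => c ^ j * expcoef j * cpow l j n * q ^ n)%C) /\
  csum (fun n => csum (fun j => c ^ j * expcoef j * cpow l j n * q ^ n)%C) = Cexp (c * ps l q).
Proof.
intros Hl Hc Hq.
set (u := fun j n => (c ^ j * expcoef j * cpow l j n * q ^ n)%C).
assert (Hcp : forall j, conv_on (cpow l j) 1) by (intros; apply conv_on_cpow; auto).
assert (Hu0 : forall j, acv (fun n => cpow l j n * q ^ n)%C) by (intros; apply conv_on_acv with 1; auto).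
assert (Hu : forall j, acv (u j)).
{ intros j; apply acv_ext with (fun n => (c ^ j * expcoef j) * (cpow l j n * q ^ n))%C.
  - intros; unfold u; ring.
  - apply acv_scal; auto. }
set (r := Cmod q).
assert (Mr : Cmod (RtoC r) = r) by (rewrite Cmod_R, Rabs_pos_eq; auto; apply Cmod_ge_0).
assert (Hs : ex_series (fun j => Series (fun n => Cmod (u j n)))).
{ assert (A : acv (fun j => expcoef j * (RtoC (Cmod c) * ps l (RtoC r)) ^ j)%C).
  { apply conv_on_acv with (Cmod (RtoC (Cmod c) * ps l (RtoC r))%C + 1); [apply conv_on_expcoef | lra]. }
  revert A; apply ex_series_ext; intros j.
  rewrite Cpow_mult_l, <- (ps_cpow l j 1) by (auto; rewrite Mr; exact Hq).
  unfold ps at 1; rewrite nnC_csum.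
  2:{ intros n; apply nnC_mult; [apply nnC_cpow; auto | ].
      rewrite <- RtoC_pow; apply nnC_R, pow_le, Cmod_ge_0. }
  rewrite !Cmod_mult, Cmod_pow, Cmod_R, (Rabs_pos_eq (Cmod c)) by apply Cmod_ge_0.
  rewrite Cmod_R, Rabs_pos_eq.
  2:{ apply Series_pos; [intros; apply Cmod_ge_0 | ].
      apply (conv_on_acv (cpow l j) 1 (RtoC r)); auto; rewrite Mr; auto. }
  rewrite <- Rmult_assoc, <- Series_scal_l; apply Series_ext; intros n.
  unfold u; rewrite !Cmod_mult, !Cmod_pow, Mr; unfold r; ring. }
destruct (csum_Fubini u Hu Hs) as (F1 & _ & F3 & _ & F5).
split; [exact F1 | split; [exact F3 | ]].
change (csum (fun n => csum (fun j => u j n)) = Cexp (c * ps l q)).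
rewrite <- F5, Cexp_series; unfold ps at 1; apply csum_ext; intros j.
rewrite (csum_ext _ (fun n => (c ^ j * expcoef j) * (cpow l j n * q ^ n))%C) by (intros; unfold u; ring).
rewrite csum_scal by auto.
change (csum (fun n => cpow l j n * q ^ n)%C) with (ps (cpow l j) q).
rewrite (ps_cpow l j 1) by auto; rewrite Cpow_mult_l; ring.
Qed.

Lemma expser_acv (c : C) (l : nat -> C) (n : nat) : (forall i, nnC (l i)) -> conv_on l 1 ->
  acv (fun j => c ^ j * expcoef j * cpow l j n)%C.
Proof.
intros Hl Hc.
assert (H2 : Cmod (RtoC (/ 2)) < 1) by (rewrite Cmod_R, Rabs_pos_eq; lra).
destruct (expser_spec c l (RtoC (/ 2)) Hl Hc H2) as (A & _).
assert (P : (RtoC (/ 2) ^ n)%C <> 0%C).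
{ apply Cmod_neq_0; rewrite Cmod_pow, Cmod_R, Rabs_pos_eq by lra; apply pow_lt; lra. }
generalize (acv_scal (/ (RtoC (/ 2) ^ n)) _ (A n)); apply acv_ext; intros j.
field; auto.
Qed.

Lemma expser_term (c : C) (l : nat -> C) (q : C) (n : nat) : (forall i, nnC (l i)) -> conv_on l 1 ->
  csum (fun j => c ^ j * expcoef j * cpow l j n * q ^ n)%C = (expser c l n * q ^ n)%C.
Proof.
intros Hl Hc; rewrite (csum_ext _ (fun j => q ^ n * (c ^ j * expcoef j * cpow l j n))%C) by (intros; ring).
rewrite csum_scal by (apply expser_acv; auto); unfold expser; ring.
Qed.

Lemma conv_on_expser (c : C) (l : nat -> C) : (forall i, nnC (l i)) -> conv_on l 1 ->
  conv_on (expser c l) 1.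
Proof.
intros Hl Hc r Hr.
assert (M : Cmod (RtoC r) = r) by (rewrite Cmod_R, Rabs_pos_eq; lra).
destruct (expser_spec c l (RtoC r) Hl Hc ltac:(lra)) as (_ & A & _).
revert A; apply ex_series_ext; intros n.
rewrite expser_term, Cmod_mult, Cmod_pow, M; auto.
Qed.

Lemma ps_expser (c : C) (l : nat -> C) (q : C) : (forall i, nnC (l i)) -> conv_on l 1 ->
  Cmod q < 1 -> ps (expser c l) q = Cexp (c * ps l q).
Proof.
intros Hl Hc Hq; destruct (expser_spec c l q Hl Hc Hq) as (_ & _ & A).
rewrite <- A; apply csum_ext; intros n; rewrite expser_term; auto.
Qed.

Lemma nnC_expser (t : R) (l : nat -> C) (n : nat) : 0 <= t -> (forall i, nnC (l i)) -> conv_on l 1 ->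
  nnC (expser (RtoC t) l n).
Proof.
intros Ht Hl Hc; apply nnC_csum_nn; [ | apply expser_acv; auto].
intros j; apply nnC_mult; [apply nnC_mult | apply nnC_cpow; auto].
- rewrite <- RtoC_pow; apply nnC_R, pow_le; auto.
- apply nnC_R, Rlt_le, Rinv_0_lt_compat, INR_fact_lt_0.
Qed.

Lemma expser_0 (c : C) (l : nat -> C) : (forall i, nnC (l i)) -> conv_on l 1 ->
  l 0%nat = 0%C -> expser c l 0%nat = 1%C.
Proof.
intros Hl Hc H0; rewrite <- ps_0, ps_expser, ps_0, H0; auto.
- replace (c * 0)%C with (RtoC 0) by ring; apply Cexp_0.
- rewrite Cmod_0; lra.
Qed.

Lemma nn_coef_le (a : nat -> C) (r : R) (n : nat) : (forall i, nnC (a i)) -> conv_on a 1 ->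
  0 <= r < 1 -> Cmod (a n) * r ^ n <= Cmod (ps a (RtoC r)).
Proof.
intros H Ha Hr.
assert (M : Cmod (RtoC r) = r) by (rewrite Cmod_R, Rabs_pos_eq; lra).
assert (A : acv (fun n => a n * RtoC r ^ n)%C) by (apply conv_on_acv with 1; auto; lra).
unfold ps; rewrite nnC_csum.
2:{ intros i; apply nnC_mult; auto; rewrite <- RtoC_pow; apply nnC_R, pow_le; lra. }
rewrite Cmod_R, Rabs_pos_eq by (apply Series_pos; auto; intros; apply Cmod_ge_0).
eapply Rle_trans; [ | apply (Series_pos_term _ n); auto; intros; apply Cmod_ge_0].
cbv beta; rewrite Cmod_mult, Cmod_pow, M; lra.
Qed.

Lemma q_expansion_mult (f g : C -> C) (a b : nat -> C) :
  has_q_expansion f a -> has_q_expansion g b ->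
  has_q_expansion (fun z => f z * g z)%C (cconv a b).
Proof.
intros Hf Hg; apply q_expansion_intro.
- apply conv_on_cconv; [apply (q_expansion_conv f) | apply (q_expansion_conv g)]; auto.
- intros z Hz; rewrite (ps_cconv a b 1), (q_expansion_ps f a z), (q_expansion_ps g b z); auto.
  + apply (q_expansion_conv f); auto.
  + apply (q_expansion_conv g); auto.
  + apply Cmod_nome_lt_1; auto.
Qed.

Lemma q_expansion_plus (f g : C -> C) (a b : nat -> C) :
  has_q_expansion f a -> has_q_expansion g b ->
  has_q_expansion (fun z => f z + g z)%C (fun n => a n + b n)%C.
Proof.
intros Hf Hg; apply q_expansion_intro.
- apply conv_on_plus; [apply (q_expansion_conv f) | apply (q_expansion_conv g)]; auto.
- intros z Hz; rewrite (ps_plus a b 1), (q_expansion_ps f a z), (q_expansion_ps g b z); auto.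
  + apply (q_expansion_conv f); auto.
  + apply (q_expansion_conv g); auto.
  + apply Cmod_nome_lt_1; auto.
Qed.

Lemma q_expansion_scal (c : C) (f : C -> C) (a : nat -> C) :
  has_q_expansion f a -> has_q_expansion (fun z => c * f z)%C (fun n => c * a n)%C.
Proof.
intros Hf; apply q_expansion_intro.
- apply conv_on_scal, (q_expansion_conv f); auto.
- intros z Hz; rewrite (ps_scal c a 1), (q_expansion_ps f a z); auto.
  + apply (q_expansion_conv f); auto.
  + apply Cmod_nome_lt_1; auto.
Qed.

Lemma qderiv_nome (z : C) : qderiv nome z (nome z * I2pi)%C.
Proof.
apply (qderiv_Cexp_comp (fun y => I2pi * y)%C z I2pi).
eapply qderiv_eq; [apply qderiv_scal, qderiv_id | ring].
Qed.

Lemma qderiv_ps_nome (a : nat -> C) (z : C) : conv_on a 1 -> upper_half_plane z ->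
  qderiv (fun y => ps a (nome y)) z (ps (dcoef a) (nome z) * (nome z * I2pi))%C.
Proof.
intros Ha Hz; apply (qderiv_comp (ps a) nome); [apply qderiv_nome | ].
apply qderiv_ps with 1; auto; apply Cmod_nome_lt_1; auto.
Qed.

Lemma upper_half_plane_nbhd (z : C) : upper_half_plane z ->
  exists d, 0 < d /\ forall h, Cmod h <= d -> upper_half_plane (z + h)%C.
Proof.
unfold upper_half_plane; intros Hz; exists (Im z / 2); split; [lra | ].
intros h Hh; pose proof (Im_le_Cmod h) as B; apply Rabs_le_between in B.
replace (Im (z + h)) with (Im z + Im h) by reflexivity; lra.
Qed.

Lemma q_expansion_holomorphic (f : C -> C) (a : nat -> C) :
  has_q_expansion f a -> holomorphic_on_H f.
Proof.
intros Hf z Hz; eapply qderiv_ex_derive.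
apply qderiv_ext_loc with (fun y => ps a (nome y)).
- destruct (upper_half_plane_nbhd z Hz) as (d & Hd & H); exists d; split; auto.
  intros h Hh; symmetry; apply q_expansion_ps; auto.
- apply qderiv_ps_nome; auto; apply (q_expansion_conv f); auto.
Qed.

(** * Sums over the integers *)

Lemma series_inv_sqr : ex_series (fun n => / (INR n + 1) ^ 2) /\
  Series (fun n => / (INR n + 1) ^ 2) <= 2.
Proof.
assert (P : forall n, 0 < INR n + 1) by (intros n; pose proof (pos_INR n); lra).
apply ex_series_pos_bounded.
- intros n; apply Rlt_le, Rinv_0_lt_compat, pow_lt, P.
(* Telescoping: with x = n + 1, the next term 1/(x+1)^2 is at most 1/x - 1/(x+1). *)
- intros n; apply Rle_trans with (2 - / (INR n + 1)).
  2:{ pose proof (Rinv_0_lt_compat _ (P n)); lra. }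
  induction n.
  + rewrite sum_O; simpl; apply Req_le; field.
  + rewrite sum_Sn; unfold plus; simpl plus; eapply Rle_trans; [apply Rplus_le_compat_r, IHn | ].
    rewrite S_INR; pose proof (P n) as Pn; set (x := INR n + 1) in *.
    change (2 - / x + / (x + 1) ^ 2 <= 2 - / (x + 1)).
    assert (/ x - / (x + 1) = / (x * (x + 1))) by (field; lra).
    assert (/ (x + 1) ^ 2 <= / (x * (x + 1))); [ | lra].
    apply Rinv_le_contravar; nra.
Qed.

Lemma ex_series_inv_sqr : ex_series (fun n => / (INR n + 1) ^ 2).
Proof. apply series_inv_sqr. Qed.

(** Pairing [n] with [- n] gives Eisenstein's symmetric summation. It is essential for the exponent
    1, where the sum over Z does not converge absolutely. *)
Definition sym (f : Z -> C) (n : nat) : C :=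
  match n with
  | O => f 0%Z
  | S _ => (f (Z.of_nat n) + f (- Z.of_nat n)%Z)%C
  end.
Definition zsum (f : Z -> C) : C := csum (sym f).
(** The added 1 keeps the reciprocals meaningful at [d = 0]. *)
Definition zabs (d : Z) : R := Rabs (IZR d) + 1.
Definition zdom (f : Z -> C) : Prop := exists K, forall d, Cmod (f d) <= K * / zabs d ^ 2.

Lemma zabs_ge_1 (d : Z) : 1 <= zabs d.
Proof. unfold zabs; pose proof (Rabs_pos (IZR d)); lra. Qed.

Lemma zabs_nat (n : nat) : zabs (Z.of_nat n) = INR n + 1 /\ zabs (- Z.of_nat n) = INR n + 1.
Proof.
unfold zabs; rewrite opp_IZR, Rabs_Ropp, <- INR_IZR_INZ, Rabs_pos_eq by apply pos_INR; auto.
Qed.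

Lemma sym_le (f : Z -> C) (b : nat -> R) :
  (forall d, Cmod (f d) <= b (Z.abs_nat d)) -> forall n, Cmod (sym f n) <= 2 * b n.
Proof.
intros H n; destruct n.
- simpl; specialize (H 0%Z); pose proof (Cmod_ge_0 (f 0%Z)); simpl in H; lra.
- unfold sym; eapply Rle_trans; [apply Cmod_triangle | ].
  pose proof (H (Z.of_nat (S n))) as H1; pose proof (H (- Z.of_nat (S n))%Z) as H2.
  replace (Z.abs_nat (Z.of_nat (S n))) with (S n) in H1 by lia.
  replace (Z.abs_nat (- Z.of_nat (S n))) with (S n) in H2 by lia; lra.
Qed.

Lemma zabs_abs_nat (d : Z) : zabs d = INR (Z.abs_nat d) + 1.
Proof. unfold zabs; rewrite INR_IZR_INZ, Zabs2Nat.id_abs, abs_IZR; auto. Qed.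

Lemma zdom_le (f : Z -> C) (K : R) : (forall d, Cmod (f d) <= K * / zabs d ^ 2) ->
  forall n, Cmod (sym f n) <= 2 * K * / (INR n + 1) ^ 2.
Proof.
intros H n; rewrite Rmult_assoc; apply (sym_le f (fun n => K * / (INR n + 1) ^ 2)).
intros d; rewrite <- zabs_abs_nat; auto.
Qed.

Lemma zdom_acv (f : Z -> C) : zdom f -> acv (sym f).
Proof.
intros [K HK]; apply acv_le with (fun n => 2 * K * / (INR n + 1) ^ 2).
- apply zdom_le; auto.
- apply (ex_series_scal_l (2 * K) (fun n => / (INR n + 1) ^ 2)), ex_series_inv_sqr.
Qed.

Lemma zdom_small (f : Z -> C) (eps : R) : zdom f -> 0 < eps ->
  exists N, forall d, (N <= Z.abs_nat d)%nat -> Cmod (f d) <= eps.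
Proof.
intros [K HK] He.
assert (HK0 : 0 <= K).
{ specialize (HK 0%Z); unfold zabs in HK; rewrite Rabs_R0 in HK; pose proof (Cmod_ge_0 (f 0%Z)).
  replace (/ (0 + 1) ^ 2) with 1 in HK by field; lra. }
destruct (nfloor_ex (K / eps)) as [N HN]; [apply Rdiv_le_0_compat; lra | ].
exists (S N); intros d Hd; eapply Rle_trans; [apply HK | ].
rewrite zabs_abs_nat; set (x := INR (Z.abs_nat d) + 1).
assert (Hx : K / eps <= x).
{ apply le_INR in Hd; rewrite S_INR in Hd; unfold x; lra. }
assert (Hx1 : 1 <= x) by (unfold x; pose proof (pos_INR (Z.abs_nat d)); lra).
apply Rmult_le_reg_r with (x ^ 2); [apply pow_lt; lra | ].
rewrite Rmult_assoc, Rinv_l by (apply pow_nonzero; lra).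
apply (Rmult_le_compat_l eps) in Hx; [ | lra].
replace (eps * (K / eps)) with K in Hx by (field; lra); nra.
Qed.

Lemma zsum_ext (f g : Z -> C) : (forall d, f d = g d) -> zsum f = zsum g.
Proof. intros H; apply csum_ext; intros n; destruct n; simpl; rewrite ?H; auto. Qed.

Lemma sym_plus (f g : Z -> C) (n : nat) : sym (fun d => f d + g d)%C n = (sym f n + sym g n)%C.
Proof. destruct n; simpl; ring. Qed.

Lemma sym_scal (c : C) (f : Z -> C) (n : nat) : sym (fun d => c * f d)%C n = (c * sym f n)%C.
Proof. destruct n; simpl; ring. Qed.

Lemma zsum_plus (f g : Z -> C) : acv (sym f) -> acv (sym g) ->
  zsum (fun d => f d + g d)%C = (zsum f + zsum g)%C.
Proof.
intros; unfold zsum; rewrite <- csum_plus by auto; apply csum_ext, sym_plus.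
Qed.

Lemma zsum_scal (c : C) (f : Z -> C) : acv (sym f) -> zsum (fun d => c * f d)%C = (c * zsum f)%C.
Proof.
intros; unfold zsum; rewrite <- csum_scal by auto; apply csum_ext, sym_scal.
Qed.

Lemma zdom_plus (f g : Z -> C) : zdom f -> zdom g -> zdom (fun d => f d + g d)%C.
Proof.
intros [K HK] [L HL]; exists (K + L); intros d; eapply Rle_trans; [apply Cmod_triangle | ].
specialize (HK d); specialize (HL d); lra.
Qed.

(** Reindexing Z disturbs the symmetric partial sums only by a boundary term [r], which tends to 0.
    Both the shift by one and the grouping of even and odd integers have this form. *)
Lemma zsum_partial_eq (f g : Z -> C) (r : nat -> C) (e : nat -> nat) :
  acv (sym f) -> acv (sym g) -> (forall N, (N <= e N)%nat) ->
  (forall N, csumn (sym g) (S N) = (csumn (sym f) (S (e N)) + r N)%C) ->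
  (forall eps, 0 < eps -> exists N0, forall N, (N0 <= N)%nat -> Cmod (r N) <= eps) ->
  zsum g = zsum f.
Proof.
intros Hf Hg He Hp Hr; apply csum_unique; auto; intros eps Heps N.
destruct (csumn_lim (sym f) (eps / 2) Hf ltac:(lra)) as [N1 H1].
destruct (Hr (eps / 2) ltac:(lra)) as [N2 H2].
set (M := (N + N1 + N2)%nat).
exists (S M); split; [unfold M; lia | ].
rewrite Hp; fold (zsum f).
specialize (H1 (S (e M))); specialize (H2 M); specialize (He M).
replace (csumn (sym f) (S (e M)) + r M - zsum f)%C
  with (- (csum (sym f) - csumn (sym f) (S (e M))) + r M)%C by (unfold zsum; ring).
eapply Rle_trans; [apply Cmod_triangle | rewrite Cmod_opp].
assert (Cmod (csum (sym f) - csumn (sym f) (S (e M)))%C < eps / 2) by (apply H1; unfold M in *; lia).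
assert (Cmod (r M) <= eps / 2) by (apply H2; unfold M; lia).
lra.
Qed.

Lemma zsum_shift (f : Z -> C) : zdom f -> zdom (fun d => f (d + 1)%Z) ->
  zsum (fun d => f (d + 1)%Z) = zsum f.
Proof.
intros Hf Hg.
apply zsum_partial_eq with (fun N => f (Z.of_nat N + 1)%Z - f (- Z.of_nat N)%Z)%C (fun N => N);
  auto using zdom_acv.
- induction N.
  + simpl; ring.
  + change (csumn (sym (fun d => f (d + 1)%Z)) (S (S N)))
      with (csumn (sym (fun d => f (d + 1)%Z)) (S N) + (f (Z.of_nat (S N) + 1)%Z + f (- Z.of_nat (S N) + 1)%Z))%C.
    change (csumn (sym f) (S (S N)))
      with (csumn (sym f) (S N) + (f (Z.of_nat (S N))%Z + f (- Z.of_nat (S N))%Z))%C.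
    rewrite IHN.
    replace (- Z.of_nat (S N) + 1)%Z with (- Z.of_nat N)%Z by lia.
    replace (Z.of_nat N + 1)%Z with (Z.of_nat (S N))%Z by lia; ring.
- intros eps He; destruct (zdom_small f (eps / 2) Hf ltac:(lra)) as [N0 H0].
  exists N0; intros N HN.
  eapply Rle_trans; [apply Cmod_triangle | rewrite Cmod_opp].
  pose proof (H0 (Z.of_nat N + 1)%Z ltac:(lia)); pose proof (H0 (- Z.of_nat N)%Z ltac:(lia)); lra.
Qed.

Lemma zsum_even_odd (f : Z -> C) : zdom f ->
  zdom (fun d => f (2 * d)%Z + f (2 * d + 1)%Z)%C ->
  zsum (fun d => f (2 * d)%Z + f (2 * d + 1)%Z)%C = zsum f.
Proof.
intros Hf Hg.
apply zsum_partial_eq with (fun N => f (2 * Z.of_nat N + 1)%Z) (fun N => (2 * N)%nat);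
  auto using zdom_acv; [intros; lia | | ].
- set (g := fun d => (f (2 * d)%Z + f (2 * d + 1)%Z)%C).
  induction N.
  + simpl; unfold g; simpl; ring.
  + change (csumn (sym g) (S (S N)))
      with (csumn (sym g) (S N) + (g (Z.of_nat (S N))%Z + g (- Z.of_nat (S N))%Z))%C.
    rewrite IHN; unfold g.
    replace (2 * S N)%nat with (S (S (2 * N))) by lia.
    change (csumn (sym f) (S (S (S (2 * N)))))
      with (csumn (sym f) (S (2 * N)) + (f (Z.of_nat (S (2 * N)))%Z + f (- Z.of_nat (S (2 * N)))%Z)
         + (f (Z.of_nat (S (S (2 * N))))%Z + f (- Z.of_nat (S (S (2 * N))))%Z))%C.
    replace (2 * Z.of_nat N + 1)%Z with (Z.of_nat (S (2 * N))) by lia.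
    replace (2 * Z.of_nat (S N))%Z with (Z.of_nat (S (S (2 * N)))) by lia.
    replace (2 * - Z.of_nat (S N))%Z with (- Z.of_nat (S (S (2 * N))))%Z by lia.
    replace (- Z.of_nat (S (S (2 * N))) + 1)%Z with (- Z.of_nat (S (2 * N)))%Z by lia; ring.
- intros eps He; destruct (zdom_small f eps Hf He) as [N0 H0].
  exists N0; intros N HN; apply H0; lia.
Qed.

(** An explicit lower bound for |c z + d| / (|c| + |d|) over real (c, d). *)
Definition lattice_const (z : C) : R := Im z / (Im z + Cmod z + 1).

Lemma lattice_const_pos (z : C) : upper_half_plane z -> 0 < lattice_const z < 1.
Proof.
unfold upper_half_plane, lattice_const; intros H; pose proof (Cmod_ge_0 z); split.
- apply Rdiv_lt_0_compat; lra.
- apply Rmult_lt_reg_r with (Im z + Cmod z + 1); [lra | ].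
  unfold Rdiv; rewrite Rmult_assoc, Rinv_l; lra.
Qed.

(** The imaginary part of c z + d controls [c]; the triangle inequality turns this into control of
    [d]. *)
Lemma lattice_lower (z : C) (c d : R) : upper_half_plane z ->
  lattice_const z * (Rabs c + Rabs d) <= Cmod (RtoC c * z + RtoC d).
Proof.
unfold upper_half_plane, lattice_const; intros H; pose proof (Cmod_ge_0 z) as Hz.
set (N := Cmod (RtoC c * z + RtoC d)).
assert (A1 : Rabs c * Im z <= N).
{ unfold N; eapply Rle_trans; [ | apply Im_le_Cmod].
  replace (Im (RtoC c * z + RtoC d)%C) with (c * Im z) by (unfold Im; simpl; ring).
  rewrite Rabs_mult, (Rabs_pos_eq (Im z)); lra. }
assert (A2 : Rabs d <= N + Rabs c * Cmod z).
{ unfold N; rewrite <- (Cmod_R d), <- (Cmod_R c), <- Cmod_mult.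
  replace (RtoC d) with ((RtoC c * z + RtoC d) + - (RtoC c * z))%C at 1 by ring.
  eapply Rle_trans; [apply Cmod_triangle | rewrite Cmod_opp; lra]. }
apply Rmult_le_reg_r with (Im z + Cmod z + 1); [lra | ].
replace (Im z / (Im z + Cmod z + 1) * (Rabs c + Rabs d) * (Im z + Cmod z + 1))
  with (Im z * (Rabs c + Rabs d)) by (field; lra).
pose proof (Rabs_pos c); nra.
Qed.

Lemma shift_lower (z : C) (d : Z) : upper_half_plane z -> lattice_const z * zabs d <= Cmod (z + RtoC (IZR d)).
Proof.
intros H; pose proof (lattice_lower z 1 (IZR d) H) as L.
rewrite Rabs_R1, Cmult_1_l, Rplus_comm in L; exact L.
Qed.

Lemma shift_neq_0 (z : C) (d : Z) : upper_half_plane z -> (z + RtoC (IZR d))%C <> 0%C.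
Proof.
intros H; apply Cmod_neq_0; eapply Rlt_le_trans; [ | apply shift_lower; auto].
apply Rmult_lt_0_compat; [apply lattice_const_pos; auto | pose proof (zabs_ge_1 d); lra].
Qed.

(** * Sums of (z + d)^(-k) over the integers d *)

Definition epsk (k : nat) (z : C) (d : Z) : C := (/ (z + RtoC (IZR d)) ^ k)%C.
Definition epsum (k : nat) (z : C) : C := zsum (epsk k z).

Lemma Cmod_inv_pow_le (w : C) (m : R) (k : nat) : 0 < m -> m <= Cmod w ->
  Cmod (/ w ^ k) <= / m ^ k.
Proof.
intros Hm Hw; assert (w <> 0%C) by (apply Cmod_neq_0; lra).
rewrite Cmod_inv, Cmod_pow by (apply Cpow_nz; auto).
apply Rinv_le_contravar; [apply pow_lt; auto | apply pow_incr; lra].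
Qed.

Lemma zabs_pow_le (d : Z) (k : nat) : (2 <= k)%nat -> / zabs d ^ k <= / zabs d ^ 2.
Proof.
intros Hk; pose proof (zabs_ge_1 d); apply Rinv_le_contravar; [apply pow_lt; lra | ].
apply Rle_pow; auto.
Qed.

Lemma epsk_bound (k : nat) (z : C) (d : Z) : (2 <= k)%nat -> upper_half_plane z ->
  Cmod (epsk k z d) <= / lattice_const z ^ k * / zabs d ^ 2.
Proof.
intros Hk Hz; pose proof (lattice_const_pos z Hz) as Hkap; pose proof (zabs_ge_1 d) as H1.
unfold epsk; eapply Rle_trans; [apply (Cmod_inv_pow_le _ (lattice_const z * zabs d)) | ].
- apply Rmult_lt_0_compat; lra.
- apply shift_lower; auto.
- rewrite Rpow_mult_distr, Rinv_mult; apply Rmult_le_compat_l.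
  + apply Rlt_le, Rinv_0_lt_compat, pow_lt; lra.
  + apply zabs_pow_le; auto.
Qed.

Lemma zdom_epsk (k : nat) (z : C) : (2 <= k)%nat -> upper_half_plane z -> zdom (epsk k z).
Proof. intros; exists (/ lattice_const z ^ k); intros; apply epsk_bound; auto. Qed.

(** The pair 1/(z+n) + 1/(z-n) equals 2z / ((z+n)(z-n)), which decays quadratically although each
    term decays only linearly. *)
Lemma sym_epsk_1 (z : C) (n : nat) : upper_half_plane z ->
  Cmod (sym (epsk 1 z) n) <= (1 + 2 * Cmod z) * / lattice_const z ^ 2 * / (INR n + 1) ^ 2.
Proof.
intros Hz; pose proof (lattice_const_pos z Hz) as Hk; pose proof (Cmod_ge_0 z) as HC.
assert (I0 : 0 < / lattice_const z) by (apply Rinv_0_lt_compat; lra).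
assert (I1 : 1 <= / lattice_const z).
{ rewrite <- Rinv_1 at 1; apply Rinv_le_contravar; lra. }
assert (I2 : / lattice_const z ^ 2 = / lattice_const z * / lattice_const z) by (field; lra).
destruct n.
- simpl sym; unfold epsk.
  eapply Rle_trans; [apply (Cmod_inv_pow_le _ (lattice_const z * zabs 0)) | ].
  + apply Rmult_lt_0_compat; [lra | pose proof (zabs_ge_1 0); lra].
  + apply shift_lower; auto.
  + unfold zabs; rewrite Rabs_R0; simpl INR.
    replace (/ (lattice_const z * (0 + 1)) ^ 1) with (/ lattice_const z) by (field; lra).
    replace (/ (0 + 1) ^ 2) with 1 by field.
    rewrite Rmult_1_r, I2; nra.
- unfold sym, epsk.
  set (N := Z.of_nat (S n)).
  pose proof (shift_neq_0 z N Hz) as N1; pose proof (shift_neq_0 z (- N) Hz) as N2.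
  replace (/ (z + RtoC (IZR N)) ^ 1 + / (z + RtoC (IZR (- N))) ^ 1)%C
    with (2 * z * (/ (z + RtoC (IZR N)) ^ 1 * / (z + RtoC (IZR (- N))) ^ 1))%C.
  2:{ assert (E : RtoC (IZR (- N)) = (- RtoC (IZR N))%C) by (rewrite opp_IZR, RtoC_opp; auto).
      rewrite E in *; field; auto. }
  rewrite !Cmod_mult, Cmod_R, Rabs_pos_eq by lra.
  assert (B1 : Cmod (/ (z + RtoC (IZR N)) ^ 1)%C <= / (lattice_const z * zabs N) ^ 1).
  { apply Cmod_inv_pow_le; [apply Rmult_lt_0_compat; [lra | pose proof (zabs_ge_1 N); lra] | apply shift_lower; auto]. }
  assert (B2 : Cmod (/ (z + RtoC (IZR (- N))) ^ 1)%C <= / (lattice_const z * zabs (- N)) ^ 1).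
  { apply Cmod_inv_pow_le; [apply Rmult_lt_0_compat; [lra | pose proof (zabs_ge_1 (- N)); lra] | apply shift_lower; auto]. }
  destruct (zabs_nat (S n)) as [Z1 Z2]; fold N in Z1, Z2; rewrite Z1 in B1; rewrite Z2 in B2.
  set (x := INR (S n) + 1) in *.
  assert (Hx : 1 <= x) by (unfold x; pose proof (pos_INR (S n)); lra).
  apply Rle_trans with (2 * Cmod z * (/ (lattice_const z * x) ^ 1 * / (lattice_const z * x) ^ 1)).
  + apply Rmult_le_compat_l; [lra | ].
    apply Rmult_le_compat; auto using Cmod_ge_0.
  + replace (2 * Cmod z * (/ (lattice_const z * x) ^ 1 * / (lattice_const z * x) ^ 1))
      with (2 * Cmod z * (/ lattice_const z ^ 2 * / x ^ 2)) by (field; lra).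
    rewrite (Rmult_assoc (1 + 2 * Cmod z)); apply Rmult_le_compat_r; [ | lra].
    apply Rmult_le_pos; apply Rlt_le, Rinv_0_lt_compat, pow_lt; lra.
Qed.

Lemma acv_sym_epsk (k : nat) (z : C) : (1 <= k)%nat -> upper_half_plane z -> acv (sym (epsk k z)).
Proof.
intros Hk Hz; destruct (Nat.eq_dec k 1) as [E | E].
- subst; apply acv_le with (fun n => (1 + 2 * Cmod z) * / lattice_const z ^ 2 * / (INR n + 1) ^ 2).
  + intros; apply sym_epsk_1; auto.
  + apply (ex_series_scal_l _ (fun n => / (INR n + 1) ^ 2)), ex_series_inv_sqr.
- apply zdom_acv, zdom_epsk; auto; lia.
Qed.

Lemma inv_pow_quad (k : nat) : exists K, 0 <= K /\ forall v : C, Cmod v <= / 2 ->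
  Cmod (/ (1 + v) ^ k - 1 + RtoC (INR k) * v)%C <= K * Cmod v ^ 2.
Proof.
assert (Hnz : forall v : C, Cmod v <= / 2 -> / 2 <= Cmod (1 + v)%C).
{ intros v Hv; pose proof (Cmod_triangle_inv 1 v); rewrite Cmod_1 in *; lra. }
induction k as [|k (K & HK & IH)].
- exists 0; split; [lra | ]; intros v _; simpl.
  replace (/ 1 - 1 + 0 * v)%C with (RtoC 0) by (field; apply C1_nz); rewrite Cmod_0; lra.
- pose proof (pos_INR k) as Pk.
  exists (2 * (K + INR k + 1)); split; [nra | ]; intros v Hv; specialize (IH v Hv); specialize (Hnz v Hv).
  assert (N0 : (1 + v)%C <> 0%C) by (apply Cmod_neq_0; lra).
  assert (Np : ((1 + v) ^ k)%C <> 0%C) by (apply Cpow_nz; auto).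
  replace (/ (1 + v) ^ S k - 1 + RtoC (INR (S k)) * v)%C
    with ((/ (1 + v) ^ k - 1 + RtoC (INR k) * v + (RtoC (INR k) + 1) * (v * v)) / (1 + v))%C.
  2:{ rewrite S_INR, RtoC_plus; simpl Cpow; field; auto. }
  rewrite Cmod_div by auto.
  assert (B : Cmod (/ (1 + v) ^ k - 1 + RtoC (INR k) * v + (RtoC (INR k) + 1) * (v * v))%C
     <= (K + INR k + 1) * Cmod v ^ 2).
  { eapply Rle_trans; [apply Cmod_triangle | ].
    rewrite !Cmod_mult, <- RtoC_plus, Cmod_R, Rabs_pos_eq by lra; nra. }
  apply Rmult_le_reg_r with (Cmod (1 + v)%C); [lra | ].
  unfold Rdiv; rewrite Rmult_assoc, Rinv_l by lra.
  pose proof (pow2_ge_0 (Cmod v)).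
  apply Rle_trans with ((K + INR k + 1) * Cmod v ^ 2 * 1); [lra | ].
  assert (0 <= (K + INR k + 1) * Cmod v ^ 2) by (apply Rmult_le_pos; lra).
  nra.
Qed.

(** The quadratic error of the term at [d] is O(|h|^2 / [zabs d] ^ (k + 2)), which is absolutely
    summable even for [k = 1], where the series itself converges only symmetrically. *)
Lemma qderiv_epsum (k : nat) (z : C) : (1 <= k)%nat -> upper_half_plane z ->
  qderiv (epsum k) z (- (RtoC (INR k) * epsum (S k) z))%C.
Proof.
intros Hk Hz.
destruct (inv_pow_quad k) as (K & HK & Hq).
destruct (upper_half_plane_nbhd z Hz) as (d0 & Hd0 & Hn).
pose proof (lattice_const_pos z Hz) as Hkap.
set (A := K * / lattice_const z ^ (k + 2)).
assert (HA : 0 <= A).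
{ apply Rmult_le_pos; auto; apply Rlt_le, Rinv_0_lt_compat, pow_lt; lra. }
set (S0 := Series (fun n => / (INR n + 1) ^ 2)).
assert (HS0 : 0 <= S0).
{ apply Series_pos; [ | apply ex_series_inv_sqr]; intros n; apply Rlt_le, Rinv_0_lt_compat, pow_lt.
  pose proof (pos_INR n); lra. }
exists (2 * A * S0), (Rmin d0 (lattice_const z / 2)); repeat split.
- apply Rmult_le_pos; lra.
- apply Rmin_glb_lt; lra.
- intros h Hh.
  assert (H1 : Cmod h <= d0) by (eapply Rle_trans; [apply Hh | apply Rmin_l]).
  assert (H2 : Cmod h <= lattice_const z / 2) by (eapply Rle_trans; [apply Hh | apply Rmin_r]).
  pose proof (Hn h H1) as Hzh.
  set (D := fun d : Z => (epsk k (z + h) d + ((-1) * epsk k z d + (h * RtoC (INR k)) * epsk (S k) z d))%C).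
  assert (E : (epsum k (z + h) - epsum k z - h * - (RtoC (INR k) * epsum (S k) z))%C = zsum D).
  { assert (a1 : acv (sym (epsk k (z + h)))) by (apply acv_sym_epsk; auto).
    assert (a2 : acv (sym (epsk k z))) by (apply acv_sym_epsk; auto).
    assert (a3 : acv (sym (epsk (S k) z))) by (apply acv_sym_epsk; auto; lia).
    assert (a4 : acv (sym (fun d => (-1) * epsk k z d)%C)).
    { eapply acv_ext; [intros n; symmetry; apply sym_scal | apply acv_scal; auto]. }
    assert (a5 : acv (sym (fun d => (h * RtoC (INR k)) * epsk (S k) z d)%C)).
    { eapply acv_ext; [intros n; symmetry; apply sym_scal | apply acv_scal; auto]. }
    unfold D; rewrite (zsum_plus (epsk k (z + h))); auto.
    2:{ eapply acv_ext; [intros n; symmetry; apply sym_plus | apply acv_plus; auto]. }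
    rewrite (zsum_plus (fun d => (-1) * epsk k z d)%C) by auto.
    rewrite !zsum_scal by auto; unfold epsum; ring. }
  rewrite E.
  assert (BD : forall d, Cmod (D d) <= A * Cmod h ^ 2 * / zabs d ^ 2).
  { intros d; pose proof (shift_lower z d Hz) as L; pose proof (zabs_ge_1 d) as Z1.
    pose proof (shift_neq_0 z d Hz) as W0; pose proof (shift_neq_0 (z + h) d Hzh) as W1.
    set (w := (z + RtoC (IZR d))%C) in *.
    assert (Pw : 0 < lattice_const z * zabs d) by (apply Rmult_lt_0_compat; lra).
    assert (Hv : Cmod (h / w)%C <= / 2).
    { rewrite Cmod_div by auto; apply Rmult_le_reg_r with (Cmod w); [lra | ].
      unfold Rdiv; rewrite Rmult_assoc, Rinv_l by lra; nra. }
    specialize (Hq _ Hv).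
    replace (z + h + RtoC (IZR d))%C with (w * (1 + h / w))%C in W1 by (unfold w; field; exact W0).
    assert (W2 : (1 + h / w)%C <> 0%C).
    { intros Q; apply W1; rewrite Q; ring. }
    replace (D d) with (/ w ^ k * (/ (1 + h / w) ^ k - 1 + RtoC (INR k) * (h / w)))%C.
    2:{ unfold D, epsk; fold w.
        replace (z + h + RtoC (IZR d))%C with (w * (1 + h / w))%C by (unfold w; field; exact W0).
        rewrite Cpow_mult_l; simpl Cpow.
        set (q := (h / w)%C) in *.
        replace h with (q * w)%C by (unfold q; field; exact W0).
        field; repeat split; auto; apply Cpow_nz; auto. }
    rewrite Cmod_mult.
    apply Rle_trans with (/ (lattice_const z * zabs d) ^ k * (K * (Cmod h / (lattice_const z * zabs d)) ^ 2)).
    - apply Rmult_le_compat; auto using Cmod_ge_0.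
      + apply Cmod_inv_pow_le; auto.
      + eapply Rle_trans; [exact Hq | ].
        apply Rmult_le_compat_l; auto; apply pow_incr; split; [apply Cmod_ge_0 | ].
        rewrite Cmod_div by auto; unfold Rdiv; apply Rmult_le_compat_l; [apply Cmod_ge_0 | ].
        apply Rinv_le_contravar; auto.
    - replace (/ (lattice_const z * zabs d) ^ k * (K * (Cmod h / (lattice_const z * zabs d)) ^ 2))
        with (A * Cmod h ^ 2 * / zabs d ^ (k + 2)).
      + apply Rmult_le_compat_l; [apply Rmult_le_pos; auto; apply pow2_ge_0 | ].
        apply zabs_pow_le; lia.
      + unfold A; rewrite !Rpow_mult_distr, !pow_add.
        field; repeat split; try apply pow_nonzero; lra. }
  unfold zsum.
  replace (2 * A * S0 * Cmod h ^ 2) with ((2 * (A * Cmod h ^ 2)) * S0) by ring.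
  unfold S0; rewrite <- Series_scal_l.
  apply Cmod_csum_le_maj.
  + apply zdom_le, BD.
  + apply (ex_series_scal_l _ (fun n => / (INR n + 1) ^ 2)), ex_series_inv_sqr.
Qed.

(** * The partial fraction expansion of the squared cosecant *)

(** The case [n = 0] is separate because 0 ^ 0 = 1 would add a constant term when [j = 0]. *)
Definition powcoef (j n : nat) : C := match n with O => RtoC 0 | S _ => RtoC (INR n ^ j) end.

Lemma conv_on_powcoef (j : nat) : conv_on (powcoef j) 1.
Proof.
induction j.
- intros r Hr; apply ex_series_le_pos with (fun n => r ^ n).
  + intros n; assert (0 <= r ^ n) by (apply pow_le; lra).
    destruct n; simpl powcoef; rewrite ?Cmod_R, ?Rabs_R0, ?pow_O, ?Rabs_R1; simpl in *; lra.
  + apply ex_series_geom; rewrite Rabs_pos_eq; lra.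
- apply conv_on_le with (fun n => RtoC (INR (S n)) * powcoef j n)%C; [ | apply conv_on_S; auto].
  intros n; destruct n.
  + simpl powcoef; rewrite Cmod_0; apply Cmod_ge_0.
  + unfold powcoef; rewrite <- RtoC_mult, !Cmod_R, !Rabs_pos_eq.
    * change (INR (S n) ^ S j) with (INR (S n) * INR (S n) ^ j); apply Rmult_le_compat_r; [apply pow_le, pos_INR | apply le_INR; lia].
    * apply Rmult_le_pos; [apply pos_INR | apply pow_le, pos_INR].
    * apply pow_le, pos_INR.
Qed.

Lemma ps_dcoef_powcoef (j : nat) (q : C) : Cmod q < 1 ->
  (q * ps (dcoef (powcoef j)) q)%C = ps (powcoef (S j)) q.
Proof.
intros Hq; unfold ps at 2.
rewrite csum_incr by (apply (conv_on_acv _ 1); auto; apply conv_on_powcoef).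
unfold ps; rewrite <- csum_scal by (apply (conv_on_acv _ 1); auto; apply conv_on_dcoef, conv_on_powcoef).
simpl powcoef at 2; rewrite Cmult_0_l, Cplus_0_l; apply csum_ext; intros n.
unfold dcoef, powcoef; change (INR (S n) ^ S j) with (INR (S n) * INR (S n) ^ j).
rewrite RtoC_mult; simpl Cpow; ring.
Qed.

(** The polylogarithm of order - j at the nome. *)
Definition lser (j : nat) (z : C) : C := ps (powcoef j) (nome z).

Lemma qderiv_lser (j : nat) (z : C) : upper_half_plane z ->
  qderiv (lser j) z (I2pi * lser (S j) z)%C.
Proof.
intros Hz; eapply qderiv_eq.
- apply (qderiv_ps_nome (powcoef j)); auto; apply conv_on_powcoef.
- unfold lser; rewrite <- ps_dcoef_powcoef by (apply Cmod_nome_lt_1; auto); ring.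
Qed.

Lemma one_minus_nz (q : C) : Cmod q < 1 -> (1 - q)%C <> 0%C.
Proof.
intros H E; assert (q = 1%C) by (replace q with (1 - (1 - q))%C by ring; rewrite E; ring).
subst; rewrite Cmod_1 in H; lra.
Qed.

Lemma ps_powcoef_0 (q : C) : Cmod q < 1 -> ps (powcoef 0) q = (q / (1 - q))%C.
Proof.
intros Hq; pose proof (one_minus_nz q Hq) as Hnz.
assert (E : ps (powcoef 0) q = (q + q * ps (powcoef 0) q)%C).
{ unfold ps; rewrite csum_incr at 1 by (apply (conv_on_acv _ 1); auto; apply conv_on_powcoef).
  rewrite csum_incr at 1 by (apply acv_incr with (a := fun n => (powcoef 0 n * q ^ n)%C); apply (conv_on_acv _ 1); auto; apply conv_on_powcoef).
  rewrite <- csum_scal by (apply (conv_on_acv _ 1); auto; apply conv_on_powcoef).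
  rewrite (csum_incr (fun n => q * (powcoef 0 n * q ^ n))%C) by (apply acv_scal, (conv_on_acv _ 1); auto; apply conv_on_powcoef).
  rewrite (csum_ext (fun n => (powcoef 0 (S (S n)) * q ^ S (S n)))%C (fun n => q * (powcoef 0 (S n) * q ^ S n))%C).
  - simpl; ring.
  - intros n; simpl; ring. }
apply (f_equal (fun t => (t - q * ps (powcoef 0) q) / (1 - q)))%C in E.
replace (ps (powcoef 0) q) with ((ps (powcoef 0) q - q * ps (powcoef 0) q) / (1 - q))%C by (field; auto).
rewrite E; field; auto.
Qed.

Lemma I2pi_nz : I2pi <> 0%C.
Proof.
apply Cmod_neq_0; unfold I2pi; rewrite Cmod_mult, Cmod_Ci, Cmod_R, Rabs_pos_eq; pose proof PI_RGT_0; lra.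
Qed.

Lemma Cmod_I2pi : Cmod I2pi = 2 * PI.
Proof.
unfold I2pi; rewrite Cmod_mult, Cmod_Ci, Cmod_R, Rabs_pos_eq; pose proof PI_RGT_0; lra.
Qed.

(** Two expressions for the derivative of [lser 0] are compared: the termwise one, and the one from
    the closed form q / (1 - q). *)
Lemma lser_1 (z : C) : upper_half_plane z -> lser 1 z = (nome z / ((1 - nome z) * (1 - nome z)))%C.
Proof.
intros Hz; pose proof (Cmod_nome_lt_1 z Hz) as Hq; pose proof (one_minus_nz _ Hq) as Hnz.
assert (D1 : qderiv (lser 0) z (I2pi * (nome z / ((1 - nome z) * (1 - nome z))))%C).
{ apply qderiv_ext_loc with (fun y => nome y * / (1 - nome y))%C.
  - destruct (upper_half_plane_nbhd z Hz) as (d & Hd & H); exists d; split; auto.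
    intros h Hh; unfold lser; rewrite ps_powcoef_0; auto; apply Cmod_nome_lt_1; auto.
  - eapply qderiv_eq.
    + apply qderiv_mult; [apply qderiv_nome | ].
      apply (qderiv_comp (fun w => / w)%C (fun y => 1 - nome y)%C);
        [apply qderiv_minus; [apply qderiv_const | apply qderiv_nome] | apply qderiv_inv; auto].
    + cbv beta; field; auto. }
pose proof (qderiv_unique _ _ _ _ D1 (qderiv_lser 0 z Hz)) as E.
pose proof I2pi_nz as I0.
replace (lser 1 z) with ((I2pi * lser 1 z) / I2pi)%C by (field; auto).
rewrite <- E; field; auto.
Qed.

Lemma nome_add_1 (z : C) : nome (z + 1) = nome z.
Proof.
rewrite !nome_Cexp.
replace (I2pi * (z + 1))%C with (I2pi * z + I2pi * RtoC (IZR 1))%C by ring.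
rewrite Cexp_plus, Cexp_2piZ; ring.
Qed.

Lemma Cexp_ipi : Cexp (I2pi * RtoC (/ 2)) = (- (1))%C.
Proof.
unfold Cexp, I2pi; apply C_eq; simpl.
- replace (2 * PI * 0 - 0 * 1) with 0 by ring.
  replace (0 * 0 + (2 * PI * 1 + 0 * 0) * / 2) with PI by field.
  replace (0 * / 2 - (2 * PI * 1 + 0 * 0) * 0) with 0 by field.
  rewrite cos_PI, sin_PI, exp_0; ring.
- replace (2 * PI * 0 - 0 * 1) with 0 by ring.
  replace (0 * 0 + (2 * PI * 1 + 0 * 0) * / 2) with PI by field.
  replace (0 * / 2 - (2 * PI * 1 + 0 * 0) * 0) with 0 by field.
  rewrite cos_PI, sin_PI, exp_0; ring.
Qed.

Definition half (z : C) : C := (RtoC (/ 2) * z)%C.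

Lemma half_H (z : C) : upper_half_plane z -> upper_half_plane (half z).
Proof. unfold upper_half_plane, half, Im; destruct z as [x y]; simpl; intros; lra. Qed.

Lemma add_real_H (z : C) (x : R) : upper_half_plane z -> upper_half_plane (z + RtoC x).
Proof. unfold upper_half_plane, Im; destruct z; simpl; intros; lra. Qed.

Lemma nome_half (z : C) : (nome (half z) * nome (half z))%C = nome z.
Proof.
rewrite !nome_Cexp, <- Cexp_plus; f_equal; unfold half.
assert (E : (RtoC (/ 2) + RtoC (/ 2))%C = 1%C) by (rewrite <- RtoC_plus; f_equal; field).
replace (I2pi * (RtoC (/ 2) * z) + I2pi * (RtoC (/ 2) * z))%C with ((RtoC (/ 2) + RtoC (/ 2)) * (I2pi * z))%C by ring.
rewrite E; ring.
Qed.

Lemma nome_half_1 (z : C) : nome (half (z + 1)) = (- nome (half z))%C.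
Proof.
rewrite !nome_Cexp; unfold half.
replace (I2pi * (RtoC (/ 2) * (z + 1)))%C with (I2pi * (RtoC (/ 2) * z) + I2pi * RtoC (/ 2))%C by ring.
rewrite Cexp_plus, Cexp_ipi; ring.
Qed.

(** The two nomes are [p] and [- p] with p^2 = q, and p/(1-p)^2 - p/(1+p)^2 = 4 p^2/(1-p^2)^2. *)
Lemma lser_1_half (z : C) : upper_half_plane z ->
  (lser 1 (half z) + lser 1 (half (z + 1)) = 4 * lser 1 z)%C.
Proof.
intros Hz.
pose proof (half_H z Hz) as H1; pose proof (half_H _ (add_real_H z 1 Hz)) as H2.
rewrite !lser_1 by auto.
pose proof (one_minus_nz _ (Cmod_nome_lt_1 z Hz)) as N0.
pose proof (one_minus_nz _ (Cmod_nome_lt_1 _ H1)) as N1.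
pose proof (one_minus_nz _ (Cmod_nome_lt_1 _ H2)) as N2.
rewrite nome_half_1; rewrite nome_half_1 in N2; rewrite <- (nome_half z); rewrite <- (nome_half z) in N0.
set (p := nome (half z)) in *.
field; repeat split; auto.
Qed.

Lemma lser_add_1 (j : nat) (z : C) : lser j (z + 1) = lser j z.
Proof. unfold lser; rewrite nome_add_1; auto. Qed.

(** Doubling z/2 + d and (z+1)/2 + d gives z plus the even and z plus the odd integers; the square
    of the factor 2 is the 4. *)
Lemma epsum_2_half (z : C) : upper_half_plane z ->
  (epsum 2 (half z) + epsum 2 (half (z + 1)) = 4 * epsum 2 z)%C.
Proof.
intros Hz.
pose proof (half_H z Hz) as H1; pose proof (half_H _ (add_real_H z 1 Hz)) as H2.
assert (E : forall d, (epsk 2 (half z) d + epsk 2 (half (z + 1)) d)%C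
   = (4 * (epsk 2 z (2 * d) + epsk 2 z (2 * d + 1)))%C).
{ intros d; unfold epsk.
  pose proof (shift_neq_0 z (2 * d) Hz) as N0; pose proof (shift_neq_0 z (2 * d + 1) Hz) as N1.
  replace (half z + RtoC (IZR d))%C with (RtoC (/ 2) * (z + RtoC (IZR (2 * d))))%C.
  2:{ unfold half; rewrite mult_IZR, RtoC_mult, RtoC_inv by lra; field. }
  replace (half (z + 1) + RtoC (IZR d))%C with (RtoC (/ 2) * (z + RtoC (IZR (2 * d + 1))))%C.
  2:{ unfold half; rewrite plus_IZR, mult_IZR, RtoC_plus, RtoC_mult, RtoC_inv by lra; field. }
  rewrite RtoC_inv by lra; field; auto. }
assert (Dg : zdom (fun d => epsk 2 z (2 * d) + epsk 2 z (2 * d + 1))%C).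
{ destruct (zdom_plus _ _ (zdom_epsk 2 _ (le_n 2) H1) (zdom_epsk 2 _ (le_n 2) H2)) as [K HK].
  exists (K / 4); intros d; specialize (HK d); rewrite E, Cmod_mult, Cmod_R, Rabs_pos_eq in HK by lra.
  lra. }
unfold epsum.
rewrite <- zsum_plus by (apply acv_sym_epsk; auto).
rewrite (zsum_ext _ _ E), zsum_scal by (apply zdom_acv; auto).
rewrite zsum_even_odd; auto; apply zdom_epsk; auto.
Qed.

Lemma epsum_add_1 (k : nat) (z : C) : (2 <= k)%nat -> upper_half_plane z ->
  epsum k (z + 1) = epsum k z.
Proof.
intros Hk Hz; pose proof (add_real_H z 1 Hz) as H1.
assert (E : forall d, epsk k (z + 1) d = epsk k z (d + 1)).
{ intros d; unfold epsk; rewrite plus_IZR, RtoC_plus; f_equal; f_equal; ring. }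
unfold epsum; rewrite (zsum_ext _ _ E); apply zsum_shift; [apply zdom_epsk; auto | ].
destruct (zdom_epsk k _ Hk H1) as [K HK]; exists K; intros d; rewrite <- E; auto.
Qed.

(** The partial fraction expansion of pi^2 / sin^2(pi z) minus its q-series (2 pi i)^2 q / (1 -
    q)^2. *)
Definition csc_defect (z : C) : C := (epsum 2 z - I2pi * I2pi * lser 1 z)%C.

Lemma csc_defect_add_1 (z : C) : upper_half_plane z -> csc_defect (z + 1) = csc_defect z.
Proof. intros; unfold csc_defect; rewrite epsum_add_1, lser_add_1; auto. Qed.

Lemma csc_defect_half (z : C) : upper_half_plane z ->
  csc_defect z = ((csc_defect (half z) + csc_defect (half (z + 1))) / 4)%C.
Proof.
intros Hz; unfold csc_defect.
pose proof (epsum_2_half z Hz) as E; pose proof (lser_1_half z Hz) as L.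
replace (epsum 2 z) with ((4 * epsum 2 z) / 4)%C by field.
replace (lser 1 z) with ((4 * lser 1 z) / 4)%C by field.
rewrite <- E, <- L; field.
Qed.

Lemma period_Z (f : C -> C) : (forall w, upper_half_plane w -> f (w + 1)%C = f w) ->
  forall n w, upper_half_plane w -> f (w + RtoC (IZR n))%C = f w.
Proof.
intros Hf.
assert (Hn : forall n w, upper_half_plane w -> f (w + RtoC (INR n))%C = f w).
{ induction n; intros w Hw.
  - simpl; f_equal; ring.
  - rewrite S_INR, RtoC_plus, Cplus_assoc, Hf; auto; apply add_real_H; auto. }
intros n w Hw; destruct (Z_le_dec 0 n) as [L | L].
- rewrite <- (Z2Nat.id n L), <- INR_IZR_INZ; auto.
- rewrite <- (Hn (Z.to_nat (- n)) (w + RtoC (IZR n))%C) by (apply add_real_H; auto).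
  f_equal; rewrite INR_IZR_INZ, Z2Nat.id, opp_IZR, RtoC_opp by lia; ring.
Qed.

Lemma period_reduce (f : C -> C) (z : C) :
  (forall w, upper_half_plane w -> f (w + 1)%C = f w) -> upper_half_plane z ->
  exists w, f w = f z /\ Im w = Im z /\ Rabs (Re w) <= / 2.
Proof.
intros Hf Hz.
set (n := up (Re z - / 2)).
destruct (archimed (Re z - / 2)) as [A B]; fold n in A, B.
exists (z + RtoC (IZR (- n)))%C; split; [apply period_Z; auto | ].
rewrite opp_IZR; split; [unfold Im; simpl; ring | ].
unfold Re; simpl; apply Rabs_le; unfold Re in *; lra.
Qed.

Lemma sin_lower (b : R) : 0 <= b <= 2 -> b / 3 <= sin b.
Proof.
intros Hb.
assert (HP : b <= PI) by (pose proof PI2_1; lra).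
destruct (SIN b ltac:(lra) HP) as [L _].
eapply Rle_trans; [ | exact L].
unfold sin_lb, sin_approx, sin_term; simpl.
field_simplify.
assert (0 <= b * (2 - b)) by (apply Rmult_le_pos; lra).
set (t := b * b).
assert (Ht : 0 <= t <= 4) by (unfold t; nra).
assert (P : / 3 <= 1 - t / 6 + t ^ 2 / 120 - t ^ 3 / 5040).
{ assert (0 <= t ^ 2 * (42 - t)) by (apply Rmult_le_pos; [apply pow2_ge_0 | lra]); nra. }
apply (Rmult_le_compat_l b) in P; [ | lra].
unfold t in P; lra.
Qed.

Lemma sinh_lower (a : R) : (2 * a) ^ 2 <= (exp a - exp (- a)) ^ 2.
Proof.
assert (P : forall t, 0 <= t -> 2 * t <= exp t - exp (- t)).
{ intros t Ht.
  destruct (MVT_gen (fun s => exp s - exp (- s) - 2 * s) 0 t (fun s => exp s + exp (- s) - 2)) as (c & _ & E).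
  - intros; auto_derive; auto; ring.
  - intros x _; apply derivable_continuous_pt; exists (exp x + exp (- x) - 2).
    apply is_derive_Reals; auto_derive; auto; ring.
  - rewrite Ropp_0, exp_0 in E.
    assert (2 <= exp c + exp (- c)).
    { assert (exp c * exp (- c) = 1) by (rewrite <- exp_plus, Rplus_opp_r; apply exp_0).
      pose proof (exp_pos c); pose proof (exp_pos (- c)).
      pose proof (pow2_ge_0 (exp c - exp (- c))).
      apply Rnot_lt_le; intros L.
      assert ((exp c + exp (- c)) * (exp c + exp (- c)) < 2 * 2) by (apply Rmult_le_0_lt_compat; lra).
      nra. }
    assert (0 <= (exp c + exp (- c) - 2) * (t - 0)) by (apply Rmult_le_pos; lra); lra. }
destruct (Rle_dec 0 a) as [H | H].
- specialize (P a H); apply pow_incr; lra.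
- specialize (P (- a) ltac:(lra)); rewrite Ropp_involutive in P.
  replace ((2 * a) ^ 2) with ((2 * - a) ^ 2) by ring.
  replace ((exp a - exp (- a)) ^ 2) with ((exp (- a) - exp a) ^ 2) by ring.
  apply pow_incr; lra.
Qed.

(** |2 sinh(a + i b)|^2 = (2 sinh a)^2 + 4 sin(b)^2, and the two squares are bounded below by 4 a^2
    and 4 b^2 / 9. The range of [b] must stay away from the zero pi of the sine. *)
Lemma Cexp_diff_lower (a b : R) : Rabs b <= 2 ->
  4 / 9 * Cmod (a, b) ^ 2 <= Cmod (Cexp (a, b) - Cexp (- (a, b))) ^ 2.
Proof.
intros Hb; rewrite !Cmod2_alt.
replace (Re (Cexp (a, b) - Cexp (- (a, b)))) with ((exp a - exp (- a)) * cos b).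
2:{ unfold Cexp, Re, Im; simpl; rewrite cos_neg, sin_neg; ring. }
replace (Im (Cexp (a, b) - Cexp (- (a, b)))) with ((exp a + exp (- a)) * sin b).
2:{ unfold Cexp, Re, Im; simpl; rewrite cos_neg, sin_neg; ring. }
assert (E : exp a * exp (- a) = 1) by (rewrite <- exp_plus, Rplus_opp_r; apply exp_0).
pose proof (sin2_cos2 b) as T; unfold Rsqr in T.
replace (((exp a - exp (- a)) * cos b) ^ 2 + ((exp a + exp (- a)) * sin b) ^ 2)
  with ((exp a - exp (- a)) ^ 2 * (sin b * sin b + cos b * cos b) + 4 * (exp a * exp (- a)) * sin b ^ 2) by ring.
rewrite T, E; pose proof (sinh_lower a).
assert (S2 : b ^ 2 / 9 <= sin b ^ 2).
{ assert (Q : Rabs b / 3 <= Rabs (sin b)).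
  { unfold Rabs at 1; destruct (Rcase_abs b) as [C | C].
    - rewrite Rabs_left1 in Hb by lra.
      pose proof (sin_lower (- b) ltac:(lra)) as L; rewrite sin_neg in L.
      rewrite <- Rabs_Ropp; eapply Rle_trans; [exact L | apply Rle_abs].
    - rewrite Rabs_pos_eq in Hb by lra.
      eapply Rle_trans; [apply sin_lower; lra | apply Rle_abs]. }
  rewrite <- (pow2_abs (sin b)), <- (pow2_abs b).
  pose proof (Rabs_pos b); nra. }
unfold Re, Im; simpl fst; simpl snd; nra.
Qed.

(** For |Re z| <= 1/2 the terms with d <> 0 stay bounded down to the real axis, and only the pole
    1/z^2 threatens. With u = 2 pi i z and D = 2 cosh u - 2 it combines with the q-series into (2 pi
    i)^2 (D - u^2) / (u^2 D), whose numerator and denominator are both of order 4 in u. *)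
Lemma csc_defect_bounded : exists K, 0 <= K /\ forall z, upper_half_plane z -> Im z <= 1 ->
  Rabs (Re z) <= / 2 -> Cmod (csc_defect z) <= K.
Proof.
set (S0 := Series (fun n => / (INR n + 1) ^ 2)).
(* 18 is the factor 2 of [cosh_quartic] times the 9 of the lower bound |D| >= |u|^2 / 9, and 4 pi
   bounds |u|. *)
set (K2 := 18 * (2 * PI) ^ 2 * exp (4 * PI)).
assert (HS0 : 0 <= S0).
{ apply Series_pos; [ | apply ex_series_inv_sqr]; intros n; apply Rlt_le, Rinv_0_lt_compat, pow_lt.
  pose proof (pos_INR n); lra. }
pose proof PI_RGT_0 as HPI.
assert (HK2 : 0 <= K2).
{ unfold K2; apply Rmult_le_pos; [ | apply Rlt_le, exp_pos]; apply Rmult_le_pos; [lra | apply pow2_ge_0]. }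
exists (8 * S0 + K2); split; [lra | ].
intros z Hz Hy Hx.
pose proof (Cmod_nome_lt_1 z Hz) as Hq; pose proof (one_minus_nz _ Hq) as Hnz.
assert (Z0 : z <> 0%C).
{ intros E; unfold upper_half_plane in Hz; rewrite E in Hz; simpl in Hz; lra. }
assert (E : csc_defect z = (csum (fun n => sym (epsk 2 z) (S n)) + (/ (z * z) - I2pi * I2pi * lser 1 z))%C).
{ unfold csc_defect, epsum, zsum; rewrite csum_incr by (apply acv_sym_epsk; auto).
  unfold sym at 1, epsk at 1; replace (z + RtoC (IZR 0))%C with z by ring.
  simpl Cpow; replace (z * (z * 1))%C with (z * z)%C by ring; ring. }
rewrite E; eapply Rle_trans; [apply Cmod_triangle | apply Rplus_le_compat].
- unfold S0; rewrite <- Series_scal_l; apply Cmod_csum_le_maj.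
  2:{ apply (ex_series_scal_l 8 (fun n => / (INR n + 1) ^ 2)), ex_series_inv_sqr. }
  intros n; unfold sym, epsk.
  assert (B : forall d : Z, IZR (Z.abs d) = INR n + 1 ->
    Cmod (/ (z + RtoC (IZR d)) ^ 2) <= 4 * / (INR n + 1) ^ 2).
  { intros d Hd; pose proof (pos_INR n) as Pn.
    eapply Rle_trans; [apply (Cmod_inv_pow_le _ ((INR n + 1) / 2)); [lra | ] | apply Req_le; field; lra].
    eapply Rle_trans; [ | apply Re_le_Cmod].
    replace (Re (z + RtoC (IZR d))%C) with (IZR d + Re z) by (unfold Re; simpl; ring).
    rewrite abs_IZR in Hd.
    apply Rabs_le_between in Hx.
    unfold Rabs in *; destruct (Rcase_abs (IZR d)), (Rcase_abs (IZR d + Re z)); lra. }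
  eapply Rle_trans; [apply Cmod_triangle | ].
  assert (I1 : IZR (Z.abs (Z.of_nat (S n))) = INR n + 1).
  { rewrite Z.abs_eq, <- INR_IZR_INZ, S_INR by lia; auto. }
  assert (I2 : IZR (Z.abs (- Z.of_nat (S n))) = INR n + 1) by (rewrite Z.abs_opp; auto).
  pose proof (B _ I1); pose proof (B _ I2); lra.
- set (u := (I2pi * z)%C).
  assert (Hu : Cmod u <= 4 * PI).
  { unfold u; rewrite Cmod_mult, Cmod_I2pi.
    pose proof (Cmod_le_ReIm z); unfold upper_half_plane in Hz; rewrite (Rabs_pos_eq (Im z)) in H by lra; nra. }
  assert (U0 : u <> 0%C) by (apply Cmult_neq_0; auto; apply I2pi_nz).
  set (D := (Cexp u + Cexp (- u) - 2)%C).
  pose proof (cosh_quartic (4 * PI) u Hu) as Q; fold D in Q.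
  assert (DL : Cmod u ^ 2 / 9 <= Cmod D).
  { set (w := (RtoC (/ 2) * u)%C).
    assert (Ew : (w + w)%C = u).
    { unfold w; rewrite RtoC_inv by lra; field. }
    assert (ED : D = ((Cexp w - Cexp (- w)) * (Cexp w - Cexp (- w)))%C).
    { assert (P : (Cexp w * Cexp (- w))%C = 1%C).
      { rewrite <- Cexp_plus; replace (w + - w)%C with (RtoC 0) by ring; apply Cexp_0. }
      unfold D; rewrite <- Ew; replace (- (w + w))%C with (- w + - w)%C by ring; rewrite !Cexp_plus.
      transitivity (Cexp w * Cexp w + Cexp (- w) * Cexp (- w) - 2 * (Cexp w * Cexp (- w)))%C; [rewrite P | ]; ring. }
    assert (Mw : Cmod u = 2 * Cmod w).
    { rewrite <- Ew; replace (w + w)%C with (2 * w)%C by ring.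
      rewrite Cmod_mult, Cmod_R, Rabs_pos_eq; lra. }
    rewrite ED, Cmod_mult, Mw.
    assert (Hw : Rabs (snd w) <= 2).
    { replace (snd w) with (PI * Re z) by (unfold w, u, I2pi, Re; simpl; field).
      rewrite Rabs_mult, (Rabs_pos_eq PI) by lra; pose proof PI_4; nra. }
    destruct w as [a b]; simpl in Hw; pose proof (Cexp_diff_lower a b Hw); nra. }
  pose proof (Cmod_pos u U0) as Pu.
  assert (D0 : D <> 0%C) by (apply Cmod_neq_0; assert (0 < Cmod u ^ 2) by (apply pow_lt; auto); lra).
  assert (EL : lser 1 z = (/ D)%C).
  { rewrite lser_1 by auto; unfold D, u; rewrite Cexp_opp; fold (Cexp (I2pi * z)).
    rewrite <- nome_Cexp.
    assert (Nq : nome z <> 0%C) by (rewrite nome_Cexp; apply Cexp_neq_0).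
    assert (D0' : (nome z + / nome z - 2)%C <> 0%C).
    { unfold D, u in D0; rewrite Cexp_opp, <- nome_Cexp in D0; exact D0. }
    assert (D1 : (nome z + / nome z - 2)%C = ((1 - nome z) * (1 - nome z) / nome z)%C) by (field; auto).
    rewrite D1; field; auto. }
  replace (/ (z * z) - I2pi * I2pi * lser 1 z)%C
    with (I2pi * I2pi * (D - u * u) / (u * u * D))%C.
  2:{ rewrite EL; unfold u; field; repeat split; auto; apply I2pi_nz. }
  assert (UD0 : (u * u * D)%C <> 0%C).
  { apply Cmult_neq_0; auto; exact (Cmult_neq_0 u u U0 U0). }
  rewrite Cmod_div by auto.
  clearbody u; rewrite !Cmod_mult, !Cmod_I2pi.
  assert (PD : 0 < Cmod u * Cmod u * Cmod D).
  { repeat apply Rmult_lt_0_compat; auto; apply Cmod_pos; auto. }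
  apply Rmult_le_reg_r with (Cmod u * Cmod u * Cmod D); auto.
  unfold Rdiv; rewrite Rmult_assoc, Rinv_l, Rmult_1_r by lra.
  apply Rle_trans with (2 * PI * (2 * PI) * (2 * exp (4 * PI) * Cmod u ^ 4)).
  + apply Rmult_le_compat_l; [nra | exact Q].
  + apply Rle_trans with (K2 * (Cmod u * Cmod u * (Cmod u ^ 2 / 9))).
    * unfold K2; apply Req_le; field.

    * apply Rmult_le_compat_l; auto; apply Rmult_le_compat_l; nra.
Qed.

(** * Lipschitz formula and zeta(2) *)

Lemma Im_half (z : C) : Im (half z) = Im z / 2.
Proof. unfold half, Im; destruct z; simpl; field. Qed.

Lemma Im_add_real (z : C) (x : R) : Im (z + RtoC x) = Im z.
Proof. unfold Im; destruct z; simpl; ring. Qed.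

(* [csc_defect_half] halves the height and the bound simultaneously. *)
Lemma csc_defect_zero (z : C) : upper_half_plane z -> csc_defect z = 0%C.
Proof.
destruct csc_defect_bounded as (K & HK & HB).
assert (B0 : forall n z, upper_half_plane z -> Im z <= 1 -> Cmod (csc_defect z) <= K / 2 ^ n).
{ induction n; intros w Hw H1.
  - destruct (period_reduce csc_defect w csc_defect_add_1 Hw) as (v & E & I & Rv).
    rewrite <- E; simpl; unfold Rdiv; rewrite Rinv_1, Rmult_1_r.
    apply HB; auto; [unfold upper_half_plane in *; lra | lra].
  - rewrite csc_defect_half by auto.
    pose proof (half_H w Hw) as A1; pose proof (half_H _ (add_real_H w 1 Hw)) as A2.
    unfold upper_half_plane in Hw.
    assert (C1 : Cmod (csc_defect (half w)) <= K / 2 ^ n) by (apply IHn; auto; rewrite Im_half; lra).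
    assert (C2 : Cmod (csc_defect (half (w + 1))) <= K / 2 ^ n).
    { apply IHn; auto; rewrite Im_half, Im_add_real; lra. }
    rewrite Cmod_div by (apply Cmod_neq_0; rewrite Cmod_R, Rabs_pos_eq; lra).
    rewrite Cmod_R, (Rabs_pos_eq 4) by lra.
    pose proof (Cmod_triangle (csc_defect (half w)) (csc_defect (half (w + 1)))) as T.
    assert (P : 0 <= K / 2 ^ n) by (apply Rdiv_le_0_compat; auto; apply pow_lt; lra).
    replace (K / 2 ^ S n) with (K / 2 ^ n / 2) by (simpl; field; apply pow_nonzero; lra).
    lra. }
assert (Z1 : forall z, upper_half_plane z -> Im z <= 1 -> csc_defect z = 0%C).
{ intros w Hw H1; apply Cmod_eq_0, Rle_antisym; [ | apply Cmod_ge_0].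
  apply Rle_eps; intros eps He.
  destruct (nfloor_ex (K / eps)) as [N [_ HN]]; [apply Rdiv_le_0_compat; lra | ].
  eapply Rle_trans; [apply (B0 (S N)); auto | ].
  assert (P : INR N + 1 <= 2 ^ S N).
  { pose proof (poly N 1 ltac:(lra)) as Q; replace (1 + 1) with 2 in Q by ring; simpl.
    pose proof (pos_INR N); lra. }
  apply Rmult_le_reg_r with (2 ^ S N); [apply pow_lt; lra | ].
  unfold Rdiv at 1; rewrite Rmult_assoc, Rinv_l by (apply pow_nonzero; lra).
  apply (Rmult_lt_compat_l eps) in HN; auto.
  replace (eps * (K / eps)) with K in HN by (field; lra); nra. }
intros Hz.
(* The same relation carries the vanishing upwards, since [w] is expressed through two points of
   half its height. *)
assert (Zn : forall n w, upper_half_plane w -> Im w <= 2 ^ n -> csc_defect w = 0%C).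
{ induction n; intros w Hw H1; [apply Z1; auto | ].
  rewrite csc_defect_half by auto.
  rewrite (IHn (half w)), (IHn (half (w + 1))).
  - replace (0 + 0)%C with (RtoC 0) by ring; unfold Cdiv; ring.
  - apply half_H, add_real_H; auto.
  - rewrite Im_half, Im_add_real; simpl in H1; lra.
  - apply half_H; auto.
  - rewrite Im_half; simpl in H1; lra. }
destruct (nfloor_ex (Im z)) as [N [_ HN]]; [unfold upper_half_plane in Hz; lra | ].
apply (Zn N); auto; pose proof (poly N 1 ltac:(lra)) as Q; replace (1 + 1) with 2 in Q by ring.
lra.
Qed.

Lemma epsum_2 (z : C) : upper_half_plane z -> epsum 2 z = (I2pi * I2pi * lser 1 z)%C.
Proof.
intros Hz; pose proof (csc_defect_zero z Hz) as E; unfold csc_defect in E.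
replace (epsum 2 z) with ((epsum 2 z - I2pi * I2pi * lser 1 z) + I2pi * I2pi * lser 1 z)%C by ring.
rewrite E; ring.
Qed.

(** The squared cosecant is the base case; every further exponent is the derivative of the preceding
    one. *)
Lemma Lipschitz (j : nat) (z : C) : upper_half_plane z ->
  (RtoC (INR (fact (S j))) * epsum (S (S j)) z = (- I2pi) ^ (S (S j)) * lser (S j) z)%C.
Proof.
revert z; induction j; intros z Hz.
- rewrite epsum_2 by auto; simpl; ring.
- assert (D1 : qderiv (fun y => RtoC (INR (fact (S j))) * epsum (S (S j)) y)%C z
    (RtoC (INR (fact (S j))) * - (RtoC (INR (S (S j))) * epsum (S (S (S j))) z))%C).
  { apply qderiv_scal, qderiv_epsum; auto; lia. }
  assert (D2 : qderiv (fun y => RtoC (INR (fact (S j))) * epsum (S (S j)) y)%C z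
    ((- I2pi) ^ (S (S j)) * (I2pi * lser (S (S j)) z))%C).
  { apply qderiv_ext_loc with (fun y => (- I2pi) ^ (S (S j)) * lser (S j) y)%C.
    - destruct (upper_half_plane_nbhd z Hz) as (d & Hd & H); exists d; split; auto.
      intros h Hh; symmetry; apply IHj; auto.
    - apply qderiv_scal, qderiv_lser; auto. }
  pose proof (qderiv_unique _ _ _ _ D1 D2) as E.
  replace (INR (fact (S (S j)))) with (INR (fact (S j)) * INR (S (S j)))
    by (rewrite (fact_simpl (S j)), mult_INR; ring).
  rewrite RtoC_mult.
  replace ((- I2pi) ^ S (S (S j)) * lser (S (S j)) z)%C
    with (- ((- I2pi) ^ S (S j) * (I2pi * lser (S (S j)) z)))%C by (simpl; ring).
  rewrite <- E; ring.
Qed.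

Lemma Cexp_taylor_4 (r : R) (u : C) : Cmod u <= r ->
  Cmod (Cexp u - 1 - u - / 2 * (u * u) - / 6 * (u * u * u))%C <= exp r * Cmod u ^ 4.
Proof.
intros Hu.
assert (HM : 0 <= exp r) by (pose proof (exp_pos r); lra).
assert (N6 : RtoC 6 <> 0%C) by (apply Cmod_neq_0; rewrite Cmod_R, Rabs_pos_eq; lra).
assert (B0 : forall v, Cmod v <= r -> Cmod (Cexp v) <= exp r * Cmod v ^ 0).
{ intros v Hv; pose proof (Cmod_Cexp_le v r Hv); simpl; lra. }
assert (B1 : forall v, Cmod v <= r -> Cmod (Cexp v - 1)%C <= exp r * Cmod v ^ 1).
{ intros v Hv; apply (Cmvt_0 (fun v => Cexp v - 1)%C (fun v => Cexp v)%C r); auto.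
  - rewrite Cexp_0; ring.
  - intros w _; qd. }
assert (B2 : forall v, Cmod v <= r -> Cmod (Cexp v - 1 - v)%C <= exp r * Cmod v ^ 2).
{ intros v Hv; apply (Cmvt_0 (fun v => Cexp v - 1 - v)%C (fun v => Cexp v - 1)%C r); auto.
  - rewrite Cexp_0; ring.
  - intros w _; qd. }
assert (B3 : forall v, Cmod v <= r -> Cmod (Cexp v - 1 - v - / 2 * (v * v))%C <= exp r * Cmod v ^ 3).
{ intros v Hv; apply (Cmvt_0 (fun v => Cexp v - 1 - v - / 2 * (v * v))%C (fun v => Cexp v - 1 - v)%C r); auto.
  - rewrite Cexp_0; ring.
  - intros w _; qd. }
apply (Cmvt_0 (fun v => Cexp v - 1 - v - / 2 * (v * v) - / 6 * (v * v * v))%C (fun v => Cexp v - 1 - v - / 2 * (v * v))%C r); auto.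
- rewrite Cexp_0; ring.
- intros w _; qd.
Qed.

Lemma exp_taylor_4 (t : R) : 0 <= t <= 1 ->
  Rabs (exp t - 1 - t - t ^ 2 / 2 - t ^ 3 / 6) <= 3 * t ^ 4.
Proof.
intros Ht.
assert (H : Cmod (RtoC t) <= 1) by (rewrite Cmod_R, Rabs_pos_eq; lra).
pose proof (Cexp_taylor_4 1 (RtoC t) H) as T.
rewrite Cexp_R in T.
replace (RtoC (exp t) - 1 - RtoC t - / 2 * (RtoC t * RtoC t) - / 6 * (RtoC t * RtoC t * RtoC t))%C
  with (RtoC (exp t - 1 - t - t ^ 2 / 2 - t ^ 3 / 6)) in T.
2:{ rewrite <- !RtoC_inv by lra; repeat rewrite <- RtoC_mult; repeat rewrite <- RtoC_minus; f_equal; field. }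
rewrite !Cmod_R, (Rabs_pos_eq t) in T by lra.
eapply Rle_trans; [exact T | ].
apply Rmult_le_compat_r; [apply pow_le; lra | apply exp_le_3].
Qed.

(* The expansion 1/(e^t - 1) = 1/t - 1/2 + t/12 + O(t^2). *)
Lemma bernoulli_expansion (t : R) : 0 < t <= 1 ->
  Rabs (/ (exp t - 1) - / t + / 2 - t / 12) <= 20 * t ^ 2.
Proof.
intros Ht.
pose proof (exp_taylor_4 t ltac:(lra)) as T.
pose proof (exp_ineq1_le t) as E1.
set (rho := exp t - 1 - t - t ^ 2 / 2 - t ^ 3 / 6) in *.
assert (Ee : exp t - 1 = t + t ^ 2 / 2 + t ^ 3 / 6 + rho) by (unfold rho; ring).
set (w := exp t - 1) in *.
assert (Hw : t <= w) by (unfold w; lra).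
replace (/ w - / t + / 2 - t / 12)
  with ((t ^ 4 / 2 - t ^ 5 / 6 - 12 * rho + 6 * t * rho - t ^ 2 * rho) / (12 * t * w)).
2:{ apply (Rmult_eq_reg_r (12 * t * w)); [ | nra].
    unfold Rdiv; rewrite Rmult_assoc, Rinv_l by nra.
    replace ((/ w - / t + / 2 - t * / 12) * (12 * t * w)) with (12 * t - 12 * w + 6 * t * w - t ^ 2 * w)
      by (field; lra).
    rewrite Ee; field. }
unfold Rdiv; rewrite Rabs_mult, Rabs_inv, (Rabs_pos_eq (12 * t * w)) by nra.
apply Rmult_le_reg_r with (12 * t * w); [nra | ].
rewrite Rmult_assoc, Rinv_l, Rmult_1_r by nra.
apply Rle_trans with (240 * t ^ 4).
- apply Rabs_le_between in T.
  assert (P2 : t ^ 2 <= 1) by nra.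
  assert (P4 : 0 <= t ^ 4) by (apply pow_le; lra).
  assert (P5 : 0 <= t ^ 5 <= t ^ 4) by (split; [apply pow_le; lra | replace (t ^ 5) with (t ^ 4 * t) by ring; nra]).
  assert (Q1 : - (3 * t ^ 4) <= t * rho <= 3 * t ^ 4) by nra.
  assert (Q2 : - (3 * t ^ 4) <= t ^ 2 * rho <= 3 * t ^ 4) by nra.
  apply Rabs_le; lra.
- assert (0 <= t ^ 3 * (w - t)) by (apply Rmult_le_pos; [apply pow_le |]; lra).
  nra.
Qed.

Definition zeta (k : nat) : R := Series (fun n => / (INR n + 1) ^ k).

Lemma ex_series_zeta (k : nat) : (2 <= k)%nat -> ex_series (fun n => / (INR n + 1) ^ k).
Proof.
intros Hk; apply ex_series_le_pos with (fun n => / (INR n + 1) ^ 2); [ | apply ex_series_inv_sqr].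
intros n; pose proof (pos_INR n); split.
- apply Rlt_le, Rinv_0_lt_compat, pow_lt; lra.
- apply Rinv_le_contravar; [apply pow_lt; lra | apply Rle_pow; auto; lra].
Qed.

Lemma epsum_1_const : exists K, forall z, upper_half_plane z -> epsum 1 z = (K - I2pi * lser 0 z)%C.
Proof.
set (f := fun z => (epsum 1 z + I2pi * lser 0 z)%C).
exists (f (0, 1)); intros z Hz.
assert (E : f z = f (0, 1)).
{ apply qderiv_0_const; intros t Ht.
  set (w := ((0, 1) + RtoC t * (z - (0, 1)))%C).
  assert (Hw : upper_half_plane w).
  { unfold upper_half_plane in *; unfold w; unfold Im in *; destruct z as [x y]; simpl in *; nra. }
  unfold f; eapply qderiv_eq.
  - apply qderiv_plus; [apply qderiv_epsum; auto | apply qderiv_scal, qderiv_lser; auto].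
  - rewrite epsum_2 by auto; simpl; ring. }
rewrite <- E; unfold f; ring.
Qed.

Definition zeta2_shifted (y : R) : R := Series (fun n => / ((INR n + 1) ^ 2 + y ^ 2)).

Lemma zeta2_shifted_close (y : R) : 0 <= zeta 2 /\ Rabs (zeta2_shifted y - zeta 2) <= y ^ 2 * zeta 2 /\ 0 <= zeta2_shifted y <= zeta 2.
Proof.
assert (P : forall n, 1 <= (INR n + 1) ^ 2).
{ intros n; pose proof (pos_INR n); nra. }
pose proof (pow2_ge_0 y) as Y.
assert (B : forall n, 0 <= / ((INR n + 1) ^ 2 + y ^ 2) <= / (INR n + 1) ^ 2).
{ intros n; specialize (P n); split; [apply Rlt_le, Rinv_0_lt_compat; lra | apply Rinv_le_contravar; lra]. }
assert (ez : ex_series (fun n => / (INR n + 1) ^ 2)) by apply ex_series_inv_sqr.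
assert (ey : ex_series (fun n => / ((INR n + 1) ^ 2 + y ^ 2))).
{ eapply ex_series_le_pos; [exact B | exact ez]. }
split; [ | split; [ | split]].
- apply Series_pos; auto; intros n; specialize (B n); lra.
- unfold zeta2_shifted, zeta; rewrite <- Series_minus by auto.
  assert (Bd : forall n, 0 <= Rabs (/ ((INR n + 1) ^ 2 + y ^ 2) - / (INR n + 1) ^ 2) <= y ^ 2 * / (INR n + 1) ^ 2).
  { intros n; split; [apply Rabs_pos | ]; specialize (P n); specialize (B n).
    rewrite Rabs_left1 by lra.
    set (m := (INR n + 1) ^ 2) in *.
    replace (- (/ (m + y ^ 2) - / m)) with (y ^ 2 * / m * / (m + y ^ 2)) by (field; lra).
    rewrite <- (Rmult_1_r (y ^ 2 * / m)) at 2; apply Rmult_le_compat_l.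
    - apply Rmult_le_pos; auto; apply Rlt_le, Rinv_0_lt_compat; lra.
    - rewrite <- Rinv_1; apply Rinv_le_contravar; lra. }
  assert (es : ex_series (fun n => y ^ 2 * / (INR n + 1) ^ 2)) by (apply (ex_series_scal_l (y ^ 2) _ ez)).
  assert (ea : ex_series (fun n => Rabs (/ ((INR n + 1) ^ 2 + y ^ 2) - / (INR n + 1) ^ 2))).
  { eapply ex_series_le_pos; [exact Bd | exact es]. }
  eapply Rle_trans; [apply Series_Rabs; exact ea | ].
  rewrite <- Series_scal_l; apply Series_mono; auto; intros n; apply Bd.
- apply Series_pos; auto; intros n; apply B.
- apply Series_mono; auto; intros n; apply B.
Qed.

Lemma epsum_1_iy (y : R) : 0 < y ->
  epsum 1 (0, y) = (- Ci * RtoC (/ y + 2 * y * zeta2_shifted y))%C.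
Proof.
intros Hy; set (z := (0, y) : C).
assert (Hz : upper_half_plane z) by exact Hy.
unfold epsum, zsum; rewrite csum_incr by (apply acv_sym_epsk; auto).
assert (ey : ex_series (fun n => / ((INR n + 1) ^ 2 + y ^ 2))).
{ apply ex_series_le_pos with (fun n => / (INR n + 1) ^ 2); [ | apply ex_series_inv_sqr].
  intros n; pose proof (pos_INR n); pose proof (pow2_ge_0 y); split;
    [apply Rlt_le, Rinv_0_lt_compat | apply Rinv_le_contravar]; nra. }
assert (ac : acv (fun n => RtoC (/ ((INR n + 1) ^ 2 + y ^ 2)))).
{ revert ey; apply ex_series_ext; intros n; rewrite Cmod_R, Rabs_pos_eq; auto.
  pose proof (pos_INR n); pose proof (pow2_ge_0 y); apply Rlt_le, Rinv_0_lt_compat; nra. }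
rewrite (csum_ext _ (fun n => (- Ci * RtoC (2 * y)) * RtoC (/ ((INR n + 1) ^ 2 + y ^ 2)))%C).
- rewrite csum_scal, nnC_csum by (auto; intros n; apply nnC_R; pose proof (pos_INR n); pose proof (pow2_ge_0 y); apply Rlt_le, Rinv_0_lt_compat; nra).
  rewrite (Series_ext _ (fun n => / ((INR n + 1) ^ 2 + y ^ 2))).
  2:{ intros n; rewrite Cmod_R, Rabs_pos_eq; auto.
      pose proof (pos_INR n); pose proof (pow2_ge_0 y); apply Rlt_le, Rinv_0_lt_compat; nra. }
  fold (zeta2_shifted y); unfold sym, epsk, z; apply C_eq; simpl; field; nra.
- intros n; unfold sym, epsk.
  rewrite <- S_INR, opp_IZR, <- INR_IZR_INZ.
  assert (Pn : 1 <= INR (S n)) by (rewrite S_INR; pose proof (pos_INR n); lra).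
  set (m := INR (S n)) in *.
  unfold z; apply C_eq; simpl; field; repeat split; nra.
Qed.

Lemma lser_0_iy (y : R) : 0 < y -> lser 0 (0, y) = RtoC (/ (exp (2 * PI * y) - 1)).
Proof.
intros Hy; assert (Hz : upper_half_plane (0, y)) by exact Hy.
pose proof PI_RGT_0.
assert (E1 : 1 < exp (2 * PI * y)) by (rewrite <- exp_0; apply exp_increasing; nra).
unfold lser; rewrite ps_powcoef_0 by (apply Cmod_nome_lt_1; auto).
rewrite nome_xy; replace (I2pi * RtoC 0)%C with (RtoC 0) by ring; rewrite Cexp_0, Cmult_1_r.
rewrite <- RtoC_minus, <- RtoC_div.
- f_equal; rewrite exp_Ropp; field; lra.
- pose proof (exp_Ropp (2 * PI * y)) as Q; rewrite Q.
  assert (/ exp (2 * PI * y) < 1) by (rewrite <- Rinv_1; apply Rinv_lt_contravar; lra); lra.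
Qed.

Lemma R_eq_eps (a b K : R) : 0 <= K -> (forall t, 0 < t <= 1 -> Rabs (a - b) <= K * t) -> a = b.
Proof.
intros HK H.
assert (E : Rabs (a - b) <= 0).
{ apply Rle_eps; intros eps He.
  set (t := Rmin 1 (eps / (K + 1))).
  assert (T0 : 0 < t) by (apply Rmin_glb_lt; [lra | apply Rdiv_lt_0_compat; lra]).
  assert (T1 : t <= 1) by apply Rmin_l.
  assert (T2 : t <= eps / (K + 1)) by apply Rmin_r.
  specialize (H t ltac:(lra)); rewrite Rplus_0_l.
  apply (Rmult_le_compat_l (K + 1)) in T2; [ | lra].
  replace ((K + 1) * (eps / (K + 1))) with eps in T2 by (field; lra); nra. }
pose proof (Rabs_pos (a - b)).
assert (Z : Rabs (a - b) = 0) by lra.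
destruct (Req_dec (a - b) 0) as [Q | Q]; [lra | apply Rabs_no_R0 in Q; lra].
Qed.

(** Integrating the squared cosecant leaves an unknown constant [K]. On z = i y with t = 2 pi y the
    identity links [K], 1/(e^t - 1) and the sum of 1/(n^2 + y^2). As t tends to 0, the constant
    order yields K = - pi i and the linear order yields zeta(2). *)
Lemma epsum_1_and_zeta_2 :
  (forall z, upper_half_plane z -> epsum 1 z = (- (RtoC PI * Ci) - I2pi * lser 0 z)%C)
  /\ zeta 2 = PI ^ 2 / 6.
Proof.
destruct epsum_1_const as [K HK].
pose proof PI_RGT_0 as HPI.
destruct (zeta2_shifted_close 0) as (HZ & _ & _).
set (be := fun t => / (exp t - 1) - / t + / 2).
assert (EK : forall t, 0 < t <= 1 ->
   K = (Ci * RtoC (2 * PI * be t - PI - t / PI * zeta2_shifted (t / (2 * PI))))%C).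
{ intros t Ht; set (y := t / (2 * PI)).
  assert (Hy : 0 < y) by (apply Rdiv_lt_0_compat; lra).
  specialize (HK (0, y) Hy); rewrite epsum_1_iy, lser_0_iy in HK by auto.
  replace (2 * PI * y) with t in HK by (unfold y; field; lra).
  assert (1 < exp t) by (rewrite <- exp_0; apply exp_increasing; lra).
  replace K with ((K - I2pi * RtoC (/ (exp t - 1))) + I2pi * RtoC (/ (exp t - 1)))%C by ring.
  rewrite <- HK; unfold be, I2pi, y; apply C_eq; simpl; field; lra. }
assert (Bbe : forall t, 0 < t <= 1 -> Rabs (be t - t / 12) <= 20 * t ^ 2).
{ intros; apply bernoulli_expansion; auto. }
assert (K0 : Re K = 0).
{ rewrite (EK 1) by lra; simpl; ring. }
assert (K1 : Im K = - PI).
{ apply R_eq_eps with (2 * PI * (20 + / 12) + zeta 2 / PI).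
  { pose proof (Rdiv_le_0_compat _ _ HZ HPI); nra. }
  intros t Ht; rewrite (EK t Ht); simpl.
  destruct (zeta2_shifted_close (t / (2 * PI))) as (_ & _ & [Z0 Z1]).
  specialize (Bbe t Ht); apply Rabs_le_between in Bbe.
  set (zz := zeta2_shifted (t / (2 * PI))) in *.
  assert (Q : 0 <= t / PI * zz <= zeta 2 / PI * t).
  { assert (0 < / PI) by (apply Rinv_0_lt_compat; auto).
    assert (0 <= t * / PI) by (apply Rmult_le_pos; lra).
    unfold Rdiv; split; [apply Rmult_le_pos; auto | ].
    replace (zeta 2 * / PI * t) with (t * / PI * zeta 2) by ring.
    apply Rmult_le_compat_l; auto. }
  assert (T2 : t ^ 2 <= t) by nra.
  apply Rabs_le; split; nra. }
assert (KE : K = (- (RtoC PI * Ci))%C).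
{ apply C_eq; [rewrite K0 | rewrite K1]; simpl; ring. }
split.
- intros z Hz; rewrite HK, KE; auto.
- apply R_eq_eps with (2 * PI ^ 2 * 20 + zeta 2); [nra | ].
  intros t Ht; pose proof (EK t Ht) as E.
  rewrite KE in E; apply (f_equal Im) in E; simpl in E.
  destruct (zeta2_shifted_close (t / (2 * PI))) as (_ & Zc & _).
  specialize (Bbe t Ht).
  set (zz := zeta2_shifted (t / (2 * PI))) in *.
  assert (E2 : zz = 2 * PI ^ 2 * be t / t).
  { assert (Q : t / PI * zz = 2 * PI * be t) by lra.
    replace zz with ((t / PI * zz) * (PI / t)) by (field; lra); rewrite Q; field; lra. }
  replace (zeta 2 - PI ^ 2 / 6) with (- (zz - zeta 2) + 2 * PI ^ 2 / t * (be t - t / 12)).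
  2:{ rewrite E2; field; lra. }
  eapply Rle_trans; [apply Rabs_triang | ]; rewrite Rabs_Ropp, Rabs_mult.
  rewrite (Rabs_pos_eq (2 * PI ^ 2 / t)) by (apply Rdiv_le_0_compat; nra).
  assert (B2 : 2 * PI ^ 2 / t * Rabs (be t - t / 12) <= 2 * PI ^ 2 / t * (20 * t ^ 2)).
  { apply Rmult_le_compat_l; auto; apply Rdiv_le_0_compat; nra. }
  replace (2 * PI ^ 2 / t * (20 * t ^ 2)) with (2 * PI ^ 2 * 20 * t) in B2 by (field; lra).
  assert (B3 : (t / (2 * PI)) ^ 2 <= t).
  { unfold Rdiv; rewrite Rpow_mult_distr.
    assert (/ (2 * PI) <= 1) by (rewrite <- Rinv_1; apply Rinv_le_contravar; pose proof PI2_1; lra).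
    assert (0 < / (2 * PI)) by (apply Rinv_0_lt_compat; lra).
    assert (t ^ 2 <= t) by nra.
    assert ((/ (2 * PI)) ^ 2 <= 1) by nra.
    pose proof (pow2_ge_0 t); pose proof (pow2_ge_0 (/ (2 * PI))); nra. }
  assert ((t / (2 * PI)) ^ 2 * zeta 2 <= t * zeta 2) by (apply Rmult_le_compat_r; auto).
  nra.
Qed.

(** * Eisenstein series *)

(** The coefficients after replacing q by q^m. The type is a parameter so that moduli, real parts
    and imaginary parts share one argument. *)
Definition sparse {T : Type} (zero : T) (m : nat) (f : nat -> T) (n : nat) : T :=
  if Nat.eqb (n mod m) 0 then f (n / m)%nat else zero.

Lemma sparse_sum (f : nat -> R) (m M : nat) : (0 < m)%nat ->
  sum_n (sparse 0 m f) M = sum_n f (M / m)%nat.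
Proof.
intros Hm; induction M.
- rewrite sum_O; unfold sparse; rewrite Nat.Div0.mod_0_l, Nat.Div0.div_0_l, sum_O; reflexivity.
- rewrite sum_Sn, IHM; unfold sparse; unfold plus; simpl.
  pose proof (Nat.div_mod_eq M m) as E; pose proof (Nat.mod_upper_bound M m ltac:(lia)) as B.
  set (d := (M / m)%nat) in *; set (r := (M mod m)%nat) in *.
  destruct (Nat.eq_dec (S r) m) as [Q | Q].
  + assert (D1 : (S M / m)%nat = S d) by (symmetry; apply (Nat.div_unique _ _ _ 0); lia).
    assert (D2 : (S M mod m)%nat = 0%nat) by (symmetry; apply (Nat.mod_unique _ _ (S d)); lia).
    rewrite D1, D2; simpl; rewrite sum_Sn; reflexivity.
  + assert (D1 : (S M / m)%nat = d) by (symmetry; apply (Nat.div_unique _ _ _ (S r)); lia).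
    assert (D2 : (S M mod m)%nat = S r) by (symmetry; apply (Nat.mod_unique _ _ d); lia).
    rewrite D1, D2; simpl; ring.
Qed.

Lemma sparse_series (f : nat -> R) (m : nat) : (0 < m)%nat -> ex_series f ->
  is_series (sparse 0 m f) (Series f).
Proof.
intros Hm Hf.
assert (E : is_lim_seq (sum_n (sparse 0 m f)) (Series f)); [ | exact E].
apply is_lim_seq_ext with (fun M => sum_n f (M / m)%nat).
{ intros; symmetry; apply sparse_sum; auto. }
apply (is_lim_seq_subseq (sum_n f) (Series f) (fun M => (M / m)%nat)).
- intros P [N HN]; exists (N * m)%nat; intros n Hn; apply HN.
  apply Nat.div_le_lower_bound; lia.
- exact (Series_correct f Hf).
Qed.

Lemma sparse_C (f : nat -> C) (m : nat) : (0 < m)%nat -> acv f ->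
  acv (sparse (RtoC 0) m f) /\ csum (sparse (RtoC 0) m f) = csum f /\
  Series (fun n => Cmod (sparse (RtoC 0) m f n)) = Series (fun n => Cmod (f n)).
Proof.
intros Hm Hf.
assert (E : forall (g : C -> R) n, g 0%C = 0 -> g (sparse (RtoC 0) m f n) = sparse 0 m (fun n => g (f n)) n).
{ intros g n Hg; unfold sparse; destruct (Nat.eqb (n mod m) 0); auto. }
pose proof (sparse_series _ m Hm Hf) as S1.
pose proof (sparse_series _ m Hm (acv_ex_Re f Hf)) as S2.
pose proof (sparse_series _ m Hm (acv_ex_Im f Hf)) as S3.
split; [ | split].
- eexists; eapply is_series_ext; [ | exact S1]; intros n; symmetry; apply (E Cmod), Cmod_0.
- apply C_eq; simpl; apply is_series_unique.
  + eapply is_series_ext; [ | exact S2]; intros n; symmetry; apply (E Re); reflexivity.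
  + eapply is_series_ext; [ | exact S3]; intros n; symmetry; apply (E Im); reflexivity.
- apply is_series_unique; eapply is_series_ext; [ | exact S1]; intros n; symmetry; apply (E Cmod), Cmod_0.
Qed.

(** For positive [N], the sum of [a] over the divisors of [N], listed by the complementary divisor
    [S c]. *)
Definition divsum (a : nat -> C) (N : nat) : C :=
  csumn (fun c => if Nat.eqb (N mod S c) 0 then a (N / S c)%nat else RtoC 0) N.

(** Fubini over pairs (c, n), collected by the product N = (c+1) n. Absolute convergence follows
    from (c+1) n >= c + n for n >= 1, which leaves a geometric factor |q|^c; the term n = 0 has to
    vanish, as it would recur for every [c]. *)
Lemma lambert (a : nat -> C) (q : C) : conv_on a 1 -> a 0%nat = 0%C -> Cmod q < 1 ->
  acv (fun c => ps a (q ^ S c)) /\ acv (fun N => divsum a N * q ^ N)%C /\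
  csum (fun c => ps a (q ^ S c)) = ps (divsum a) q.
Proof.
intros Ha H0 Hq.
pose proof (Cmod_ge_0 q) as Q0.
assert (Hqc : forall c, Cmod (q ^ S c) < 1).
{ intros c; rewrite Cmod_pow; apply Rle_lt_trans with (Cmod q * 1); [ | lra].
  change (Cmod q ^ S c) with (Cmod q * Cmod q ^ c); apply Rmult_le_compat_l; auto.
  rewrite <- (pow1 c); apply pow_incr; lra. }
assert (Aq : forall c, acv (fun n => a n * (q ^ S c) ^ n)%C) by (intros; apply conv_on_acv with 1; auto).
set (u := fun c N => sparse (RtoC 0) (S c) (fun n => a n * (q ^ S c) ^ n)%C N).
assert (Hu : forall c, acv (u c)) by (intros c; apply (sparse_C _ (S c)); auto; lia).
assert (Hs : ex_series (fun c => Series (fun N => Cmod (u c N)))).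
{ assert (A1 : acv (fun n => a n * q ^ n)%C) by (apply conv_on_acv with 1; auto).
  apply ex_series_le_pos with (fun c => Series (fun n => Cmod (a n * q ^ n)%C) * Cmod q ^ c).
  - intros c; split; [apply Series_pos; [intros; apply Cmod_ge_0 | apply Hu] | ].
    destruct (sparse_C (fun n => a n * (q ^ S c) ^ n)%C (S c) ltac:(lia) (Aq c)) as (_ & _ & E).
    unfold u; rewrite E, Rmult_comm, <- Series_scal_l.
    apply Series_mono; [ | apply Aq | apply (ex_series_scal_l _ _ A1)].
    intros n; destruct n.
    + rewrite H0, !Cmult_0_l, Cmod_0; lra.
    + rewrite !Cmod_mult, !Cmod_pow, <- pow_mult.
      pose proof (Cmod_ge_0 (a (S n))).
      replace (Cmod q ^ c * (Cmod (a (S n)) * Cmod q ^ S n)) with (Cmod (a (S n)) * Cmod q ^ (c + S n))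
        by (rewrite pow_add; ring).
      apply Rmult_le_compat_l; auto.
      replace (S c * S n)%nat with ((c + S n) + c * n)%nat by lia.
      rewrite pow_add; rewrite <- (Rmult_1_r (Cmod q ^ (c + S n))) at 2.
      apply Rmult_le_compat_l; [apply pow_le; auto | ].
      rewrite <- (pow1 (c * n)); apply pow_incr; lra.
  - apply (ex_series_scal_l (Series (fun n => Cmod (a n * q ^ n)%C)) (fun c => Cmod q ^ c)).
    apply ex_series_geom; rewrite Rabs_pos_eq; auto. }
destruct (csum_Fubini u Hu Hs) as (_ & F2 & F3 & _ & F5).
assert (E1 : forall c, csum (u c) = ps a (q ^ S c)).
{ intros c; apply (sparse_C _ (S c)); auto; lia. }
assert (E2 : forall N, csum (fun c => u c N) = (divsum a N * q ^ N)%C).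
{ intros N; rewrite (csum_finite _ N).
  - unfold divsum; rewrite Cmult_comm, <- csumn_scal; apply csumn_ext; intros c Hc; unfold u, sparse.
    destruct (Nat.eqb_spec (N mod S c) 0) as [Q | Q]; [ | ring].
    rewrite <- Cpow_mult_r.
    replace (S c * (N / S c))%nat with N; [ring | ].
    pose proof (Nat.div_mod_eq N (S c)); lia.
  - intros c Hc; unfold u, sparse.
    destruct (Nat.eqb_spec (N mod S c) 0) as [Q | Q]; auto.
    rewrite Nat.mod_small in Q by lia; subst N.
    rewrite Nat.Div0.div_0_l, H0; ring. }
split; [ | split].
- revert F2; apply acv_ext, E1.
- revert F3; apply acv_ext, E2.
- rewrite <- (csum_ext _ _ E1), F5; apply csum_ext, E2.
Qed.

Lemma conv_on_divsum (a : nat -> C) : conv_on a 1 -> a 0%nat = 0%C -> conv_on (divsum a) 1.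
Proof.
intros Ha H0 r Hr.
assert (M : Cmod (RtoC r) = r) by (rewrite Cmod_R, Rabs_pos_eq; lra).
destruct (lambert a (RtoC r) Ha H0 ltac:(lra)) as (_ & A & _).
revert A; apply ex_series_ext; intros n; rewrite Cmod_mult, Cmod_pow, M; auto.
Qed.

Definition mulz (c : nat) (z : C) : C := (RtoC (INR (S c)) * z)%C.

Lemma mulz_H (c : nat) (z : C) : upper_half_plane z -> upper_half_plane (mulz c z).
Proof.
unfold upper_half_plane, mulz; intros H.
assert (0 < INR (S c)) by (apply lt_0_INR; lia).
destruct z as [x y]; unfold Im in *; simpl in *; set (t := match c with O => 1 | S _ => INR c + 1 end) in *.
nra.
Qed.

Lemma nome_mulz (c : nat) (z : C) : nome (mulz c z) = (nome z ^ S c)%C.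
Proof.
rewrite !nome_Cexp, <- Cexp_pow; f_equal; unfold mulz; ring.
Qed.

(* The sum of (c z + d)^(-k) over all (c, d) <> (0, 0), rows c first, for even k. *)
Definition Eis (k : nat) (z : C) : C :=
  (2 * RtoC (zeta k) + 2 * csum (fun c => epsum k (mulz c z)))%C.

Definition lipschitz_const (k : nat) : C := ((- I2pi) ^ k / RtoC (INR (fact (k - 1))))%C.

Definition sigma_coef (j : nat) : nat -> C := divsum (powcoef j).

Lemma RtoC_neq_0 (x : R) : x <> 0 -> RtoC x <> 0%C.
Proof. intros H E; apply H; injection E; auto. Qed.

Lemma epsum_lser (k : nat) (z : C) : (2 <= k)%nat -> upper_half_plane z ->
  epsum k z = (lipschitz_const k * lser (k - 1) z)%C.
Proof.
intros Hk Hz; destruct k as [|[|j]]; try lia.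
pose proof (Lipschitz j z Hz) as L; unfold lipschitz_const.
replace (S (S j) - 1)%nat with (S j) by lia.
assert (F0 : RtoC (INR (fact (S j))) <> 0%C) by (apply RtoC_neq_0, INR_fact_neq_0).
replace (epsum (S (S j)) z) with ((RtoC (INR (fact (S j))) * epsum (S (S j)) z) / RtoC (INR (fact (S j))))%C by (field; auto).
rewrite L; field; auto.
Qed.

Lemma epsum_mulz (k : nat) (z : C) : (2 <= k)%nat -> upper_half_plane z ->
  acv (fun c => epsum k (mulz c z)) /\
  csum (fun c => epsum k (mulz c z)) = (lipschitz_const k * ps (sigma_coef (k - 1)) (nome z))%C.
Proof.
intros Hk Hz.
assert (E : forall c, epsum k (mulz c z) = (lipschitz_const k * ps (powcoef (k - 1)) (nome z ^ S c))%C).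
{ intros c; rewrite epsum_lser by (auto using mulz_H); unfold lser; rewrite nome_mulz; auto. }
destruct (lambert (powcoef (k - 1)) (nome z) (conv_on_powcoef _) eq_refl (Cmod_nome_lt_1 z Hz)) as (L1 & _ & L3).
split.
- eapply acv_ext; [intros c; symmetry; apply E | apply acv_scal; auto].
- rewrite (csum_ext _ _ E), csum_scal by auto; rewrite L3; auto.
Qed.

Lemma Eis_q (k : nat) (z : C) : (2 <= k)%nat -> upper_half_plane z ->
  Eis k z = (2 * RtoC (zeta k) + 2 * lipschitz_const k * ps (sigma_coef (k - 1)) (nome z))%C.
Proof.
intros Hk Hz; unfold Eis; rewrite (proj2 (epsum_mulz k z Hk Hz)); ring.
Qed.

Lemma zeta_ge_1 (k : nat) : (2 <= k)%nat -> 1 <= zeta k <= 2.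
Proof.
intros Hk; split.
- unfold zeta; eapply Rle_trans; [ | apply (Series_pos_term _ 0)].
  + simpl; replace (0 + 1) with 1 by ring; rewrite pow1; lra.
  + intros n; pose proof (pos_INR n); apply Rlt_le, Rinv_0_lt_compat, pow_lt; lra.
  + apply ex_series_zeta; auto.
- apply Rle_trans with (zeta 2).
  + apply Series_mono; [ | apply ex_series_zeta; auto | apply ex_series_zeta; auto].
    intros n; pose proof (pos_INR n); apply Rinv_le_contravar; [apply pow_lt; lra | apply Rle_pow; auto; lra].
  + apply series_inv_sqr.
Qed.

(* The four lattice points (+-c, +-d), for indices c and d shifted by one. *)
Definition four_points (k : nat) (z : C) (c d : nat) : C :=
  (2 * (/ (RtoC (INR (S c)) * z + RtoC (INR (S d))) ^ k
      + / (RtoC (INR (S c)) * z + RtoC (- INR (S d))) ^ k))%C.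

Lemma lattice_neq_0 (z : C) (c d : R) : upper_half_plane z -> 0 < c -> (RtoC c * z + RtoC d)%C <> 0%C.
Proof.
intros Hz Hc; apply Cmod_neq_0; eapply Rlt_le_trans; [ | apply lattice_lower; auto].
apply Rmult_lt_0_compat; [apply lattice_const_pos; auto | ].
rewrite (Rabs_pos_eq c) by lra; pose proof (Rabs_pos d); lra.
Qed.

Lemma z_neq_0 (z : C) : upper_half_plane z -> z <> 0%C.
Proof.
intros Hz E; unfold upper_half_plane in Hz; rewrite E in Hz; simpl in Hz; lra.
Qed.

Lemma four_points_row (k : nat) (z : C) (c : nat) : (2 <= k)%nat -> upper_half_plane z ->
  acv (four_points k z c) /\ csum (four_points k z c) = (2 * epsum k (mulz c z) - 2 * / mulz c z ^ k)%C.
Proof.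
intros Hk Hz; pose proof (mulz_H c z Hz) as Hm.
assert (A : acv (sym (epsk k (mulz c z)))) by (apply acv_sym_epsk; auto; lia).
assert (A' := A); apply acv_incr in A'.
assert (E : forall d, (2 * sym (epsk k (mulz c z)) (S d))%C = four_points k z c d).
{ intros d; unfold sym, epsk, four_points, mulz; rewrite opp_IZR, <- INR_IZR_INZ; auto. }
split.
- eapply acv_ext; [exact E | apply acv_scal; auto].
- rewrite <- (csum_ext _ _ E), csum_scal by auto.
  unfold epsum, zsum; rewrite (csum_incr _ A).
  unfold sym at 2, epsk at 2; replace (mulz c z + RtoC (IZR 0))%C with (mulz c z) by ring; ring.
Qed.

Lemma inv_mulz_pow (k : nat) (z : C) (c : nat) : upper_half_plane z ->
  (/ mulz c z ^ k)%C = (/ z ^ k * RtoC (/ (INR c + 1) ^ k))%C.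
Proof.
intros Hz; unfold mulz; rewrite Cpow_mult_l, S_INR.
assert (P : INR c + 1 <> 0) by (pose proof (pos_INR c); lra).
rewrite RtoC_inv, RtoC_pow by (apply pow_nonzero; auto).
pose proof (z_neq_0 z Hz); pose proof (RtoC_neq_0 _ P).
field; split; apply Cpow_nz; auto.
Qed.

(** Separates the two axes of the lattice from the rest. Under z -> -1/z the axes are exchanged and
    the remaining double series is transposed. *)
Lemma Eis_expand (k : nat) (z : C) : (2 <= k)%nat -> upper_half_plane z ->
  acv (fun c => csum (four_points k z c)) /\
  Eis k z = (2 * RtoC (zeta k) + 2 * RtoC (zeta k) * / z ^ k + csum (fun c => csum (four_points k z c)))%C.
Proof.
intros Hk Hz.
destruct (epsum_mulz k z Hk Hz) as [A1 _].
assert (A2 : acv (fun c => RtoC (/ (INR c + 1) ^ k))).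
{ generalize (ex_series_zeta k Hk); apply ex_series_ext; intros n; rewrite Cmod_R, Rabs_pos_eq; auto.
  pose proof (pos_INR n); apply Rlt_le, Rinv_0_lt_compat, pow_lt; lra. }
assert (S2 : csum (fun c => RtoC (/ (INR c + 1) ^ k)) = RtoC (zeta k)).
{ rewrite nnC_csum.
  - f_equal; apply Series_ext; intros n; rewrite Cmod_R, Rabs_pos_eq; auto.
    pose proof (pos_INR n); apply Rlt_le, Rinv_0_lt_compat, pow_lt; lra.
  - intros n; apply nnC_R; pose proof (pos_INR n); apply Rlt_le, Rinv_0_lt_compat, pow_lt; lra. }
assert (E : forall c, csum (four_points k z c) = (2 * epsum k (mulz c z) - (2 * / z ^ k) * RtoC (/ (INR c + 1) ^ k))%C).
{ intros c; rewrite (proj2 (four_points_row k z c Hk Hz)), inv_mulz_pow by auto; ring. }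
split.
- eapply acv_ext; [intros c; symmetry; apply E | apply acv_minus; apply acv_scal; auto].
- rewrite (csum_ext _ _ E), csum_minus, !csum_scal, S2 by (auto using acv_scal).
  unfold Eis; ring.
Qed.

Definition Sz (z : C) : C := (- / z)%C.

Lemma Im_Sz (z : C) : upper_half_plane z -> Im (Sz z) = Im z / Cmod z ^ 2.
Proof.
intros Hz; rewrite Cmod2_alt; unfold Sz; destruct z as [x y]; unfold upper_half_plane in Hz.
unfold Im, Re in *; simpl in *; field; nra.
Qed.

Lemma Sz_H (z : C) : upper_half_plane z -> upper_half_plane (Sz z).
Proof.
intros Hz; unfold upper_half_plane; rewrite Im_Sz by auto.
apply Rdiv_lt_0_compat; [exact Hz | apply pow_lt, Cmod_pos, z_neq_0; auto].
Qed.

Lemma Cpow_opp_even (x : C) (k : nat) : Nat.Even k -> ((- x) ^ k)%C = (x ^ k)%C.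
Proof.
intros [m ->]; rewrite !Cpow_mult_r; f_equal; simpl; ring.
Qed.

Lemma four_points_Sz (k : nat) (z : C) (c d : nat) : Nat.Even k -> upper_half_plane z ->
  four_points k (Sz z) c d = (z ^ k * four_points k z d c)%C.
Proof.
intros He Hz; pose proof (z_neq_0 z Hz) as Z0.
assert (Pd : 0 < INR (S d)) by (apply lt_0_INR; lia).
assert (Pc : 0 < INR (S c)) by (apply lt_0_INR; lia).
pose proof (lattice_neq_0 z (INR (S d)) (INR (S c)) Hz Pd) as N1.
pose proof (lattice_neq_0 z (INR (S d)) (- INR (S c)) Hz Pd) as N2.
unfold four_points.
replace (RtoC (INR (S c)) * Sz z + RtoC (INR (S d)))%C
  with ((RtoC (INR (S d)) * z + RtoC (- INR (S c))) / z)%C by (unfold Sz; rewrite RtoC_opp; field; auto).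
replace (RtoC (INR (S c)) * Sz z + RtoC (- INR (S d)))%C
  with (- ((RtoC (INR (S d)) * z + RtoC (INR (S c))) / z))%C by (unfold Sz; rewrite RtoC_opp; field; auto).
rewrite Cpow_opp_even by auto.
unfold Cdiv; rewrite !Cpow_mult_l, Cpow_inv by auto.
field; repeat split; try (apply Cpow_nz; auto); auto.
Qed.

(** Compared with the expansion at [z], only the order of summation differs. Weight 2 is included,
    because there the discrepancy between the two orders is what has to be computed. *)
Lemma Eis_Sz_expand (k : nat) (z : C) : (2 <= k)%nat -> Nat.Even k -> upper_half_plane z ->
  acv (fun d => csum (fun c => four_points k z c d)) /\
  Eis k (Sz z) = (z ^ k * (2 * RtoC (zeta k) + 2 * RtoC (zeta k) * / z ^ k
      + csum (fun d => csum (fun c => four_points k z c d))))%C.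
Proof.
intros Hk He Hz; pose proof (Sz_H z Hz) as Hw; pose proof (z_neq_0 z Hz) as Z0.
assert (Zk : (z ^ k)%C <> 0%C) by (apply Cpow_nz; auto).
destruct (Eis_expand k (Sz z) Hk Hw) as [A B].
assert (Ec : forall d, acv (fun c => four_points k z c d)).
{ intros d; generalize (acv_scal (/ z ^ k)%C _ (proj1 (four_points_row k (Sz z) d Hk Hw))); apply acv_ext.
  intros c; rewrite four_points_Sz by auto; field; auto. }
assert (E : forall d, csum (four_points k (Sz z) d) = (z ^ k * csum (fun c => four_points k z c d))%C).
{ intros d; rewrite <- csum_scal by auto; apply csum_ext; intros c; apply four_points_Sz; auto. }
assert (A' : acv (fun d => csum (fun c => four_points k z c d))).
{ generalize (acv_scal (/ z ^ k)%C _ A); apply acv_ext; intros d; rewrite E; field; auto. }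
split; auto.
rewrite B, (csum_ext _ _ E), csum_scal by auto.
assert (Es : ((Sz z) ^ k)%C = (/ z ^ k)%C).
{ unfold Sz; rewrite Cpow_opp_even, Cpow_inv; auto. }
rewrite Es; field; auto.
Qed.

Lemma Fubini_lattice (u : nat -> nat -> C) (K : R) : 
  (forall c d, Cmod (u c d) <= K * (/ (INR c + 1) ^ 2 * / (INR d + 1) ^ 2)) ->
  (forall c, acv (u c)) /\ (forall d, acv (fun c => u c d)) /\
  acv (fun c => csum (u c)) /\ acv (fun d => csum (fun c => u c d)) /\
  csum (fun c => csum (u c)) = csum (fun d => csum (fun c => u c d)).
Proof.
intros H.
assert (es : ex_series (fun d => / (INR d + 1) ^ 2)) by apply ex_series_inv_sqr.
assert (Hu : forall c, acv (u c)).
{ intros c; apply acv_le with (fun d => K * / (INR c + 1) ^ 2 * / (INR d + 1) ^ 2).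
  - intros d; eapply Rle_trans; [apply H | apply Req_le; ring].
  - apply (ex_series_scal_l (K * / (INR c + 1) ^ 2) _ es). }
assert (Hs : ex_series (fun c => Series (fun d => Cmod (u c d)))).
{ apply ex_series_le_pos with (fun c => K * Series (fun d => / (INR d + 1) ^ 2) * / (INR c + 1) ^ 2).
  - intros c; split; [apply Series_pos; [intros; apply Cmod_ge_0 | apply Hu] | ].
    replace (K * Series (fun d => / (INR d + 1) ^ 2) * / (INR c + 1) ^ 2)
      with ((K * / (INR c + 1) ^ 2) * Series (fun d => / (INR d + 1) ^ 2)) by ring.
    rewrite <- Series_scal_l; apply Series_mono; [ | apply Hu | apply (ex_series_scal_l (K * / (INR c + 1) ^ 2) _ es)].
    intros d; eapply Rle_trans; [apply H | apply Req_le; ring].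
  - apply (ex_series_scal_l (K * Series (fun d => / (INR d + 1) ^ 2)) _ es). }
destruct (csum_Fubini u Hu Hs) as (F1 & F2 & F3 & _ & F5); auto.
Qed.

(** (x + |t|)^2 >= x |t| splits a fourth power into a product of squares, each summable by itself.
    Allowing |t| down to half of [S d] makes room for points displaced by 1/2. *)
Lemma lattice_pow4 (z : C) (k c d : nat) (t : R) : (4 <= k)%nat -> upper_half_plane z ->
  INR (S d) / 2 <= Rabs t ->
  / (lattice_const z * (Rabs (INR (S c)) + Rabs t)) ^ k <= 4 * / lattice_const z ^ k * (/ (INR c + 1) ^ 2 * / (INR d + 1) ^ 2).
Proof.
intros Hk Hz Ht; pose proof (lattice_const_pos z Hz) as Kp.
rewrite S_INR in *.
pose proof (pos_INR c); pose proof (pos_INR d).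
set (x := INR c + 1) in *; set (y := INR d + 1) in *.
rewrite (Rabs_pos_eq x) by (unfold x; lra).
assert (Hx : 1 <= x) by (unfold x; lra); assert (Hy : 1 <= y) by (unfold y; lra).
rewrite Rpow_mult_distr, Rinv_mult.
assert (I0 : 0 < / lattice_const z ^ k) by (apply Rinv_0_lt_compat, pow_lt; lra).
replace (4 * / lattice_const z ^ k * (/ x ^ 2 * / y ^ 2)) with (/ lattice_const z ^ k * (4 * (/ x ^ 2 * / y ^ 2))) by ring.
apply Rmult_le_compat_l; [lra | ].
assert (Q1 : 1 <= x + Rabs t) by (pose proof (Rabs_pos t); lra).
apply Rle_trans with (/ (x + Rabs t) ^ 4).
{ apply Rinv_le_contravar; [apply pow_lt; lra | apply Rle_pow; auto]. }
replace (4 * (/ x ^ 2 * / y ^ 2)) with (/ (x * (y / 2)) ^ 2) by (field; lra).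
apply Rinv_le_contravar; [apply pow_lt; nra | ].
replace ((x + Rabs t) ^ 4) with (((x + Rabs t) ^ 2) ^ 2) by ring.
apply pow_incr; split; [nra | ].
assert (x * (y / 2) <= x * Rabs t) by (apply Rmult_le_compat_l; lra).
pose proof (Rabs_pos t); nra.
Qed.

Lemma Eis_Sz (k : nat) (z : C) : (4 <= k)%nat -> Nat.Even k -> upper_half_plane z ->
  Eis k (Sz z) = (z ^ k * Eis k z)%C.
Proof.
intros Hk He Hz.
rewrite (proj2 (Eis_Sz_expand k z ltac:(lia) He Hz)), (proj2 (Eis_expand k z ltac:(lia) Hz)).
f_equal; f_equal; symmetry.
apply (Fubini_lattice _ (4 * (4 * / lattice_const z ^ k))).
intros c d; pose proof (lattice_const_pos z Hz) as Kp.
assert (B : forall t, Rabs t = INR (S d) -> Cmod (/ (RtoC (INR (S c)) * z + RtoC t) ^ k)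
   <= 4 * / lattice_const z ^ k * (/ (INR c + 1) ^ 2 * / (INR d + 1) ^ 2)).
{ intros t Ht; pose proof (pos_INR c); pose proof (pos_INR d).
  eapply Rle_trans; [apply (Cmod_inv_pow_le _ (lattice_const z * (Rabs (INR (S c)) + Rabs t))) | ].
  - apply Rmult_lt_0_compat; [lra | ]; rewrite Ht, !S_INR; pose proof (Rabs_pos (INR c + 1)); lra.
  - apply lattice_lower; auto.
  - apply lattice_pow4; auto; rewrite Ht; rewrite S_INR; lra. }
assert (Pd : 0 <= INR (S d)) by apply pos_INR.
pose proof (B (INR (S d)) (Rabs_pos_eq _ Pd)) as B1.
pose proof (B (- INR (S d)) ltac:(rewrite Rabs_Ropp; apply Rabs_pos_eq; auto)) as B2.
unfold four_points; rewrite Cmod_mult, Cmod_R, Rabs_pos_eq by lra.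
pose proof (Cmod_triangle (/ (RtoC (INR (S c)) * z + RtoC (INR (S d))) ^ k)
  (/ (RtoC (INR (S c)) * z + RtoC (- INR (S d))) ^ k)); lra.
Qed.

(** * The discriminant *)

Lemma small_inv (K eps : R) (N0 : nat) : 0 < eps ->
  exists D, (N0 <= D)%nat /\ K / (INR D + / 2) <= eps.
Proof.
intros He.
destruct (nfloor_ex (Rabs K / eps)) as [N [_ HN]].
{ apply Rdiv_le_0_compat; auto; apply Rabs_pos. }
exists (S N + N0)%nat; split; [lia | ].
rewrite plus_INR, S_INR; pose proof (pos_INR N0); pose proof (pos_INR N).
apply (Rmult_lt_compat_l eps) in HN; auto.
replace (eps * (Rabs K / eps)) with (Rabs K) in HN by (field; lra).
pose proof (Rle_abs K).
apply Rmult_le_reg_r with (INR N + 1 + INR N0 + / 2); [lra | ].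
unfold Rdiv; rewrite Rmult_assoc, Rinv_l by lra; nra.
Qed.

(** * The transformation of the Eisenstein series of weight 2 *)

Section Quasi.
Variable z : C.
Hypothesis Hz : upper_half_plane z.

Let cz (c : nat) : C := (RtoC (INR (S c)) * z)%C.

(** 1/(w - 1/2) - 1/(w + 1/2) telescopes in d and, thanks to the symmetric offsets, differs from
    1/w^2 only by a term of order w^(-4). It is taken at the four points of [four_points], up to a
    common sign. *)
Let tau (c d : nat) : C :=
  (2 * ((/ (cz c + RtoC (INR (S d) - / 2)) - / (cz c + RtoC (INR (S d) + / 2)))
      + (/ (cz c + RtoC (- INR (S d) - / 2)) - / (cz c + RtoC (- INR (S d) + / 2)))))%C.

(** The boundary terms of the telescoping sum: [pc] at the near end, independent of the cut-off [D],
    and [rc] at the far end. *)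
Let pc (c : nat) : C := (/ (cz c + RtoC (/ 2)) - / (cz c + RtoC (- / 2)))%C.
Let rc (c D : nat) : C := (/ (cz c + RtoC (- (INR D + / 2))) - / (cz c + RtoC (INR D + / 2)))%C.

Let cz_lower (c : nat) (t : R) : lattice_const z * (INR (S c) + Rabs t) <= Cmod (cz c + RtoC t).
Proof.
unfold cz; rewrite <- (Rabs_pos_eq (INR (S c))) at 1 by apply pos_INR.
apply lattice_lower; auto.
Qed.

Let cz_nz (c : nat) (t : R) : (cz c + RtoC t)%C <> 0%C.
Proof. apply lattice_neq_0; auto; apply lt_0_INR; lia. Qed.

Let tau_partial (c D : nat) : csumn (tau c) D = (2 * (pc c + rc c D))%C.
Proof.
induction D.
- simpl csumn; unfold pc, rc; simpl INR; rewrite Rplus_0_l; ring.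
- simpl csumn; rewrite IHD; unfold tau, rc.
  replace (INR (S D) - / 2) with (INR D + / 2) by (rewrite S_INR; field).
  replace (- INR (S D) + / 2) with (- (INR D + / 2)) by (rewrite S_INR; field).
  replace (- INR (S D) - / 2) with (- (INR (S D) + / 2)) by ring.
  ring.
Qed.

Let half_term (c d : nat) (t : R) : Rabs t = INR (S d) ->
  Cmod (/ (cz c + RtoC t) ^ 2 - (/ (cz c + RtoC (t - / 2)) - / (cz c + RtoC (t + / 2))))
  <= / lattice_const z ^ 4 * (/ (INR c + 1) ^ 2 * / (INR d + 1) ^ 2).
Proof.
intros Ht; pose proof (lattice_const_pos z Hz) as Kp.
pose proof (cz_nz c t) as N0; pose proof (cz_nz c (t - / 2)) as N1; pose proof (cz_nz c (t + / 2)) as N2.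
pose proof (pos_INR c) as Pc; pose proof (pos_INR d) as Pd.
set (m := lattice_const z * (Rabs (INR (S c)) + Rabs (INR (S d) / 2))).
assert (Hm : 0 < m).
{ apply Rmult_lt_0_compat; [lra | ]; rewrite S_INR; pose proof (Rabs_pos (INR (S d) / 2)).
  rewrite Rabs_pos_eq by lra; lra. }
assert (L : forall s, INR (S d) / 2 <= Rabs s -> Cmod (/ (cz c + RtoC s)) <= / m).
{ intros s Hs; pose proof (cz_lower c s) as B.
  rewrite Cmod_inv by apply cz_nz; apply Rinv_le_contravar; auto.
  eapply Rle_trans; [ | exact B]; unfold m; apply Rmult_le_compat_l; [lra | ].
  rewrite (Rabs_pos_eq (INR (S c))) by apply pos_INR.
  rewrite (Rabs_pos_eq (INR (S d) / 2)) by (rewrite S_INR; lra); lra. }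
rewrite S_INR in *.
assert (L0 : Cmod (/ (cz c + RtoC t)) <= / m) by (apply L; lra).
assert (L1 : Cmod (/ (cz c + RtoC (t - / 2))) <= / m).
{ apply L; unfold Rabs in *; destruct (Rcase_abs t), (Rcase_abs (t - / 2)); lra. }
assert (L2 : Cmod (/ (cz c + RtoC (t + / 2))) <= / m).
{ apply L; unfold Rabs in *; destruct (Rcase_abs t), (Rcase_abs (t + / 2)); lra. }
replace (/ (cz c + RtoC t) ^ 2 - (/ (cz c + RtoC (t - / 2)) - / (cz c + RtoC (t + / 2))))%C
  with (- RtoC (/ 4) * ((/ (cz c + RtoC t) * / (cz c + RtoC t)) * (/ (cz c + RtoC (t - / 2)) * / (cz c + RtoC (t + / 2)))))%C.
2:{ set (h := RtoC (/ 2)); set (x := (cz c + RtoC t)%C) in *.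
    assert (H2 : (h + h)%C = 1%C) by (unfold h; rewrite <- RtoC_plus; f_equal; field).
    assert (H4 : RtoC (/ 4) = (h * h)%C) by (unfold h; rewrite <- RtoC_mult; f_equal; field).
    replace (cz c + RtoC (t - / 2))%C with (x - h)%C in * by (unfold x, h; rewrite RtoC_minus; ring).
    replace (cz c + RtoC (t + / 2))%C with (x + h)%C in * by (unfold x, h; rewrite RtoC_plus; ring).
    transitivity ((x * x * (1 - (h + h)) - h * h) / (x * x * (x - h) * (x + h)))%C.
    - rewrite H2, H4; field; auto.
    - field; auto. }
rewrite Cmod_mult, Cmod_opp, Cmod_R, Rabs_pos_eq by lra.
rewrite !Cmod_mult.
assert (Im0 : 0 < / m) by (apply Rinv_0_lt_compat; auto).
assert (P1 : Cmod (/ (cz c + RtoC t)) * Cmod (/ (cz c + RtoC t)) <= / m * / m).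
{ apply Rmult_le_compat; auto using Cmod_ge_0. }
assert (P2 : Cmod (/ (cz c + RtoC (t - / 2))) * Cmod (/ (cz c + RtoC (t + / 2))) <= / m * / m).
{ apply Rmult_le_compat; auto using Cmod_ge_0. }
apply Rle_trans with (/ 4 * ((/ m * / m) * (/ m * / m))).
- apply Rmult_le_compat_l; [lra | ].
  apply Rmult_le_compat; auto; apply Rmult_le_pos; apply Cmod_ge_0.
- replace ((/ m * / m) * (/ m * / m)) with (/ m ^ 4) by (field; lra).
  pose proof (lattice_pow4 z 4 c d ((INR d + 1) / 2) (le_n 4) Hz) as B.
  rewrite !S_INR in B; specialize (B ltac:(rewrite Rabs_pos_eq; lra)).
  unfold m; rewrite !S_INR; lra.
Qed.

Let ee (c d : nat) : C := (four_points 2 z c d - tau c d)%C.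

Let ee_bound (c d : nat) : Cmod (ee c d) <= (4 * / lattice_const z ^ 4) * (/ (INR c + 1) ^ 2 * / (INR d + 1) ^ 2).
Proof.
pose proof (half_term c d (INR (S d)) (Rabs_pos_eq _ (pos_INR _))) as B1.
assert (R2 : Rabs (- INR (S d)) = INR (S d)) by (rewrite Rabs_Ropp; apply Rabs_pos_eq, pos_INR).
pose proof (half_term c d (- INR (S d)) R2) as B2.
replace (ee c d) with (2 * ((/ (cz c + RtoC (INR (S d))) ^ 2
    - (/ (cz c + RtoC (INR (S d) - / 2)) - / (cz c + RtoC (INR (S d) + / 2))))
  + (/ (cz c + RtoC (- INR (S d))) ^ 2
    - (/ (cz c + RtoC (- INR (S d) - / 2)) - / (cz c + RtoC (- INR (S d) + / 2))))))%C.
2:{ unfold ee, tau, four_points; fold (cz c); ring. }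
rewrite Cmod_mult, Cmod_R, Rabs_pos_eq by lra.
eapply Rle_trans; [apply Rmult_le_compat_l; [lra | apply Cmod_triangle] | lra].
Qed.

(** Division by [z] turns the far boundary points into integer translates of [w D] up to sign, so
    their sum over all [c] is an [epsum 1] at a point whose height grows with [D]. *)
Let w (D : nat) : C := (RtoC (INR D + / 2) * Sz z)%C.

Let w_H (D : nat) : upper_half_plane (w D).
Proof.
pose proof (Sz_H z Hz) as H; unfold upper_half_plane, w, Im in *; pose proof (pos_INR D).
destruct (Sz z) as [x y]; simpl in *; nra.
Qed.

Let rc_sum (D : nat) : acv (fun c => rc c D) /\
  csum (fun c => rc c D) = ((epsum 1 (w D) + z / RtoC (INR D + / 2)) / z)%C.
Proof.
pose proof (z_neq_0 z Hz) as Z0.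
assert (PN : INR D + / 2 <> 0) by (pose proof (pos_INR D); lra).
assert (A : acv (sym (epsk 1 (w D)))) by (apply acv_sym_epsk; auto).
assert (A' := A); apply acv_incr in A'.
assert (E : forall c, (/ z * sym (epsk 1 (w D)) (S c))%C = rc c D).
{ intros c; unfold sym, epsk, rc; rewrite opp_IZR, <- INR_IZR_INZ.
  pose proof (cz_nz c (- (INR D + / 2))) as N1; pose proof (cz_nz c (INR D + / 2)) as N2.
  set (N := INR D + / 2) in *; set (m := INR (S c)).
  replace (w D + RtoC m)%C with ((cz c + RtoC (- N)) / z)%C.
  2:{ unfold w, Sz, cz; fold N; fold m; rewrite RtoC_opp; field; auto. }
  replace (w D + RtoC (- m))%C with (- ((cz c + RtoC N) / z))%C.
  2:{ unfold w, Sz, cz; fold N; fold m; rewrite RtoC_opp; field; auto. }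
  field; auto. }
split.
- eapply acv_ext; [exact E | apply acv_scal; auto].
- rewrite <- (csum_ext _ _ E), csum_scal by auto.
  unfold epsum, zsum; rewrite (csum_incr _ A).
  unfold sym at 2, epsk at 2.
  replace (w D + RtoC (IZR 0))%C with (- (RtoC (INR D + / 2) / z))%C by (unfold w, Sz; field; auto).
  pose proof (RtoC_neq_0 _ PN).
  field; auto.
Qed.

(** The nome of [w D] tends to 0, so only the constant - pi i of the formula for [epsum 1] survives,
    divided by [z]. *)
Let rc_limit : exists K N0, forall D, (N0 <= D)%nat ->
  Cmod (csum (fun c => rc c D) + RtoC PI * Ci / z) <= K / (INR D + / 2).
Proof.
pose proof (z_neq_0 z Hz) as Z0; pose proof (Cmod_pos z Z0) as Pz.
pose proof (Sz_H z Hz) as Hv; unfold upper_half_plane in Hv.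
set (v := Im (Sz z)) in *; pose proof PI_RGT_0 as HPI.
assert (Hpv : 0 < 2 * PI * v) by (apply Rmult_lt_0_compat; lra).
(* From this index on 2 pi Im([w D]) >= 2, hence the nome has modulus at most 1/2 and 1 - q stays
   away from 0. *)
destruct (nfloor_ex (2 / (2 * PI * v))) as [N [_ HN]]; [apply Rdiv_le_0_compat; lra | ].
exists ((2 * PI * (2 / (2 * PI * v)) + Cmod z) / Cmod z), (S N); intros D HD.
assert (HDN : INR N + 1 <= INR D) by (rewrite <- S_INR; apply le_INR; auto).
set (M := INR D + / 2).
assert (PM : 0 < M) by (unfold M; pose proof (pos_INR D); lra).
assert (HM : 2 <= 2 * PI * v * M).
{ apply (Rmult_lt_compat_l (2 * PI * v)) in HN; auto.
  replace (2 * PI * v * (2 / (2 * PI * v))) with 2 in HN by (field; lra).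
  unfold M; nra. }
rewrite (proj2 (rc_sum D)), (proj1 epsum_1_and_zeta_2 (w D) (w_H D)); fold M.
assert (RM0 : RtoC M <> 0%C) by (apply RtoC_neq_0; lra).
replace ((- (RtoC PI * Ci) - I2pi * lser 0 (w D) + z / RtoC M) / z + RtoC PI * Ci / z)%C
  with ((- (I2pi * lser 0 (w D)) + z / RtoC M) / z)%C by (field; auto).
rewrite Cmod_div by auto.
assert (Q : Cmod (nome (w D)) <= / (2 * PI * v * M)).
{ rewrite Cmod_nome.
  replace (Im (w D)) with (M * v) by (unfold w, v, M, Im; simpl; ring).
  replace (2 * PI * (M * v)) with (2 * PI * v * M) by ring.
  rewrite exp_Ropp; apply Rinv_le_contravar; [lra | ].
  pose proof (exp_ineq1_le (2 * PI * v * M)); lra. }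
assert (Q2 : / (2 * PI * v * M) <= / 2) by (apply Rinv_le_contravar; lra).
assert (Q1 : Cmod (lser 0 (w D)) <= 2 / (2 * PI * v) / M).
{ unfold lser; rewrite ps_powcoef_0 by (apply Cmod_nome_lt_1; auto).
  pose proof (one_minus_nz _ (Cmod_nome_lt_1 _ (w_H D))) as N1.
  rewrite Cmod_div by auto.
  pose proof (Cmod_triangle_inv 1 (- nome (w D))) as T; rewrite Cmod_1, Cmod_opp in T.
  change (1 + - nome (w D))%C with (1 - nome (w D))%C in T.
  apply Rmult_le_reg_r with (Cmod (1 - nome (w D))%C); [apply Cmod_pos; auto | ].
  unfold Rdiv at 1; rewrite Rmult_assoc, Rinv_l, Rmult_1_r by (apply Rgt_not_eq, Cmod_pos; auto).
  replace (2 / (2 * PI * v) / M) with (2 * / (2 * PI * v * M)) by (field; lra).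
  assert (0 < / (2 * PI * v * M)) by (apply Rinv_0_lt_compat; lra).
  nra. }
replace ((2 * PI * (2 / (2 * PI * v)) + Cmod z) / Cmod z / M)
  with ((2 * PI * (2 / (2 * PI * v) / M) + Cmod z / M) / Cmod z) by (field; repeat split; lra).
unfold Rdiv at 1; unfold Rdiv at 3; apply Rmult_le_compat_r; [apply Rlt_le, Rinv_0_lt_compat; auto | ].
eapply Rle_trans; [apply Cmod_triangle | ].
rewrite Cmod_opp, Cmod_mult, Cmod_I2pi, Cmod_div, (Cmod_R M), (Rabs_pos_eq M) by (auto; lra).
apply Rplus_le_compat; [apply Rmult_le_compat_l; lra | lra].
Qed.

(* The double series of weight 2 converges only conditionally. Subtracting the
   telescoping terms [tau] makes it absolutely convergent, and exchanging the order
   of summation of [tau] alone produces the term I2pi / z. *)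
Lemma Eis_2_Sz : Eis 2 (Sz z) = (z ^ 2 * (Eis 2 z - I2pi / z))%C.
Proof.
assert (E2 : Nat.Even 2) by (exists 1%nat; auto).
destruct (Eis_Sz_expand 2 z (le_n 2) E2 Hz) as [A1 X1].
destruct (Eis_expand 2 z (le_n 2) Hz) as [A2 X2].
destruct (Fubini_lattice ee _ ee_bound) as (F1 & F2 & F3 & F4 & F5).
pose proof (lattice_const_pos z Hz) as Kp.
assert (As : forall c, acv (four_points 2 z c)) by (intros; apply four_points_row; auto).
assert (As' : forall d, acv (fun c => four_points 2 z c d)).
{ intros d; generalize (acv_scal (/ z ^ 2)%C _ (proj1 (four_points_row 2 (Sz z) d (le_n 2) (Sz_H z Hz)))).
  apply acv_ext; intros c; rewrite four_points_Sz by auto.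
  assert ((z ^ 2)%C <> 0%C) by (apply Cpow_nz, z_neq_0; auto); field; apply z_neq_0; auto. }
assert (Et : forall c d, tau c d = (four_points 2 z c d - ee c d)%C) by (intros; unfold ee; ring).
assert (At : forall c, acv (tau c)).
{ intros c; eapply acv_ext; [intros d; symmetry; apply Et | apply acv_minus; auto]. }
assert (At' : forall d, acv (fun c => tau c d)).
{ intros d; eapply acv_ext; [intros c; symmetry; apply Et | apply acv_minus; auto]. }
assert (Ap : acv pc).
{ generalize (acv_opp _ (proj1 (rc_sum 0))); apply acv_ext; intros c; unfold rc, pc; simpl INR.
  rewrite Rplus_0_l; ring. }
(* For a fixed [c] the far boundary term tends to 0. *)
assert (T1 : forall c, csum (tau c) = (2 * pc c)%C).
{ intros c; apply csum_unique; auto; intros eps He N.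
  destruct (small_inv (4 * / lattice_const z) eps N He) as (D & HD & HB).
  exists D; split; auto; rewrite tau_partial.
  replace (2 * (pc c + rc c D) - 2 * pc c)%C with (2 * rc c D)%C by ring.
  eapply Rle_trans; [ | exact HB].
  assert (PM : 0 < INR D + / 2) by (pose proof (pos_INR D); lra).
  assert (B : forall t, Rabs t = INR D + / 2 -> Cmod (/ (cz c + RtoC t)) <= / (lattice_const z * (INR D + / 2))).
  { intros t Ht; rewrite Cmod_inv by apply cz_nz; apply Rinv_le_contravar.
    - apply Rmult_lt_0_compat; lra.
    - eapply Rle_trans; [ | apply cz_lower]; rewrite Ht; apply Rmult_le_compat_l; [lra | ].
      pose proof (pos_INR (S c)); lra. }
  rewrite Cmod_mult, Cmod_R, Rabs_pos_eq by lra; unfold rc.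
  pose proof (B (- (INR D + / 2)) ltac:(rewrite Rabs_Ropp; apply Rabs_pos_eq; lra)) as B1.
  pose proof (B (INR D + / 2) ltac:(apply Rabs_pos_eq; lra)) as B2.
  eapply Rle_trans; [apply Rmult_le_compat_l; [lra | apply Cmod_triangle] | ]; rewrite Cmod_opp.
  replace (4 * / lattice_const z / (INR D + / 2)) with (4 * / (lattice_const z * (INR D + / 2))) by (field; lra).
  lra. }
assert (Atd : acv (fun d => csum (fun c => tau c d))).
{ eapply acv_ext; [ | apply (acv_minus _ _ A1 F4)]; intros d; cbv beta.
  rewrite <- csum_minus by auto; apply csum_ext; intros c; symmetry; apply Et. }
(* In the other order the far boundary terms are summed over all [c] before the cut-off moves, and
   their total tends to - pi i / z; the factor 2 in [tau] doubles it. *)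
assert (T2 : csum (fun d => csum (fun c => tau c d)) = (2 * csum pc - I2pi / z)%C).
{ apply csum_unique; auto; intros eps He N.
  destruct rc_limit as (K & N0 & HK).
  destruct (small_inv (2 * K) eps (N + N0) He) as (D & HD & HB).
  exists D; split; [lia | ].
  rewrite (proj2 (csumn_csum (fun d c => tau c d) D At')).
  rewrite (csum_ext _ (fun c => 2 * (pc c + rc c D))%C) by (intros c; apply tau_partial).
  rewrite csum_scal by (apply acv_plus; auto; apply rc_sum).
  rewrite csum_plus by (auto; apply rc_sum).
  replace (2 * (csum pc + csum (fun n => rc n D)) - (2 * csum pc - I2pi / z))%C
    with (2 * (csum (fun n => rc n D) + RtoC PI * Ci / z))%C.
  2:{ unfold I2pi; rewrite RtoC_mult; unfold Cdiv; ring. }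
  rewrite Cmod_mult, Cmod_R, Rabs_pos_eq by lra.
  specialize (HK D ltac:(lia)); lra. }
assert (Y1 : csum (fun c => csum (four_points 2 z c)) = (csum (fun c => csum (ee c)) + 2 * csum pc)%C).
{ rewrite <- (csum_scal 2 pc), <- csum_plus by (auto using acv_scal).
  apply csum_ext; intros c; rewrite <- T1, <- csum_plus by auto.
  apply csum_ext; intros d; rewrite Et; ring. }
assert (Y2 : csum (fun d => csum (fun c => four_points 2 z c d))
  = (csum (fun d => csum (fun c => ee c d)) + (2 * csum pc - I2pi / z))%C).
{ rewrite <- T2, <- csum_plus by auto.
  apply csum_ext; intros d; rewrite <- csum_plus by auto.
  apply csum_ext; intros c; rewrite Et; ring. }
rewrite X1, X2, Y1, Y2, F5; unfold Cdiv; ring.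
Qed.

End Quasi.

Lemma sigma_coef_nn (j n : nat) : nnC (sigma_coef j n).
Proof.
apply nnC_csumn; intros c; destruct (Nat.eqb (n mod S c) 0); [ | apply nnC_R; lra].
unfold powcoef; destruct (n / S c)%nat; apply nnC_R; [lra | apply pow_le, pos_INR].
Qed.

(** Division by [n] inverts q d/dq, so that [logeta] is a primitive of the q-series of weight 2. *)
Definition logeta_coef (n : nat) : C := match n with O => RtoC 0 | S _ => (RtoC (/ INR n) * sigma_coef 1 n)%C end.

Lemma logeta_coef_nn (n : nat) : nnC (logeta_coef n).
Proof.
destruct n; [apply nnC_R; lra | ].
apply nnC_mult; [ | apply sigma_coef_nn].
apply nnC_R, Rlt_le, Rinv_0_lt_compat, lt_0_INR; lia.
Qed.

Lemma conv_on_sigma_coef (j : nat) : conv_on (sigma_coef j) 1.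
Proof. apply conv_on_divsum; [apply conv_on_powcoef | reflexivity]. Qed.

Lemma conv_on_logeta_coef : conv_on logeta_coef 1.
Proof.
apply conv_on_le with (sigma_coef 1); [ | apply conv_on_sigma_coef].
intros n; destruct n; [simpl logeta_coef; rewrite Cmod_0; apply Cmod_ge_0 | ].
unfold logeta_coef; rewrite Cmod_mult, Cmod_R.
assert (P : 1 <= INR (S n)) by (rewrite S_INR; pose proof (pos_INR n); lra).
rewrite Rabs_pos_eq by (apply Rlt_le, Rinv_0_lt_compat; lra).
assert (/ INR (S n) <= 1) by (rewrite <- Rinv_1; apply Rinv_le_contravar; lra).
pose proof (Cmod_ge_0 (sigma_coef 1 (S n))); nra.
Qed.

(* log of the product of the (1 - q^n), up to sign: Delta = q exp(-24 logeta). *)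
Definition logeta (z : C) : C := ps logeta_coef (nome z).
Definition Delta (z : C) : C := Cexp (I2pi * z - 24 * logeta z).

Lemma qderiv_logeta (z : C) : upper_half_plane z -> qderiv logeta z (I2pi * ps (sigma_coef 1) (nome z))%C.
Proof.
intros Hz; pose proof (Cmod_nome_lt_1 z Hz) as Hq.
eapply qderiv_eq; [apply (qderiv_ps_nome logeta_coef); auto; apply conv_on_logeta_coef | ].
assert (E : (nome z * ps (dcoef logeta_coef) (nome z))%C = ps (sigma_coef 1) (nome z)).
{ unfold ps at 2; rewrite csum_incr by (apply (conv_on_acv _ 1); auto; apply conv_on_sigma_coef).
  unfold ps; rewrite <- csum_scal by (apply (conv_on_acv _ 1); auto; apply conv_on_dcoef, conv_on_logeta_coef).
  replace (sigma_coef 1 0) with (RtoC 0) by reflexivity.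
  rewrite Cmult_0_l, Cplus_0_l; apply csum_ext; intros n.
  assert (P : INR (S n) <> 0) by (apply not_0_INR; lia).
  unfold dcoef, logeta_coef; rewrite RtoC_inv by auto.
  pose proof (RtoC_neq_0 _ P); simpl Cpow; field; auto. }
rewrite <- E; ring.
Qed.

Lemma I2pi_sqr : (I2pi * I2pi)%C = RtoC (- (4 * PI ^ 2)).
Proof. unfold I2pi; apply C_eq; simpl; ring. Qed.

(** The logarithmic derivative of the discriminant is 2 pi i E_2; the factor 3 / pi^2 is 1 / (2
    zeta(2)), which normalises [Eis 2]. *)
Lemma qderiv_logDelta (z : C) : upper_half_plane z ->
  qderiv (fun y => I2pi * y - 24 * logeta y)%C z (I2pi * RtoC (3 / PI ^ 2) * Eis 2 z)%C.
Proof.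
intros Hz; eapply qderiv_eq.
- apply qderiv_minus; [apply qderiv_scal, qderiv_id | apply qderiv_scal, qderiv_logeta; auto].
- rewrite Eis_q by auto; rewrite (proj2 epsum_1_and_zeta_2).
  assert (EB : lipschitz_const 2 = RtoC (- (4 * PI ^ 2))).
  { rewrite <- I2pi_sqr; unfold lipschitz_const; simpl; field. }
  rewrite EB; simpl (2 - 1)%nat.
  pose proof PI_RGT_0.
  assert (P1 : (RtoC (3 / PI ^ 2) * RtoC (PI ^ 2 / 6))%C = RtoC (/ 2)).
  { rewrite <- RtoC_mult; f_equal; field; lra. }
  assert (P2 : (RtoC (3 / PI ^ 2) * RtoC (- (4 * PI ^ 2)))%C = RtoC (-12)).
  { rewrite <- RtoC_mult; f_equal; field; lra. }
  set (s := ps (sigma_coef 1) (nome z)).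
  transitivity (I2pi * (2 * (RtoC (3 / PI ^ 2) * RtoC (PI ^ 2 / 6)) + 2 * (RtoC (3 / PI ^ 2) * RtoC (- (4 * PI ^ 2))) * s))%C; [ | ring].
  rewrite P1, P2, RtoC_inv by lra; field.
Qed.

Lemma qderiv_pow (n : nat) (x : C) : qderiv (fun y => y ^ S n)%C x (RtoC (INR (S n)) * x ^ n)%C.
Proof.
induction n.
- apply qderiv_ext with (fun y => y); [intros; simpl; ring | ].
  eapply qderiv_eq; [apply qderiv_id | simpl; ring].
- apply qderiv_ext with (fun y => y * y ^ S n)%C; [reflexivity | ].
  eapply qderiv_eq; [apply (qderiv_mult (fun y => y)); [apply qderiv_id | exact IHn] | ].
  rewrite (S_INR (S n)), RtoC_plus; simpl Cpow; ring.
Qed.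

Lemma qderiv_Sz (z : C) : z <> 0%C -> qderiv Sz z (/ (z * z))%C.
Proof.
intros Hz; eapply qderiv_eq; [apply (qderiv_opp (fun y => / y)%C), qderiv_inv; auto | field; auto].
Qed.

(** The quotient of the two sides has derivative zero: the correction - 2 pi i / z in weight 2
    contributes exactly 12 / z to the logarithmic derivative. Its value is 1 at the fixed point i of
    S, since i^12 = 1. *)
Lemma Delta_Sz (z : C) : upper_half_plane z -> Delta (Sz z) = (z ^ 12 * Delta z)%C.
Proof.
intros Hz.
set (logDelta := fun y => (I2pi * y - 24 * logeta y)%C).
set (f := fun y => (Cexp (logDelta (Sz y) - logDelta y) * / y ^ 12)%C).
assert (E : f z = f (0, 1)).
{ apply qderiv_0_const; intros t Ht.
  set (w := ((0, 1) + RtoC t * (z - (0, 1)))%C).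
  assert (Hw : upper_half_plane w).
  { unfold upper_half_plane in *; unfold w; unfold Im in *; destruct z as [x y]; simpl in *; nra. }
  pose proof (z_neq_0 w Hw) as W0.
  unfold f; eapply qderiv_eq.
  - apply qderiv_mult.
    + apply (qderiv_Cexp_comp (fun y => logDelta (Sz y) - logDelta y)%C).
      apply qderiv_minus; [ | apply qderiv_logDelta; auto].
      apply (qderiv_comp logDelta Sz); [apply qderiv_Sz; auto | apply qderiv_logDelta, Sz_H; auto].
    + apply (qderiv_comp (fun y => / y)%C (fun y => y ^ 12)%C); [apply qderiv_pow | apply qderiv_inv, Cpow_nz; auto].
  - cbv beta; rewrite Eis_2_Sz by auto.
    set (e := Cexp (logDelta (Sz w) - logDelta w)).
    assert (Q : (I2pi * RtoC (3 / PI ^ 2) * (w ^ 2 * (Eis 2 w - I2pi / w)) * / (w * w)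
       - I2pi * RtoC (3 / PI ^ 2) * Eis 2 w)%C = (RtoC 12 / w)%C).
    { transitivity (- ((I2pi * I2pi) * RtoC (3 / PI ^ 2)) / w)%C; [field; auto | ].
      rewrite I2pi_sqr, <- RtoC_mult, <- RtoC_opp; f_equal; f_equal; field.
      apply Rgt_not_eq, PI_RGT_0. }
    rewrite Q; replace (INR 12) with 12 by (simpl; ring); field; auto. }
unfold f in E.
assert (S1 : Sz (0, 1) = (0, 1)) by (unfold Sz; apply C_eq; simpl; field).
rewrite S1 in E.
replace (logDelta (0, 1) - logDelta (0, 1))%C with (RtoC 0) in E by ring.
rewrite Cexp_0 in E.
assert (I12 : (((0, 1) : C) ^ 12)%C = 1%C) by (apply C_eq; simpl; ring).
rewrite I12 in E.
unfold Delta; fold (logDelta z); fold (logDelta (Sz z)).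
replace (logDelta (Sz z)) with ((logDelta (Sz z) - logDelta z) + logDelta z)%C by ring.
rewrite Cexp_plus.
pose proof (z_neq_0 z Hz) as Z0; assert (Zk : (z ^ 12)%C <> 0%C) by (apply Cpow_nz; auto).
replace (Cexp (logDelta (Sz z) - logDelta z)) with ((Cexp (logDelta (Sz z) - logDelta z) * / z ^ 12) * z ^ 12)%C by (field; auto).
rewrite E; field.
Qed.

Lemma ps_delay (a : nat -> C) (m : nat) (q : C) : conv_on a 1 -> Cmod q < 1 ->
  ps (delay a m) q = (q ^ m * ps a q)%C.
Proof.
intros Ha Hq.
assert (A : acv (fun n => a n * q ^ n)%C) by (apply conv_on_acv with 1; auto).
unfold ps; rewrite <- (csum_delay _ m A), <- csum_scal by (apply acv_delay; auto).
apply csum_ext; intros n; unfold delay; destruct (Nat.leb_spec m n); [ | ring].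
assert (E : (q ^ n)%C = (q ^ m * q ^ (n - m))%C) by (rewrite <- Cpow_add_r; f_equal; lia).
rewrite E; ring.
Qed.

Lemma conv_on_delay (a : nat -> C) (m : nat) : conv_on a 1 -> conv_on (delay a m) 1.
Proof.
intros Ha r Hr.
assert (M : Cmod (RtoC r) = r) by (rewrite Cmod_R, Rabs_pos_eq; lra).
assert (A : acv (fun n => a n * RtoC r ^ n)%C) by (apply conv_on_acv with 1; auto; lra).
generalize (acv_scal (RtoC r ^ m) _ (acv_delay _ m A)); apply ex_series_ext; intros n.
unfold delay; destruct (Nat.leb_spec m n).
- assert (E : r ^ n = r ^ m * r ^ (n - m)) by (rewrite <- pow_add; f_equal; lia).
  rewrite !Cmod_mult, !Cmod_pow, M, E.
  match goal with |- @eq _ ?a ?b => change (@eq R a b) end; ring.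
- rewrite Cmult_0_r, Cmod_0.
  match goal with |- @eq _ ?a ?b => change (@eq R a b) end; ring.
Qed.

Lemma Delta_q : has_q_expansion Delta (delay (expser (-24) logeta_coef) 1).
Proof.
assert (A : conv_on (expser (-24) logeta_coef) 1) by (apply conv_on_expser; [apply logeta_coef_nn | apply conv_on_logeta_coef]).
apply q_expansion_intro; [apply conv_on_delay; auto | ].
intros z Hz; pose proof (Cmod_nome_lt_1 z Hz) as Hq.
rewrite ps_delay, ps_expser by (auto; try apply logeta_coef_nn; apply conv_on_logeta_coef).
unfold Delta, logeta; rewrite nome_Cexp at 2; simpl Cpow; rewrite Cmult_1_r, <- Cexp_plus; f_equal; ring.
Qed.

Lemma Cpow_1_l (n : nat) : (1 ^ n)%C = 1%C.
Proof. induction n; simpl; [auto | rewrite IHn; ring]. Qed.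

(* Euclid's algorithm on the bottom row writes a matrix as a word in S and T. *)
Lemma weight_invariant_ST (k : nat) (f : C -> C) : Nat.Even k ->
  (forall w, upper_half_plane w -> f (w + 1)%C = f w) ->
  (forall w, upper_half_plane w -> f (Sz w) = (w ^ k * f w)%C) ->
  weight_invariant k f.
Proof.
intros Hk HT HS a b c d Hdet z Hz; revert a b c d Hdet z Hz.
assert (G : forall n a b c d, (Z.abs_nat c < n)%nat -> (a * d - b * c = 1)%Z ->
  forall z : C, upper_half_plane z ->
    f ((IZR a * z + IZR b) / (IZR c * z + IZR d))%C = ((IZR c * z + IZR d) ^ k * f z)%C).
{ induction n; intros a b c d Hn Hdet z Hz; [lia | ].
  destruct (Z.eq_dec c 0) as [C0 | C0].
  - subst c.
    assert (Had : (a * d = 1)%Z) by lia.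
    destruct (Z.mul_eq_1 a d Had) as [Ha | Ha].
    + assert (Hd : d = 1%Z) by lia.
      replace ((IZR a * z + IZR b) / (IZR 0 * z + IZR d))%C with (z + IZR b)%C by (rewrite Ha, Hd; field).
      rewrite (period_Z f HT) by auto.
      replace (IZR 0 * z + IZR d)%C with (RtoC 1) by (rewrite Hd; ring); rewrite Cpow_1_l; ring.
    + assert (Hd : d = (-1)%Z) by lia.
      assert (Ea : RtoC (IZR a) = (- (1))%C) by (rewrite Ha, <- RtoC_opp; reflexivity).
      assert (Ed : RtoC (IZR d) = (- (1))%C) by (rewrite Hd, <- RtoC_opp; reflexivity).
      replace ((IZR a * z + IZR b) / (IZR 0 * z + IZR d))%C with (z + IZR (- b))%C.
      2:{ rewrite opp_IZR, RtoC_opp, Ea, Ed; field; intros Q; apply (f_equal Re) in Q; simpl in Q; lra. }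
      rewrite (period_Z f HT) by auto.
      replace (IZR 0 * z + IZR d)%C with (- (1))%C by (rewrite Ed; ring).
      rewrite Cpow_opp_even, Cpow_1_l by auto; ring.
  (* The matrix is rewritten as one with bottom row (r, - c), acting on S applied to z + q; the
     remainder [r] is smaller than [c] in absolute value. *)
  - set (q := (d / c)%Z); set (r := (d mod c)%Z).
    assert (Ed : d = (c * q + r)%Z) by (apply Z_div_mod_eq_full).
    assert (Hr : (Z.abs_nat r < Z.abs_nat c)%nat).
    { pose proof (Z.mod_bound_or d c C0); unfold r; lia. }
    set (y := (z + IZR q)%C).
    assert (Hy : upper_half_plane y) by (apply add_real_H; auto).
    pose proof (z_neq_0 y Hy) as Y0.
    assert (Hdet2 : ((b - q * a) * (- c) - (- a) * r = 1)%Z) by (rewrite Ed in Hdet; lia).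
    pose proof (IHn (b - q * a)%Z (- a)%Z r (- c)%Z ltac:(lia) Hdet2 (Sz y) (Sz_H y Hy)) as I.
    assert (D0 : (IZR c * z + IZR d)%C <> 0%C).
    { destruct (Z_lt_dec 0 c) as [L | L].
      - apply lattice_neq_0; auto; apply IZR_lt; auto.
      - intros Q; apply (lattice_neq_0 z (- IZR c) (- IZR d) Hz).
        + rewrite <- opp_IZR; apply IZR_lt; lia.
        + rewrite !RtoC_opp; replace (- RtoC (IZR c) * z + - RtoC (IZR d))%C with (- (IZR c * z + IZR d))%C by ring.
          rewrite Q; ring. }
    assert (Edz : (IZR r * Sz y + IZR (- c))%C = (- (IZR c * z + IZR d) / y)%C).
    { assert (Enum : (IZR c * z + IZR d)%C = (IZR c * y + IZR r)%C).
      { rewrite Ed, plus_IZR, mult_IZR, RtoC_plus, RtoC_mult; unfold y; ring. }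
      rewrite Enum; unfold Sz; rewrite opp_IZR, RtoC_opp; field; auto. }
    assert (Earg : ((IZR (b - q * a) * Sz y + IZR (- a)) / (IZR r * Sz y + IZR (- c)))%C
       = ((IZR a * z + IZR b) / (IZR c * z + IZR d))%C).
    { rewrite Edz; unfold Sz; rewrite minus_IZR, mult_IZR, opp_IZR, RtoC_minus, RtoC_mult, RtoC_opp.
      assert (Nm : (IZR a * z + IZR b)%C = (RtoC (IZR a) * y + (RtoC (IZR b) - RtoC (IZR q) * RtoC (IZR a)))%C)
        by (unfold y; ring).
      rewrite Nm; field; auto. }
    rewrite Earg, HS, Edz in I by auto; rewrite I.
    unfold Cdiv; rewrite Cpow_mult_l, Cpow_opp_even, Cpow_inv by auto.
    unfold y at 3; rewrite (period_Z f HT) by auto.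
    field; apply Cpow_nz; auto. }
intros a b c d Hdet z Hz; apply (G (S (Z.abs_nat c))); auto.
Qed.

(** * A lower bound for the dimension *)

Lemma modular_form_intro (k : nat) (f : C -> C) (a : nat -> C) : Nat.Even k ->
  has_q_expansion f a ->
  (forall w, upper_half_plane w -> f (w + 1)%C = f w) ->
  (forall w, upper_half_plane w -> f (Sz w) = (w ^ k * f w)%C) ->
  modular_form k f.
Proof.
intros Hk Ha HT HS; split; [ | split].
- apply q_expansion_holomorphic with a; auto.
- apply weight_invariant_ST; auto.
- exists a; auto.
Qed.

Lemma modular_form_mult (k m : nat) (f g : C -> C) :
  modular_form k f -> modular_form m g -> modular_form (k + m) (fun z => f z * g z)%C.
Proof.
intros (_ & W1 & a & A) (_ & W2 & b & B).
pose proof (q_expansion_mult f g a b A B) as Q; split; [ | split].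
- apply q_expansion_holomorphic with (cconv a b); auto.
- intros p q r s H z Hz; rewrite W1, W2 by auto; rewrite Cpow_add_r; ring.
- exists (cconv a b); auto.
Qed.

Lemma q_expansion_const (c : C) : has_q_expansion (fun _ => c) (fun n => c * delta0 n)%C.
Proof.
apply q_expansion_intro; [apply conv_on_scal, conv_on_delta0 | ].
intros z Hz; rewrite (ps_scal c delta0 1), ps_delta0; [ring | apply conv_on_delta0 | apply Cmod_nome_lt_1; auto].
Qed.

Lemma modular_form_const (c : C) : modular_form 0 (fun _ => c).
Proof.
split; [ | split].
- apply q_expansion_holomorphic with (fun n => c * delta0 n)%C, q_expansion_const.
- intros p q r s H z Hz; simpl; ring.
- exists (fun n => c * delta0 n)%C; apply q_expansion_const.
Qed.

Lemma q_expansion_period (f : C -> C) (a : nat -> C) (z : C) : has_q_expansion f a ->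
  upper_half_plane z -> f (z + 1)%C = f z.
Proof.
intros Ha Hz; rewrite (q_expansion_ps f a z), (q_expansion_ps f a (z + 1)), nome_add_1; auto.
apply add_real_H; auto.
Qed.

Lemma modular_form_Delta : modular_form 12 Delta.
Proof.
apply modular_form_intro with (delay (expser (-24) logeta_coef) 1).
- exists 6%nat; auto.
- apply Delta_q.
- intros; apply q_expansion_period with (delay (expser (-24) logeta_coef) 1); auto; apply Delta_q.
- apply Delta_Sz.
Qed.

Lemma modular_form_pow (k m : nat) (f : C -> C) :
  modular_form k f -> modular_form (k * m) (fun z => f z ^ m)%C.
Proof.
intros H; induction m.
- rewrite Nat.mul_0_r; apply (modular_form_const 1).
- rewrite Nat.mul_succ_r, Nat.add_comm; apply (modular_form_mult k (k * m) f (fun z => f z ^ m)%C); auto.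
Qed.

Definition eisenstein (k : nat) (z : C) : C := (Eis k z / (2 * RtoC (zeta k)))%C.
Definition eisenstein_coef (k n : nat) : C := (delta0 n + (lipschitz_const k / RtoC (zeta k)) * sigma_coef (k - 1) n)%C.

Lemma zeta_neq_0 (k : nat) : (2 <= k)%nat -> RtoC (zeta k) <> 0%C.
Proof. intros Hk; apply RtoC_neq_0; pose proof (zeta_ge_1 k Hk); lra. Qed.

Lemma eisenstein_q (k : nat) : (2 <= k)%nat -> has_q_expansion (eisenstein k) (eisenstein_coef k).
Proof.
intros Hk; pose proof (zeta_neq_0 k Hk) as Z0.
assert (A : conv_on (fun n => (lipschitz_const k / RtoC (zeta k)) * sigma_coef (k - 1) n)%C 1).
{ apply conv_on_scal, conv_on_sigma_coef. }
apply q_expansion_intro; [apply conv_on_plus; auto; apply conv_on_delta0 | ].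
intros z Hz; pose proof (Cmod_nome_lt_1 z Hz) as Hq.
unfold eisenstein_coef; rewrite (ps_plus delta0 (fun n => lipschitz_const k / RtoC (zeta k) * sigma_coef (k - 1) n)%C 1), ps_delta0,
  (ps_scal _ (sigma_coef (k - 1)) 1); auto using conv_on_delta0, conv_on_sigma_coef.
unfold eisenstein; rewrite Eis_q by auto; field; auto.
Qed.

Lemma eisenstein_Sz (k : nat) (z : C) : (4 <= k)%nat -> Nat.Even k -> upper_half_plane z ->
  eisenstein k (Sz z) = (z ^ k * eisenstein k z)%C.
Proof.
intros Hk He Hz; unfold eisenstein; rewrite Eis_Sz by auto.
pose proof (zeta_neq_0 k ltac:(lia)); field; auto.
Qed.

Lemma modular_form_eisenstein (k : nat) : (4 <= k)%nat -> Nat.Even k -> modular_form k (eisenstein k).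
Proof.
intros Hk He; apply modular_form_intro with (eisenstein_coef k); auto.
- apply eisenstein_q; lia.
- intros; apply q_expansion_period with (eisenstein_coef k); auto; apply eisenstein_q; lia.
- intros; apply eisenstein_Sz; auto.
Qed.

(** A constant in weight 0 and an Eisenstein series otherwise. Multiples of 4 never meet weight 2,
    where the Eisenstein series is not modular. *)
Lemma modular_form_leading_1 (k : nat) : (k mod 4 = 0)%nat ->
  exists f b, modular_form k f /\ has_q_expansion f b /\ b 0%nat = 1%C.
Proof.
intros Hk; destruct (Nat.eq_dec k 0) as [E | E].
- subst; exists (fun _ => RtoC 1), (fun n => 1 * delta0 n)%C; split; [apply modular_form_const | ].
  split; [apply q_expansion_const | unfold delta0; simpl; ring].
- pose proof (Nat.div_mod_eq k 4).
  exists (eisenstein k), (eisenstein_coef k); split; [ | split].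
  + apply modular_form_eisenstein; [lia | exists (2 * (k / 4))%nat; lia].
  + apply eisenstein_q; lia.
  + unfold eisenstein_coef, sigma_coef, divsum, delta0; simpl; ring.
Qed.

Lemma cusp_form_order (k m : nat) : (k mod 4 = 0)%nat -> (1 <= m)%nat -> (12 * m <= k)%nat ->
  exists f b, cusp_form k f /\ has_q_expansion f (delay b m) /\ b 0%nat = 1%C.
Proof.
intros Hk Hm Hmk.
assert (Hk' : ((k - 12 * m) mod 4 = 0)%nat).
{ pose proof (Nat.div_mod_eq k 4); rewrite Hk in H.
  replace (k - 12 * m)%nat with ((k / 4 - 3 * m) * 4)%nat by lia; apply Nat.Div0.mod_mul. }
destruct (modular_form_leading_1 _ Hk') as (g & b & Mg & Qg & B0).
set (ex := expser (-24) logeta_coef).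
assert (Cex : conv_on ex 1) by (apply conv_on_expser; [apply logeta_coef_nn | apply conv_on_logeta_coef]).
assert (Ex0 : ex 0%nat = 1%C) by (apply expser_0; [apply logeta_coef_nn | apply conv_on_logeta_coef | reflexivity]).
set (e := cconv (cpow ex m) b).
assert (Cb : conv_on b 1) by (apply (q_expansion_conv g); auto).
assert (Ce : conv_on e 1) by (apply conv_on_cconv; auto; apply conv_on_cpow; auto).
set (f := fun z => (Delta z ^ m * g z)%C).
assert (Qf : has_q_expansion f (delay e m)).
{ apply q_expansion_intro; [apply conv_on_delay; auto | ].
  intros z Hz; pose proof (Cmod_nome_lt_1 z Hz) as Hq.
  unfold f; rewrite (q_expansion_ps _ _ z Delta_q Hz), (q_expansion_ps g b z Qg Hz).
  fold ex; rewrite (ps_delay ex), (ps_delay e) by auto; unfold e.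
  rewrite (ps_cconv _ _ 1), (ps_cpow ex m 1) by (auto; apply conv_on_cpow; auto).
  simpl (nome z ^ 1)%C; rewrite Cmult_1_r, Cpow_mult_l; ring. }
assert (Mf : modular_form k f).
{ replace k with (12 * m + (k - 12 * m))%nat by lia.
  apply (modular_form_mult _ _ (fun z => Delta z ^ m)%C g); auto.
  apply modular_form_pow, modular_form_Delta. }
exists f, e; split; [ | split; auto].
- split; auto; exists (delay e m); split; auto.
  unfold delay; destruct m; [lia | reflexivity].
- unfold e; rewrite <- ps_0, (ps_cconv _ _ 1), (ps_cpow ex m 1), !ps_0, Ex0, B0, Cpow_1_l;
    auto; try ring; try (rewrite Cmod_0; lra); apply conv_on_cpow; auto.
Qed.

(** * Linear dependence: more unknowns than equations *)

Definition skip (p m : nat) : nat := if Nat.ltb m p then m else S m.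

Lemma csumn_skip (g : nat -> C) (p n : nat) : (p <= n)%nat ->
  csumn g (S n) = (g p + csumn (fun m => g (skip p m)) n)%C.
Proof.
intros H; induction H as [ | n H IH].
- assert (E : csumn (fun m => g (skip p m)) p = csumn g p).
  { apply csumn_ext; intros i Hi; unfold skip; destruct (Nat.ltb_spec i p); [auto | lia]. }
  rewrite E; simpl; ring.
- change (csumn g (S (S n))) with (csumn g (S n) + g (S n))%C; rewrite IH; simpl csumn.
  unfold skip at 3; destruct (Nat.ltb_spec n p); [lia | ring].
Qed.

(** Elimination by induction on the number of equations: an unknown [p] with nonzero coefficient in
    the last equation is expressed through the others and substituted. *)
Lemma linear_dependence (l : nat) (c : nat -> nat -> C) :
  exists x : nat -> C, (exists m, (m <= l)%nat /\ x m <> 0%C) /\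
    forall i, (i < l)%nat -> csumn (fun m => x m * c m i)%C (S l) = 0%C.
Proof.
revert c; induction l; intros c.
- exists (fun _ => RtoC 1); split; [exists 0%nat; split; [lia | apply C1_nz] | intros; lia].
- destruct (Classical_Prop.classic (exists p, (p <= S l)%nat /\ c p l <> 0%C)) as [(p & Hp & P0) | N].
  + destruct (IHl (fun m i => c (skip p m) i - c (skip p m) l / c p l * c p i)%C) as (y & (m0 & Hm0 & Y0) & Hy).
    set (t := (- csumn (fun m => y m * c (skip p m) l) (S l) / c p l)%C).
    set (x := fun j => if Nat.ltb j p then y j else if Nat.eqb j p then t else y (j - 1)%nat).
    assert (Xs : forall m, x (skip p m) = y m).
    { intros m; unfold x, skip; destruct (Nat.ltb_spec m p).
      - destruct (Nat.ltb_spec m p); [auto | lia].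
      - destruct (Nat.ltb_spec (S m) p), (Nat.eqb_spec (S m) p); try lia; f_equal; lia. }
    assert (Xp : x p = t).
    { unfold x; destruct (Nat.ltb_spec p p), (Nat.eqb_spec p p); try lia; auto. }
    exists x; split.
    * exists (skip p m0); split; [unfold skip; destruct (Nat.ltb_spec m0 p); lia | rewrite Xs; auto].
    * intros i Hi; rewrite (csumn_skip _ p) by auto; rewrite Xp.
      rewrite (csumn_ext _ (fun m => y m * c (skip p m) i)%C) by (intros; rewrite Xs; auto).
      destruct (Nat.eq_dec i l) as [-> | Hil]; [unfold t; field; auto | ].
      specialize (Hy i ltac:(lia)).
      rewrite (csumn_ext _ (fun m => y m * c (skip p m) i + (- c p i / c p l) * (y m * c (skip p m) l))%C) in Hy
        by (intros; field; auto).
      rewrite csumn_plus, csumn_scal in Hy.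
      rewrite <- Hy; unfold t; field; auto.
  + destruct (IHl c) as (y & (m0 & Hm0 & Y0) & Hy).
    (* Here the last equation has only zero coefficients. The induction hypothesis solves the others
       in all unknowns but the last, which is set to 0. *)
    exists (fun m => if Nat.ltb m (S l) then y m else RtoC 0); split.
    * exists m0; split; [lia | destruct (Nat.ltb_spec m0 (S l)); [auto | lia]].
    * intros i Hi; change (csumn (fun m => (if Nat.ltb m (S l) then y m else RtoC 0) * c m i)%C (S (S l)))
        with (csumn (fun m => (if Nat.ltb m (S l) then y m else RtoC 0) * c m i)%C (S l)
          + (if Nat.ltb (S l) (S l) then y (S l) else RtoC 0) * c (S l) i)%C.
      destruct (Nat.ltb_spec (S l) (S l)); [lia | ].
      rewrite (csumn_ext _ (fun m => y m * c m i)%C).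
      2:{ intros m Hm; destruct (Nat.ltb_spec m (S l)); [auto | lia]. }
      destruct (Nat.eq_dec i l) as [-> | Hil].
      -- rewrite (csumn_ext _ (fun m => 0 * 0)%C), (csumn_scal 0 (fun _ => RtoC 0)); [ring | ].
         intros m Hm; replace (c m l) with (RtoC 0); [ring | ].
         destruct (Classical_Prop.classic (c m l = 0%C)) as [Q | Q]; auto.
         exfalso; apply N; exists m; split; [lia | auto].
      -- rewrite Hy by lia; ring.
Qed.

Lemma lincomb_csumn (l : nat) (c : nat -> C) (b : nat -> C -> C) (z : C) :
  lincomb l c b z = csumn (fun i => c (S i) * b (S i) z)%C l.
Proof.
unfold lincomb; induction l.
- rewrite sum_n_m_zero by lia; reflexivity.
- rewrite sum_n_Sm by lia; rewrite IHl; reflexivity.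
Qed.

Lemma q_expansion_csumn (f : nat -> C -> C) (a : nat -> nat -> C) (x : nat -> C) (N : nat) :
  (forall m, (m < N)%nat -> has_q_expansion (f m) (a m)) ->
  has_q_expansion (fun z => csumn (fun m => x m * f m z)%C N) (fun n => csumn (fun m => x m * a m n)%C N).
Proof.
induction N; intros H.
- apply q_expansion_intro; [apply conv_on_finite with 0%nat; auto | ].
  intros z Hz; simpl; unfold ps; rewrite csum_0; auto; intros; ring.
- simpl csumn; apply (q_expansion_plus (fun z => csumn (fun m => x m * f m z)%C N) (fun z => x N * f N z)%C
    (fun n => csumn (fun m => x m * a m n)%C N) (fun n => x N * a N n)%C).
  + apply IHN; auto.
  + apply q_expansion_scal; auto.
Qed.

Lemma finite_choice {A : Type} (a0 : A) (P : nat -> A -> Prop) (N : nat) :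
  (forall m, (m < N)%nat -> exists a, P m a) -> exists f, forall m, (m < N)%nat -> P m (f m).
Proof.
induction N; intros H; [exists (fun _ => a0); intros; lia | ].
destruct IHN as [f Hf]; auto.
destruct (H N (le_n _)) as [a Ha].
exists (fun m => if Nat.eqb m N then a else f m); intros m Hm.
destruct (Nat.eqb_spec m N); [subst; auto | apply Hf; lia].
Qed.

(** Were l < k/12, cusp forms of the orders 1, ..., l + 1 would lie in the span of l functions and
    satisfy a nontrivial linear relation, which their distinct leading terms exclude. *)
Lemma dimension_lower_bound (k l : nat) : (k mod 4 = 0)%nat ->
  has_dimension (cusp_form k) l -> (k / 12 <= l)%nat.
Proof.
intros Hk (b & _ & _ & Hspan).
destruct (le_lt_dec (k / 12) l) as [L | L]; auto; exfalso.
pose proof (Nat.div_mod_eq k 12) as Ek.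
assert (HF : forall m, (m < S l)%nat -> exists p : (C -> C) * (nat -> C),
   cusp_form k (fst p) /\ has_q_expansion (fst p) (delay (snd p) (S m)) /\ snd p 0%nat = 1%C).
{ intros m Hm; destruct (cusp_form_order k (S m) Hk ltac:(lia) ltac:(lia)) as (f & e & H).
  exists (f, e); exact H. }
destruct (finite_choice ((fun _ => RtoC 0), (fun _ => RtoC 0)) _ _ HF) as (v & Hv).
assert (HC : forall m, (m < S l)%nat -> exists c : nat -> C,
   forall z, upper_half_plane z -> fst (v m) z = lincomb l c b z).
{ intros m Hm; apply Hspan, Hv; auto. }
destruct (finite_choice (fun _ => RtoC 0) _ _ HC) as (c & Hc).
destruct (linear_dependence l (fun m i => c m (S i))) as (x & (m1 & Hm1 & X1) & Hx).
set (f := fun z => csumn (fun m => x m * fst (v m) z)%C (S l)).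
set (a := fun n => csumn (fun m => x m * delay (snd (v m)) (S m) n)%C (S l)).
assert (Qf : has_q_expansion f a).
{ apply (q_expansion_csumn (fun m => fst (v m)) (fun m => delay (snd (v m)) (S m))); intros; apply Hv; auto. }
assert (F0 : forall z, upper_half_plane z -> f z = 0%C).
{ intros z Hz; unfold f.
  rewrite (csumn_ext _ (fun m => csumn (fun i => x m * (c m (S i) * b (S i) z)) l)%C).
  2:{ intros m Hm; rewrite (Hc m Hm z Hz), lincomb_csumn, csumn_scal; auto. }
  rewrite csumn_swap.
  rewrite (csumn_ext _ (fun i => 0 * b (S i) z)%C).
  - rewrite csumn_scal; ring.
  - intros i Hi; rewrite (csumn_ext _ (fun m => b (S i) z * (x m * c m (S i)))%C) by (intros; ring).
    rewrite csumn_scal, (Hx i Hi); ring. }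
assert (A0 : forall n, a n = 0%C).
{ apply coef_zero; [apply (q_expansion_conv f); auto | ].
  intros z Hz; rewrite <- (q_expansion_ps f a z Qf Hz); auto. }
(* In the coefficient of q^(m+1) the forms of lower order are already known to have coefficient 0 in
   the relation, and those of higher order do not contribute. *)
assert (X0 : forall m, (m <= l)%nat -> x m = 0%C).
{ induction m as [m IH] using (well_founded_induction lt_wf); intros Hm.
  pose proof (A0 (S m)) as Am; unfold a in Am; rewrite (csumn_skip _ m) in Am by lia.
  rewrite (csumn_ext (fun i => (x (skip m i) * _)%C) (fun _ => 0 * 0)%C), (csumn_scal 0 (fun _ => RtoC 0)) in Am.
  - unfold delay in Am; rewrite Nat.leb_refl, Nat.sub_diag in Am.
    destruct (Hv m ltac:(lia)) as (_ & _ & V0); rewrite V0 in Am.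
    rewrite <- Am; ring.
  - intros i Hi; unfold skip; destruct (Nat.ltb_spec i m).
    + rewrite IH by lia; ring.
    + unfold delay; destruct (Nat.leb_spec (S (S i)) (S m)); [lia | ring]. }
apply X1, X0; auto.
Qed.

(** * Coefficients of cusp forms *)

Lemma PI_bounds : 3.1 <= PI <= 3.3.
Proof.
destruct (PI_2_3_7_ineq 0) as [A _]; destruct (PI_2_3_7_ineq 1) as [_ B].
unfold sum_f_R0, tg_alt, PI_2_3_7_tg, Ratan_seq in A, B; simpl in A, B; lra.
Qed.

Lemma exp_ge_partial (x : R) (N : nat) : 0 <= x ->
  sum_n (fun n => x ^ n * / INR (fact n)) N <= exp x.
Proof.
intros Hx.
assert (E : is_series (fun n => x ^ n * / INR (fact n)) (exp x)).
{ generalize (is_exp_Reals x); apply is_series_ext; intros n; rewrite pow_n_pow; reflexivity. }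
rewrite <- (is_series_unique _ _ E); apply Series_pos_partial; [ | exists (exp x); exact E].
intros n; apply Rmult_le_pos; [apply pow_le; auto | apply Rlt_le, Rinv_0_lt_compat, INR_fact_lt_0].
Qed.

(** The crude bound sigma_1(n) <= n^2. It costs little, because the final numerical estimates use it
    only where |q| is below 0.006. *)
Lemma logeta_coef_bound (n : nat) : Cmod (logeta_coef n) <= INR n.
Proof.
destruct n; [simpl logeta_coef; rewrite Cmod_0; simpl; lra | ].
unfold logeta_coef; rewrite Cmod_mult, Cmod_R.
assert (P : 0 < INR (S n)) by (apply lt_0_INR; lia).
rewrite Rabs_pos_eq by (apply Rlt_le, Rinv_0_lt_compat; auto).
apply Rmult_le_reg_l with (INR (S n)); auto.
rewrite <- Rmult_assoc, Rinv_r, Rmult_1_l by lra.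
apply Cmod_csumn_bound; intros i Hi.
destruct (Nat.eqb (S n mod S i) 0); [ | rewrite Cmod_0; lra].
unfold powcoef; destruct (S n / S i)%nat eqn:E; [rewrite Cmod_0; lra | ].
rewrite Cmod_R, Rabs_pos_eq by (apply pow_le, pos_INR).
rewrite pow_1, <- E; apply le_INR, Nat.Div0.div_le_upper_bound; nia.
Qed.

(* sum n r^n, a majorant of [logeta] at |q| = r. *)
Definition koebe (r : R) : R := r / (1 - r) ^ 2.

Lemma ps_powcoef_1 (r : R) : 0 < r < 1 -> ps (powcoef 1) (RtoC r) = RtoC (koebe r).
Proof.
intros Hr; destruct (nome_real r Hr) as (z & Hz & E).
rewrite <- E; change (ps (powcoef 1) (nome z)) with (lser 1 z); rewrite lser_1 by auto; rewrite E.
unfold koebe; rewrite <- RtoC_minus, <- RtoC_mult, <- RtoC_div by nra; f_equal; field; lra.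
Qed.

Lemma Cmod_ps_logeta_coef (q : C) (r : R) : Cmod q <= r -> 0 < r < 1 -> Cmod (ps logeta_coef q) <= koebe r.
Proof.
intros Hq Hr.
assert (M : Cmod (RtoC r) = r) by (rewrite Cmod_R, Rabs_pos_eq; lra).
assert (A : acv (fun n => powcoef 1 n * RtoC r ^ n)%C).
{ apply conv_on_acv with 1; [apply conv_on_powcoef | lra]. }
assert (E : koebe r = Series (fun n => Cmod (powcoef 1 n * RtoC r ^ n)%C)).
{ pose proof (ps_powcoef_1 r Hr) as P; unfold ps in P; rewrite nnC_csum in P.
  - injection P; auto.
  - intros n; apply nnC_mult; [ | rewrite <- RtoC_pow; apply nnC_R, pow_le; lra].
    destruct n; apply nnC_R; [lra | apply pow_le, pos_INR]. }
rewrite E; apply Cmod_csum_le_maj; [ | exact A].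
intros n; rewrite !Cmod_mult, !Cmod_pow, M.
apply Rmult_le_compat; [apply Cmod_ge_0 | apply pow_le, Cmod_ge_0 | | apply pow_incr; split; [apply Cmod_ge_0 | auto]].
eapply Rle_trans; [apply logeta_coef_bound | ].
destruct n; [simpl; rewrite Cmod_0; lra | ].
unfold powcoef; rewrite Cmod_R, pow_1; apply Rle_abs.
Qed.

Definition nome_abs (y : R) : R := exp (- (2 * PI * y)).

Lemma nome_abs_lt_1 (y : R) : 0 < y -> 0 < nome_abs y < 1.
Proof. intros; split; [apply exp_pos | apply exp_lt_1; pose proof PI_RGT_0; nra]. Qed.

Lemma logeta_bound (z : C) (y : R) : 0 < y <= Im z -> Cmod (logeta z) <= koebe (nome_abs y).
Proof.
intros Hy; apply Cmod_ps_logeta_coef; [ | apply nome_abs_lt_1; lra].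
rewrite Cmod_nome; apply exp_le; pose proof PI_RGT_0; nra.
Qed.

Lemma logeta_add_1 (z : C) : logeta (z + 1) = logeta z.
Proof. unfold logeta; rewrite nome_add_1; auto. Qed.

(* [logDelta z] is -log |Delta z|. *)
Definition logDelta (z : C) : R := 2 * PI * Im z + 24 * Re (logeta z).

Lemma Cmod_Delta (z : C) : Cmod (Delta z) = exp (- logDelta z).
Proof.
unfold Delta, logDelta; rewrite Cmod_Cexp; f_equal; unfold I2pi, Re, Im; simpl; ring.
Qed.

Lemma logDelta_Sz (z : C) : upper_half_plane z -> logDelta (Sz z) = logDelta z - 12 * ln (Cmod z).
Proof.
intros Hz; pose proof (Cmod_pos z (z_neq_0 z Hz)) as P.
pose proof (f_equal Cmod (Delta_Sz z Hz)) as E.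
rewrite Cmod_mult, Cmod_pow, !Cmod_Delta in E.
apply (f_equal ln) in E; rewrite ln_mult, !ln_exp, ln_pow in E; auto using exp_pos.
- simpl INR in E; lra.
- apply pow_lt; auto.
Qed.

Lemma logDelta_add_1 (z : C) : logDelta (z + 1) = logDelta z.
Proof. unfold logDelta; rewrite logeta_add_1, Im_add_real; auto. Qed.

Lemma exp_INR_ln (k : nat) (x : R) : 0 < x -> exp (INR k * ln x) = x ^ k.
Proof. intros Hx; rewrite <- ln_pow by auto; apply exp_ln, pow_lt; auto. Qed.

(** If |Re w| <= 1/2 and Im w <= 43/50 then |w|^2 <= 0.99, so S raises the height by a factor above
    1.01, and finitely many steps reach the half plane Im w >= 43/50. The height 43/50 lies just
    below sqrt(3)/2. *)
Lemma weight_reduce (phi : C -> R) (M : R) :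
  (forall w, upper_half_plane w -> phi (w + 1)%C = phi w) ->
  (forall w, upper_half_plane w -> phi (Sz w) = phi w) ->
  (forall w, 43 / 50 <= Im w -> phi w <= M) ->
  forall z, upper_half_plane z -> phi z <= M.
Proof.
intros HT HS HM.
assert (G : forall n z, upper_half_plane z -> 43 / 50 <= Im z * 1.01 ^ n -> phi z <= M).
{ induction n; intros z Hz Hn; [apply HM; simpl in Hn; lra | ].
  destruct (Rle_dec (43 / 50) (Im z)) as [L | L]; [apply HM; auto | ].
  destruct (period_reduce (fun w => RtoC (phi w)) z) as (w & E & Iw & Rw); auto.
  { intros w Hw; rewrite HT; auto. }
  injection E as E; rewrite <- E.
  assert (Hw : upper_half_plane w) by (unfold upper_half_plane in *; lra).
  rewrite <- HS by auto; apply IHn; [apply Sz_H; auto | ].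
  rewrite Im_Sz by auto.
  eapply Rle_trans; [exact Hn | ]; rewrite <- Iw; simpl pow; rewrite <- Rmult_assoc.
  apply Rmult_le_compat_r; [apply pow_le; lra | ].
  unfold upper_half_plane in Hw; pose proof (Cmod_pos w (z_neq_0 w Hw)) as Pw.
  assert (Q : Cmod w ^ 2 <= 0.99).
  { rewrite Cmod2_alt; rewrite <- (pow2_abs (Re w)); pose proof (Rabs_pos (Re w)).
    assert (Im w <= 43 / 50) by lra; nra. }
  apply Rmult_le_reg_r with (Cmod w ^ 2); [apply pow_lt; auto | ].
  unfold Rdiv; rewrite (Rmult_assoc (Im w) (/ _)), Rinv_l by (apply pow_nonzero; lra).
  nra. }
intros z Hz; unfold upper_half_plane in Hz.
destruct (nfloor_ex (100 / Im z)) as [N [_ HN]]; [apply Rdiv_le_0_compat; lra | ].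
apply (G (S N)); auto.
pose proof (poly (S N) 0.01 ltac:(lra)) as P; rewrite S_INR in P.
replace (1 + 0.01) with 1.01 in P by lra.
apply (Rmult_lt_compat_l (Im z)) in HN; auto.
replace (Im z * (100 / Im z)) with 100 in HN by (field; lra).
nra.
Qed.

(** * Hecke's estimate in terms of the coefficients up to q^(k/12) *)

Section Bound.
Variables (k : nat) (g : C -> C) (b : nat -> C).
Hypothesis Hk4 : (k mod 4 = 0)%nat.
Hypothesis Hg : has_q_expansion g b.
Hypothesis HS : forall w, upper_half_plane w -> g (Sz w) = (w ^ k * g w)%C.

Let L := (k / 12)%nat.
Let kk := INR k.

(** k mod 12 is 0, 4 or 8. The resulting gap L + 1 - k/12 >= 1/3 drives the contraction. *)
Let L_bounds : INR L <= kk / 12 <= INR L + 2 / 3.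
Proof.
pose proof (Nat.div_mod_eq k 12) as E; fold L in E.
pose proof (Nat.mod_upper_bound k 12 ltac:(lia)) as B.
pose proof (Nat.div_mod_eq k 4) as E4.
assert (B2 : (k mod 12 <= 8)%nat) by lia.
assert (H1 : (12 * L <= k)%nat) by lia; assert (H2 : (k <= 12 * L + 8)%nat) by lia.
apply le_INR in H1; apply le_INR in H2.
rewrite plus_INR, mult_INR in H2; rewrite mult_INR in H1.
replace (INR 12) with 12 in * by (simpl; ring); replace (INR 8) with 8 in * by (simpl; ring).
unfold kk; lra.
Qed.

Let kk_pos : 0 <= kk := pos_INR k.

(** The coefficients of (q / Delta)^(k/12). The explicit logarithm gives this power a meaning even
    if 12 does not divide k, and 24 * k/12 = 2k. *)
Let ec : nat -> C := expser (RtoC (2 * kk)) logeta_coef.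
Let u : nat -> C := cconv b ec.
Let U (z : C) : C := ps u (nome z).

Let conv_b : conv_on b 1 := q_expansion_conv g b Hg.
Let conv_ec : conv_on ec 1 := conv_on_expser _ logeta_coef logeta_coef_nn conv_on_logeta_coef.
Let conv_u : conv_on u 1 := conv_on_cconv b ec 1 conv_b conv_ec.

Let U_eq (z : C) : upper_half_plane z -> U z = (g z * Cexp (RtoC (2 * kk) * logeta z))%C.
Proof.
intros Hz; pose proof (Cmod_nome_lt_1 z Hz).
unfold U, u; rewrite (ps_cconv b ec 1) by auto.
unfold ec; rewrite ps_expser by (auto using logeta_coef_nn, conv_on_logeta_coef).
rewrite (q_expansion_ps g b z Hg Hz); reflexivity.
Qed.

Let psi (z : C) : R := Cmod (U z) * exp (PI * kk * Im z / 6).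

Let psi_eq (z : C) : upper_half_plane z -> psi z = Cmod (g z) * exp (kk / 12 * logDelta z).
Proof.
intros Hz; unfold psi; rewrite U_eq by auto; rewrite Cmod_mult, Cmod_Cexp, Rmult_assoc, <- exp_plus.
f_equal; f_equal; unfold logDelta, Re, Im; simpl; field.
Qed.

Let psi_Sz (z : C) : upper_half_plane z -> psi (Sz z) = psi z.
Proof.
intros Hz; rewrite !psi_eq by (auto using Sz_H); rewrite HS, Cmod_mult, Cmod_pow, logDelta_Sz by auto.
pose proof (Cmod_pos z (z_neq_0 z Hz)) as P.
replace (kk / 12 * (logDelta z - 12 * ln (Cmod z))) with (kk / 12 * logDelta z + - (kk * ln (Cmod z))) by field.
rewrite exp_plus, exp_Ropp; unfold kk at 2; rewrite exp_INR_ln by auto.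
field; apply pow_nonzero; lra.
Qed.

Let psi_add_1 (z : C) : psi (z + 1)%C = psi z.
Proof. unfold psi, U; rewrite nome_add_1, Im_add_real; auto. Qed.

Let uA (n : nat) : C := if Nat.leb n L then u n else RtoC 0.
Let uT (n : nat) : C := if Nat.leb n L then RtoC 0 else u n.

Let conv_uA : conv_on uA 1.
Proof.
apply conv_on_finite with (S L); intros n Hn; unfold uA; destruct (Nat.leb_spec n L); [lia | auto].
Qed.

Let conv_uT : conv_on uT 1.
Proof.
apply conv_on_le with u; auto; intros n; unfold uT; destruct (Nat.leb_spec n L); [ | lra].
rewrite Cmod_0; apply Cmod_ge_0.
Qed.

Let UA (z : C) : C := ps uA (nome z).
Let UT (z : C) : C := ps uT (nome z).

Let U_split (z : C) : upper_half_plane z -> U z = (UA z + UT z)%C.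
Proof.
intros Hz; unfold UA, UT; rewrite <- (ps_plus uA uT 1) by (auto using Cmod_nome_lt_1).
apply ps_ext; intros n; unfold uA, uT; destruct (Nat.leb n L); ring.
Qed.

(** S sends the points of height 11/20 with |Re z| <= 1/2 to heights between 0.55/0.5525, which
    exceeds 43/50, and 1/0.55 = 20/11. The bottom [yF] of the strip is the height of
    [weight_reduce]. *)
Let y1 := 11 / 20.
Let yF := 43 / 50.
Let Y := 20 / 11.

Section Contraction.
Variables N Sc : R.
Hypothesis HN0 : 0 <= N.
Hypothesis HSc0 : 0 <= Sc.
Hypothesis HN : forall z, yF <= Im z <= Y -> psi z <= N.
Hypothesis HSc : forall z, y1 <= Im z <= Y -> Cmod (UA z) * exp (PI * kk * Im z / 6) <= Sc.

Let psi_y1 (z : C) : Im z = y1 -> psi z <= N.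
Proof.
intros Hy.
assert (Hz : upper_half_plane z) by (unfold upper_half_plane, y1 in *; lra).
destruct (period_reduce (fun w => RtoC (psi w)) z) as (w & E & Iw & Rw); auto.
{ intros w _; rewrite psi_add_1; auto. }
injection E as E; rewrite <- E.
assert (Hw : upper_half_plane w) by (unfold upper_half_plane in *; lra).
rewrite <- psi_Sz by auto; apply HN; rewrite Im_Sz, Cmod2_alt by auto.
rewrite Iw, Hy; unfold y1, yF, Y.
assert (Q : 0 <= Re w ^ 2 <= / 4).
{ split; [apply pow2_ge_0 | ]; rewrite <- (pow2_abs (Re w)); pose proof (Rabs_pos (Re w)); nra. }
set (D := Re w ^ 2 + (11 / 20) ^ 2).
assert (HD : (11 / 20) ^ 2 <= D <= (11 / 20) ^ 2 + / 4) by (unfold D; lra).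
split; apply Rmult_le_reg_r with D; try lra;
  replace (11 / 20 / D * D) with (11 / 20) by (field; lra); lra.
Qed.

Let UT_y1 (x : R) : Cmod (ps uT (nome (x, y1))) <= (N + Sc) * exp (- (PI * kk * y1 / 6)).
Proof.
assert (Hz : upper_half_plane (x, y1)) by (unfold upper_half_plane, Im, y1; simpl; lra).
pose proof (psi_y1 (x, y1) eq_refl) as A; unfold psi in A.
assert (B : Cmod (UA (x, y1)) * exp (PI * kk * Im (x, y1) / 6) <= Sc).
{ apply HSc; unfold Im, y1, Y; simpl; lra. }
change (Im (x, y1)) with y1 in *.
assert (E : UT (x, y1) = (U (x, y1) - UA (x, y1))%C) by (rewrite U_split by auto; ring).
fold (UT (x, y1)); rewrite E.
rewrite exp_Ropp; set (e := exp (PI * kk * y1 / 6)) in *.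
assert (Pe : 0 < e) by apply exp_pos.
apply Rmult_le_reg_r with e; auto.
rewrite Rmult_assoc, Rinv_l, Rmult_1_r by lra.
pose proof (Cmod_triangle (U (x, y1)) (- UA (x, y1))) as T; rewrite Cmod_opp in T.
change (U (x, y1) + - UA (x, y1))%C with (U (x, y1) - UA (x, y1))%C in T; nra.
Qed.

(* A point of height y1 is moved by S into the strip, where [psi] is at most N;
   extracting coefficients on that line and summing the geometric series gives the factor 2/3. *)
Lemma UT_bound (z : C) : yF <= Im z ->
  Cmod (UT z) * exp (PI * kk * Im z / 6) <= 2 / 3 * (N + Sc).
Proof.
intros Hy; pose proof PI_bounds as HPI.
set (y := Im z) in *; unfold yF in Hy.
set (B := (N + Sc) * exp (- (PI * kk * y1 / 6))).
assert (HB : 0 <= B) by (apply Rmult_le_pos; [lra | apply Rlt_le, exp_pos]).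
set (rho := exp (- (2 * PI * (y - y1)))).
assert (R0 : 0 < rho) by apply exp_pos.
(* 2 pi (yF - y1) >= 2 * 3.1 * 0.31 >= 3 * 0.64 and 1.88^3 > 6, hence rho <= 1/6. The same 0.64
   bounds the exponent 2 * 3.1 * 0.31 / 3 needed below. *)
assert (X64 : 1.88 <= exp 0.64).
{ eapply Rle_trans; [ | apply (exp_ge_partial 0.64 3); lra].
  rewrite !sum_Sn, sum_O; unfold plus; simpl; lra. }
assert (R1 : rho <= / 6).
{ unfold rho; rewrite exp_Ropp; apply Rinv_le_contravar; [lra | ].
  apply Rle_trans with (exp (0.64 + 0.64 + 0.64)); [rewrite !exp_plus; nra | apply exp_le; unfold y1; nra]. }
assert (T : Cmod (UT z) <= B * rho ^ S L * / (1 - rho)).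
{ assert (Hgeo : forall n, Cmod (uT n * nome z ^ n) <= (if Nat.leb n L then 0 else B * rho ^ n)).
  { intros n; pose proof (coef_bound uT y1 B n conv_uT ltac:(unfold y1; lra) UT_y1) as CB.
    rewrite Cmod_mult, Cmod_pow, Cmod_nome; fold y.
    unfold uT in *; destruct (Nat.leb n L); [rewrite Cmod_0; lra | ].
    replace (exp (- (2 * PI * y))) with (exp (- (2 * PI * y1)) * rho).
    2:{ unfold rho; rewrite <- exp_plus; f_equal; ring. }
    rewrite Rpow_mult_distr, <- Rmult_assoc; apply Rmult_le_compat_r; [apply pow_le; lra | auto]. }
  unfold UT, ps.
  assert (Hz : upper_half_plane z) by (unfold upper_half_plane; fold y; lra).
  rewrite (csum_shift _ (S L)) by (apply (conv_on_acv _ 1); auto; apply Cmod_nome_lt_1; auto).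
  rewrite (csumn_ext _ (fun n => 0 * 0)%C), (csumn_scal 0 (fun _ => RtoC 0)), Cmult_0_l, Cplus_0_l.
  2:{ intros i Hi; unfold uT; destruct (Nat.leb_spec i L); [ring | lia]. }
  rewrite <- (Series_geom rho) by (rewrite Rabs_pos_eq; lra).
  rewrite <- Series_scal_l; apply Cmod_csum_le_maj.
  - intros n; specialize (Hgeo (S L + n)%nat); destruct (Nat.leb_spec (S L + n) L); [lia | ].
    eapply Rle_trans; [exact Hgeo | rewrite pow_add; lra].
  - apply (ex_series_scal_l (B * rho ^ S L) (fun n => rho ^ n)), ex_series_geom; rewrite Rabs_pos_eq; lra. }
assert (I1 : / (1 - rho) <= 1.2).
{ apply Rmult_le_reg_r with (1 - rho); [lra | ]; rewrite Rinv_l by lra; lra. }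
(* The exponential is rho^(-k/12), so the net power of rho is L + 1 - k/12 >= 1/3. With the
   geometric factor at most 1.2, the product 1.2 / 1.88 stays below 2/3. *)
assert (Q : rho ^ S L * exp (PI * kk * (y - y1) / 6) <= / 1.88).
{ unfold rho; rewrite <- (exp_INR_ln (S L)) by apply exp_pos; rewrite ln_exp, <- exp_plus, S_INR.
  apply Rle_trans with (exp (- (64 / 100))); [apply exp_le | rewrite exp_Ropp; replace (64 / 100) with 0.64 by lra; apply Rinv_le_contravar; lra].
  destruct L_bounds as [_ LB].
  assert (P1 : 0.31 <= y - y1) by (unfold y1; lra).
  assert (P2 : 0.31 * 3.1 <= (y - y1) * PI) by nra.
  assert (P3 : / 3 <= INR L + 1 - kk / 12) by lra.
  assert (P4 : 0.31 * 3.1 * (2 / 3) <= 2 * ((y - y1) * PI) * (INR L + 1 - kk / 12)) by nra.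
  replace ((INR L + 1) * - (2 * PI * (y - y1)) + PI * kk * (y - y1) / 6)
    with (- (2 * ((y - y1) * PI) * (INR L + 1 - kk / 12))) by field.
  lra. }
assert (E : B * exp (PI * kk * y / 6) = (N + Sc) * exp (PI * kk * (y - y1) / 6)).
{ unfold B; rewrite Rmult_assoc, <- exp_plus; f_equal; f_equal; field. }
pose proof (exp_pos (PI * kk * y / 6)) as Pe.
apply Rle_trans with (B * rho ^ S L * / (1 - rho) * exp (PI * kk * y / 6)).
{ apply Rmult_le_compat_r; lra. }
replace (B * rho ^ S L * / (1 - rho) * exp (PI * kk * y / 6))
  with ((B * exp (PI * kk * y / 6)) * rho ^ S L * / (1 - rho)) by ring.
rewrite E.
replace ((N + Sc) * exp (PI * kk * (y - y1) / 6) * rho ^ S L * / (1 - rho))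
  with ((N + Sc) * ((rho ^ S L * exp (PI * kk * (y - y1) / 6)) * / (1 - rho))) by ring.
assert (I0 : 0 < / (1 - rho)) by (apply Rinv_0_lt_compat; lra).
assert (Q0 : 0 <= rho ^ S L * exp (PI * kk * (y - y1) / 6)).
{ apply Rmult_le_pos; [apply pow_le; lra | apply Rlt_le, exp_pos]. }
assert (F : rho ^ S L * exp (PI * kk * (y - y1) / 6) * / (1 - rho) <= 2 / 3).
{ apply Rle_trans with (/ 1.88 * 1.2); [apply Rmult_le_compat; lra | lra]. }
rewrite (Rmult_comm (2 / 3)); apply Rmult_le_compat_l; lra.
Qed.

End Contraction.

(** 5 Sc is the fixed point of N -> Sc + (2/3)(N + Sc). Starting from the crude bound [N0] on the
    strip, the excess over it shrinks by 2/3 at each pass, so no maximum has to be attained. *)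
Lemma psi_bounded (Sc : R) : 0 <= Sc ->
  (forall z, y1 <= Im z <= Y -> Cmod (UA z) * exp (PI * kk * Im z / 6) <= Sc) ->
  forall z, yF <= Im z <= Y -> psi z <= 5 * Sc.
Proof.
intros HSc0 HSc.
pose proof PI_RGT_0 as HPI.
set (N0 := Series (fun n => Cmod (u n) * nome_abs yF ^ n) * exp (PI * kk * Y / 6)).
assert (HrF : 0 < nome_abs yF < 1) by (apply nome_abs_lt_1; unfold yF; lra).
assert (ex0 : ex_series (fun n => Cmod (u n) * nome_abs yF ^ n)) by (apply conv_u; lra).
assert (HN0 : 0 <= N0).
{ apply Rmult_le_pos; [ | apply Rlt_le, exp_pos]; apply Series_pos; auto.
  intros n; apply Rmult_le_pos; [apply Cmod_ge_0 | apply pow_le; lra]. }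
assert (G : forall j z, yF <= Im z <= Y -> psi z <= 5 * Sc + (2 / 3) ^ j * N0).
{ induction j; intros z Hz.
  - apply Rle_trans with N0; [ | simpl; lra].
    unfold psi, N0; apply Rmult_le_compat; [apply Cmod_ge_0 | apply Rlt_le, exp_pos | | ].
    + apply Cmod_csum_le_maj; auto; intros n; rewrite Cmod_mult, Cmod_pow, Cmod_nome.
      apply Rmult_le_compat_l; [apply Cmod_ge_0 | ]; apply pow_incr; split; [apply Rlt_le, exp_pos | ].
      apply exp_le; nra.
    + apply exp_le; unfold Rdiv; apply Rmult_le_compat_r; [lra | ].
      apply Rmult_le_compat_l; [apply Rmult_le_pos; lra | lra].
  - assert (P : 0 <= (2 / 3) ^ j * N0) by (apply Rmult_le_pos; auto; apply pow_le; lra).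
    pose proof (UT_bound (5 * Sc + (2 / 3) ^ j * N0) Sc ltac:(lra) HSc0 IHj HSc z (proj1 Hz)) as T.
    assert (A : Cmod (UA z) * exp (PI * kk * Im z / 6) <= Sc).
    { apply HSc; unfold y1, yF in *; lra. }
    unfold psi; rewrite U_split by (unfold upper_half_plane, yF in *; lra).
    pose proof (Cmod_triangle (UA z) (UT z)); pose proof (exp_pos (PI * kk * Im z / 6)).
    simpl pow; nra. }
intros z Hz; apply Rle_eps; intros eps He.
destruct (pow_lt_1_zero (2 / 3) ltac:(rewrite Rabs_pos_eq; lra) (eps / (N0 + 1))) as [j Hj].
{ apply Rdiv_lt_0_compat; lra. }
specialize (Hj j (le_n _)); rewrite Rabs_pos_eq in Hj by (apply pow_le; lra).
eapply Rle_trans; [apply (G j z Hz) | ].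
assert ((2 / 3) ^ j * N0 <= eps / (N0 + 1) * (N0 + 1)).
{ apply Rmult_le_compat; auto; [apply pow_le; lra | lra | lra]. }
replace (eps / (N0 + 1) * (N0 + 1)) with eps in H by (field; lra); lra.
Qed.

Let hY := koebe (nome_abs Y).
Let hF := koebe (nome_abs yF).
Let EY := exp (2 * kk * hY).

(** The coefficients are nonnegative, so each term is at most the value of the whole series at the
    real nome of height [Y], the top of the strip. *)
Let ec_bound (s : nat) : Cmod (ec s) <= exp (2 * PI * Y * INR s) * EY.
Proof.
assert (HrY : 0 < nome_abs Y < 1) by (apply nome_abs_lt_1; unfold Y; lra).
assert (A : Cmod (ec s) * nome_abs Y ^ s <= Cmod (ps ec (RtoC (nome_abs Y)))).
{ apply nn_coef_le; auto; [ | lra].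
  intros i; apply nnC_expser; [lra | apply logeta_coef_nn | apply conv_on_logeta_coef]. }
assert (B : Cmod (ps ec (RtoC (nome_abs Y))) <= EY).
{ unfold ec; rewrite ps_expser by (try apply logeta_coef_nn; try apply conv_on_logeta_coef; rewrite Cmod_R, Rabs_pos_eq; lra).
  rewrite Cmod_Cexp; apply exp_le.
  eapply Rle_trans; [apply Rle_abs | eapply Rle_trans; [apply Re_le_Cmod | ]].
  rewrite Cmod_mult, Cmod_R, Rabs_pos_eq by lra; apply Rmult_le_compat_l; [lra | ].
  apply Cmod_ps_logeta_coef; auto; rewrite Cmod_R, Rabs_pos_eq; lra. }
assert (E : exp (2 * PI * Y * INR s) * nome_abs Y ^ s = 1).
{ unfold nome_abs; rewrite <- (exp_INR_ln s) by apply exp_pos; rewrite ln_exp, <- exp_plus, <- exp_0; f_equal; ring. }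
assert (P : 0 < nome_abs Y ^ s) by (apply pow_lt; lra).
apply Rmult_le_reg_r with (nome_abs Y ^ s); auto.
replace (exp (2 * PI * Y * INR s) * EY * nome_abs Y ^ s) with (EY * (exp (2 * PI * Y * INR s) * nome_abs Y ^ s)) by ring.
rewrite E; lra.
Qed.

Let u_bound (i : nat) (w Q : R) : 0 <= w -> 0 <= Q ->
  (forall m, (m <= i)%nat -> Cmod (b m) * exp (2 * PI * Y * INR (i - m)) * w <= Q) ->
  Cmod (u i) * w <= INR (S i) * (EY * Q).
Proof.
intros Hw HQ H.
assert (PE : 0 < EY) by apply exp_pos.
replace (Cmod (u i) * w) with (Cmod (RtoC w * u i)) by (rewrite Cmod_mult, Cmod_R, Rabs_pos_eq; auto; ring).
unfold u, cconv; rewrite <- csumn_scal; apply Cmod_csumn_bound; intros m Hm.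
rewrite !Cmod_mult, Cmod_R, Rabs_pos_eq by auto.
specialize (H m ltac:(lia)); pose proof (ec_bound (i - m)) as B.
pose proof (Cmod_ge_0 (b m)).
apply Rle_trans with (w * (Cmod (b m) * (exp (2 * PI * Y * INR (i - m)) * EY))).
- apply Rmult_le_compat_l; auto; apply Rmult_le_compat_l; auto.
- replace (w * (Cmod (b m) * (exp (2 * PI * Y * INR (i - m)) * EY)))
    with (EY * (Cmod (b m) * exp (2 * PI * Y * INR (i - m)) * w)) by ring.
  apply Rmult_le_compat_l; lra.
Qed.

(** Two nested sums of at most L + 1 terms give the square. The weight [w] is arbitrary, so that one
    estimate serves the strip, where it is |q|^(-k/12), and the region above it, where it is the
    weight that turns |U| into [mz]. *)
Let UA_bound (z : C) (w Q : R) : upper_half_plane z -> 0 <= w -> 0 <= Q ->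
  (forall m i, (m <= i <= L)%nat ->
     Cmod (b m) * exp (2 * PI * Y * INR (i - m)) * (exp (- (2 * PI * Im z)) ^ i * w) <= Q) ->
  Cmod (UA z) * w <= INR (S L) ^ 2 * (EY * Q).
Proof.
intros Hz Hw HQ H.
assert (PE : 0 < EY) by apply exp_pos.
assert (PEQ : 0 <= EY * Q) by (apply Rmult_le_pos; lra).
replace (Cmod (UA z) * w) with (Cmod (RtoC w * UA z)) by (rewrite Cmod_mult, Cmod_R, Rabs_pos_eq; auto; ring).
unfold UA, ps; rewrite (csum_finite _ (S L)).
2:{ intros n Hn; unfold uA; destruct (Nat.leb_spec n L); [lia | ring]. }
rewrite <- csumn_scal.
replace (INR (S L) ^ 2 * (EY * Q)) with (INR (S L) * (INR (S L) * (EY * Q))) by ring.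
apply Cmod_csumn_bound; intros i Hi.
rewrite !Cmod_mult, Cmod_R, Rabs_pos_eq, Cmod_pow, Cmod_nome by auto.
unfold uA; destruct (Nat.leb_spec i L); [ | lia].
apply Rle_trans with (INR (S i) * (EY * Q)).
- replace (w * (Cmod (u i) * exp (- (2 * PI * Im z)) ^ i))
    with (Cmod (u i) * (exp (- (2 * PI * Im z)) ^ i * w)) by ring.
  apply u_bound; auto.
  apply Rmult_le_pos; auto; apply pow_le, Rlt_le, exp_pos.
- apply Rmult_le_compat_r; auto; apply le_INR; lia.
Qed.

(** The invariant |g| y^(k/2) of Hecke's argument. *)
Let mz (z : C) : R := Cmod (g z) * exp (kk / 2 * ln (Im z)).

Let mz_Sz (z : C) : upper_half_plane z -> mz (Sz z) = mz z.
Proof.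
intros Hz; unfold mz; rewrite HS, Cmod_mult, Cmod_pow, Im_Sz by auto.
pose proof (Cmod_pos z (z_neq_0 z Hz)) as P; unfold upper_half_plane in Hz.
unfold Rdiv at 2; rewrite ln_mult by (auto; apply Rinv_0_lt_compat, pow_lt; auto).
rewrite ln_Rinv, ln_pow by (auto; apply pow_lt; auto).
replace (kk / 2 * (ln (Im z) + - (INR 2 * ln (Cmod z)))) with (kk / 2 * ln (Im z) + - (kk * ln (Cmod z)))
  by (simpl INR; field).
rewrite exp_plus, exp_Ropp; unfold kk at 2; rewrite exp_INR_ln by auto.
field; apply pow_nonzero; lra.
Qed.

Let mz_add_1 (z : C) : upper_half_plane z -> mz (z + 1)%C = mz z.
Proof.
intros Hz; unfold mz; rewrite Im_add_real, (q_expansion_period g b z Hg Hz); auto.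
Qed.

Let mz_psi (z : C) : upper_half_plane z ->
  mz z = psi z * exp (- (kk / 12 * logDelta z) + kk / 2 * ln (Im z)).
Proof.
intros Hz; rewrite psi_eq by auto; unfold mz; rewrite Rmult_assoc, <- exp_plus; f_equal; f_equal; ring.
Qed.

(** A bound for y^(k/2) |Delta|^(k/12): the function y exp(- pi y / 3) has its maximum 3 / (pi e) at
    y = 3 / pi, and [hF] bounds the product (1 - q^n) logarithmically. *)
Let Wc := exp (kk / 2 * (ln (3 / PI) - 1) + 2 * kk * hF).

Let Wc_bound (z : C) : yF <= Im z -> exp (- (kk / 12 * logDelta z) + kk / 2 * ln (Im z)) <= Wc.
Proof.
intros Hy; pose proof PI_RGT_0 as HPI.
assert (Hy0 : 0 < Im z) by (unfold yF in Hy; lra).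
apply exp_le; unfold logDelta.
assert (B : Rabs (Re (logeta z)) <= hF).
{ eapply Rle_trans; [apply Re_le_Cmod | apply logeta_bound; unfold yF in *; lra]. }
apply Rabs_le_between in B.
assert (Ln : ln (Im z) - PI * Im z / 3 <= ln (3 / PI) - 1).
{ replace (Im z) with ((3 / PI) * (PI * Im z / 3)) at 1 by (field; lra).
  rewrite ln_mult by (apply Rdiv_lt_0_compat; nra).
  pose proof (exp_ineq1_le (ln (PI * Im z / 3))) as X.
  rewrite exp_ln in X by (apply Rdiv_lt_0_compat; nra); lra. }
assert (kk / 2 * (ln (Im z) - PI * Im z / 3) <= kk / 2 * (ln (3 / PI) - 1)) by (apply Rmult_le_compat_l; lra).
assert (2 * kk * - Re (logeta z) <= 2 * kk * hF) by (apply Rmult_le_compat_l; lra).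
lra.
Qed.

(** [Q] controls U_A up to height [Y]. Above it U_T is still contracted, but the weight |q|^(-k/12)
    grows without bound on U_A; there [Q2] bounds |b m| y^(k/2) exp(- 2 pi m y) instead. *)
Lemma coefficient_bound (Q Q2 : R) (n : nat) : 0 <= Q -> 0 <= Q2 -> (0 < k)%nat -> (0 < n)%nat ->
  (forall m, (m <= L)%nat -> Cmod (b m) * exp (2 * PI * Y * (kk / 12 - INR m)) <= Q) ->
  (forall m y, (m <= L)%nat -> 0 < y ->
     Cmod (b m) * exp (- (2 * PI * y * INR m) + kk / 2 * ln y) <= Q2) ->
  Cmod (b n) <= (5 * (INR (S L) ^ 2 * (EY * Q)) * Wc + INR (S L) ^ 2 * (EY * (EY * Q2)))
     * exp (kk / 2 * (ln (4 * PI * INR n / kk) + 1)).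
Proof.
intros HQ HQ2 Hk Hn H1 H2.
pose proof PI_RGT_0 as HPI.
assert (PE : 0 < EY) by apply exp_pos.
set (Sc := INR (S L) ^ 2 * (EY * Q)).
assert (HSc0 : 0 <= Sc).
{ apply Rmult_le_pos; [apply pow2_ge_0 | apply Rmult_le_pos; lra]. }
assert (HSc : forall z, y1 <= Im z <= Y -> Cmod (UA z) * exp (PI * kk * Im z / 6) <= Sc).
{ intros z Hz; apply UA_bound; auto; [unfold upper_half_plane, y1 in *; lra | apply Rlt_le, exp_pos | ].
  intros m i [Hm Hi]; eapply Rle_trans; [ | apply (H1 m); lia].
  rewrite Rmult_assoc; apply Rmult_le_compat_l; [apply Cmod_ge_0 | ].
  rewrite <- (exp_INR_ln i) by apply exp_pos; rewrite ln_exp, <- !exp_plus.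
  apply exp_le; rewrite minus_INR by lia.
  destruct L_bounds as [LB _]; apply le_INR in Hi.
  assert (X : 0 <= 2 * PI * ((Y - Im z) * (kk / 12 - INR i))).
  { apply Rmult_le_pos; [lra | apply Rmult_le_pos; lra]. }
  lra. }
pose proof (psi_bounded Sc HSc0 HSc) as Hpsi.
set (M := 5 * Sc * Wc + INR (S L) ^ 2 * (EY * (EY * Q2))).
assert (PW : 0 < Wc) by apply exp_pos.
assert (HM2 : 0 <= INR (S L) ^ 2 * (EY * (EY * Q2))).
{ apply Rmult_le_pos; [apply pow2_ge_0 | ]; apply Rmult_le_pos; [lra | apply Rmult_le_pos; lra]. }
assert (HF : forall w, 43 / 50 <= Im w -> mz w <= M).
{ intros w Hw; fold yF in Hw.
  assert (Hw0 : upper_half_plane w) by (unfold upper_half_plane, yF in *; lra).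
  pose proof (Wc_bound w Hw) as WB.
  rewrite mz_psi by auto.
  set (e := exp (- (kk / 12 * logDelta w) + kk / 2 * ln (Im w))) in *.
  assert (Pe : 0 < e) by apply exp_pos.
  (* In the strip the bound on [psi] is enough. Above it U_T and U_A are treated apart, which gives
     the two terms of [M]. *)
  destruct (Rle_dec (Im w) Y) as [D | D].
  - assert (psi w <= 5 * Sc) by (apply Hpsi; lra).
    assert (psi w * e <= 5 * Sc * Wc) by (apply Rmult_le_compat; try lra; apply Rmult_le_pos; [apply Cmod_ge_0 | apply Rlt_le, exp_pos]).
    unfold M; lra.
  - pose proof (UT_bound (5 * Sc) Sc ltac:(lra) HSc0 Hpsi HSc w Hw) as T.
    unfold psi; rewrite U_split by auto.
    set (f := exp (PI * kk * Im w / 6)) in *.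
    assert (Pf : 0 < f) by apply exp_pos.
    assert (T2 : Cmod (UT w) * f * e <= 5 * Sc * Wc).
    { apply Rmult_le_compat; try lra; apply Rmult_le_pos; [apply Cmod_ge_0 | lra]. }
    assert (A : Cmod (UA w) * (f * e) <= INR (S L) ^ 2 * (EY * (EY * Q2))).
    { apply UA_bound; auto; [apply Rmult_le_pos; lra | apply Rmult_le_pos; lra | ].
      intros m i [Hm Hi].
      (* The linear term of [logDelta] cancels the exponential weight [f]; only y^(k/2) and the
         bounded contribution of [logeta] remain. *)
      assert (Fe : f * e <= EY * exp (kk / 2 * ln (Im w))).
      { unfold f, e, EY; rewrite <- !exp_plus; apply exp_le; unfold logDelta.
        assert (B : Rabs (Re (logeta w)) <= hY).
        { eapply Rle_trans; [apply Re_le_Cmod | apply logeta_bound; unfold Y in *; lra]. }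
        apply Rabs_le_between in B.
        assert (2 * kk * - Re (logeta w) <= 2 * kk * hY) by (apply Rmult_le_compat_l; lra).
        lra. }
      rewrite <- (exp_INR_ln i) by apply exp_pos; rewrite ln_exp.
      specialize (H2 m (Im w) ltac:(lia) Hw0).
      apply Rle_trans with (Cmod (b m) * exp (2 * PI * Y * INR (i - m)) *
         (exp (INR i * - (2 * PI * Im w)) * (EY * exp (kk / 2 * ln (Im w))))).
      { apply Rmult_le_compat_l; [apply Rmult_le_pos; [apply Cmod_ge_0 | apply Rlt_le, exp_pos] | ].
        apply Rmult_le_compat_l; [apply Rlt_le, exp_pos | auto]. }
      replace (Cmod (b m) * exp (2 * PI * Y * INR (i - m)) *
         (exp (INR i * - (2 * PI * Im w)) * (EY * exp (kk / 2 * ln (Im w)))))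
        with (EY * (Cmod (b m) * (exp (2 * PI * Y * INR (i - m)) *
         (exp (INR i * - (2 * PI * Im w)) * exp (kk / 2 * ln (Im w)))))) by ring.
      apply Rmult_le_compat_l; [lra | ].
      eapply Rle_trans; [ | exact H2].
      apply Rmult_le_compat_l; [apply Cmod_ge_0 | ].
      rewrite <- !exp_plus; apply exp_le; rewrite minus_INR by lia.
      apply le_INR in Hm.
      assert (X : 0 <= 2 * PI * ((Im w - Y) * (INR i - INR m))).
      { apply Rmult_le_pos; [lra | apply Rmult_le_pos; lra]. }
      lra. }
    pose proof (Cmod_triangle (UA w) (UT w)) as Tr.
    unfold M; apply Rle_trans with ((Cmod (UA w) + Cmod (UT w)) * f * e).
    + apply Rmult_le_compat_r; [lra | ]; apply Rmult_le_compat_r; lra.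
    + lra. }
pose proof (weight_reduce mz M mz_add_1 mz_Sz HF) as HM.
assert (Pk : 0 < kk) by (apply lt_0_INR; auto).
assert (Pn : 0 < INR n) by (apply lt_0_INR; auto).
(* This height minimises y^(-k/2) exp(2 pi n y). *)
set (y := kk / (4 * PI * INR n)).
assert (P4 : 0 < 4 * PI * INR n) by (apply Rmult_lt_0_compat; lra).
assert (Hy : 0 < y) by (apply Rdiv_lt_0_compat; auto).
assert (C : Cmod (b n) * exp (- (2 * PI * y)) ^ n <= M * exp (- (kk / 2 * ln y))).
{ apply coef_bound; auto; intros x.
  assert (Hz : upper_half_plane (x, y)) by exact Hy.
  rewrite <- (q_expansion_ps g b _ Hg Hz).
  specialize (HM _ Hz); unfold mz in HM; change (Im (x, y)) with y in HM.
  rewrite exp_Ropp; apply Rmult_le_reg_r with (exp (kk / 2 * ln y)); [apply exp_pos | ].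
  rewrite Rmult_assoc, Rinv_l, Rmult_1_r by (apply Rgt_not_eq, exp_pos); auto. }
rewrite <- (exp_INR_ln n), ln_exp in C by apply exp_pos.
apply (Rmult_le_compat_r (exp (INR n * (2 * PI * y)))) in C; [ | apply Rlt_le, exp_pos].
rewrite (Rmult_assoc (Cmod (b n))), (Rmult_assoc M), <- !exp_plus in C.
replace (INR n * - (2 * PI * y) + INR n * (2 * PI * y)) with 0 in C by ring.
rewrite exp_0, Rmult_1_r in C.
replace (kk / 2 * (ln (4 * PI * INR n / kk) + 1)) with (- (kk / 2 * ln y) + INR n * (2 * PI * y)).
- exact C.
- replace (4 * PI * INR n / kk) with (/ y) by (unfold y; field; lra).
  rewrite ln_Rinv by auto; unfold y at 2; field; lra.
Qed.

End Bound.

(** * The theorem *)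

Lemma Sturm_bound (k : nat) (g : C -> C) (b : nat -> C) : (k mod 4 = 0)%nat -> (0 < k)%nat ->
  has_q_expansion g b ->
  (forall w, upper_half_plane w -> g (Sz w) = (w ^ k * g w)%C) ->
  (forall m, (m <= k / 12)%nat -> b m = 0%C) -> forall n, b n = 0%C.
Proof.
intros Hk4 Hk Hg HS H0 n; destruct (Nat.eq_dec n 0) as [-> | Hn]; [apply H0; lia | ].
apply Cmod_eq_0, Rle_antisym; [ | apply Cmod_ge_0].
eapply Rle_trans; [apply (coefficient_bound k g b Hk4 Hg HS 0 0 n); auto; try lra; try lia | ].
- intros m Hm; rewrite H0, Cmod_0 by auto; lra.
- intros m y Hm _; rewrite H0, Cmod_0 by auto; lra.
- apply Req_le; ring.
Qed.

(** * Real coefficients by reflection in the imaginary axis *)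

Definition mirror (f : C -> C) (z : C) : C := Cconj (f (- Cconj z)%C).

Lemma mirror_H (z : C) : upper_half_plane z -> upper_half_plane (- Cconj z)%C.
Proof. unfold upper_half_plane, Im; simpl; lra. Qed.

Lemma nome_mirror (z : C) : nome (- Cconj z) = Cconj (nome z).
Proof.
rewrite !nome_Cexp; unfold Cexp, I2pi; destruct z as [x y]; apply C_eq; simpl.
- replace (- x * (2 * PI * 0 - 0 * 1)) with (x * (2 * PI * 0 - 0 * 1)) by ring.
  set (A := (2 * PI * 0 - 0 * 1)); set (B := (2 * PI * 1 + 0 * 0)).
  replace (A * - x - B * - - y) with (A * x - B * y) by (unfold A; ring).
  replace (A * - - y + B * - x) with (- (A * y + B * x)) by (unfold A; ring).
  rewrite cos_neg, sin_neg; ring.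
- set (A := (2 * PI * 0 - 0 * 1)); set (B := (2 * PI * 1 + 0 * 0)).
  replace (A * - x - B * - - y) with (A * x - B * y) by (unfold A; ring).
  replace (A * - - y + B * - x) with (- (A * y + B * x)) by (unfold A; ring).
  rewrite cos_neg, sin_neg; ring.
Qed.

Lemma Cconj_pow (x : C) (n : nat) : (Cconj (x ^ n) = Cconj x ^ n)%C.
Proof. induction n; simpl; [apply C_eq; simpl; ring | rewrite Cmult_conj, IHn; auto]. Qed.

Lemma csum_conj (a : nat -> C) : csum (fun n => Cconj (a n)) = Cconj (csum a).
Proof. apply C_eq; simpl; [reflexivity | apply Series_opp]. Qed.

Lemma q_expansion_mirror (f : C -> C) (a : nat -> C) :
  has_q_expansion f a -> has_q_expansion (mirror f) (fun n => Cconj (a n)).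
Proof.
intros Hf; apply q_expansion_intro.
- apply conv_on_le with a; [ | apply (q_expansion_conv f); auto].
  intros n; rewrite Cmod_conj; lra.
- intros z Hz; unfold mirror; rewrite (q_expansion_ps f a _ Hf) by (apply mirror_H; auto).
  unfold ps; rewrite <- csum_conj; apply csum_ext; intros n.
  rewrite Cmult_conj, Cconj_pow, nome_mirror, Cconj_conj; auto.
Qed.

Lemma mirror_Sz (k : nat) (f : C -> C) : Nat.Even k ->
  (forall w, upper_half_plane w -> f (Sz w) = (w ^ k * f w)%C) ->
  forall w, upper_half_plane w -> mirror f (Sz w) = (w ^ k * mirror f w)%C.
Proof.
intros He HS w Hw; unfold mirror.
assert (E : (- Cconj (Sz w))%C = Sz (- Cconj w)).
{ unfold Sz; pose proof (z_neq_0 w Hw) as W0.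
  rewrite Copp_conj, Cinv_conj by auto.
  assert (Cconj w <> 0%C).
  { intros Q; apply W0; rewrite <- (Cconj_conj w), Q; apply C_eq; simpl; ring. }
  field; auto. }
rewrite E, HS by (apply mirror_H; auto).
rewrite Cmult_conj, Cconj_pow, Copp_conj, Cconj_conj, Cpow_opp_even; auto.
Qed.

Lemma weight_invariant_Sz (k : nat) (f : C -> C) (w : C) : weight_invariant k f ->
  upper_half_plane w -> f (Sz w) = (w ^ k * f w)%C.
Proof.
intros H Hw; pose proof (H 0%Z (-1)%Z 1%Z 0%Z eq_refl w Hw) as E.
pose proof (z_neq_0 w Hw) as W0.
replace ((IZR 1 * w + IZR 0)%C) with w in E by ring.
replace ((IZR 0 * w + IZR (-1)) / w)%C with (Sz w) in E; auto.
assert (E1 : RtoC (IZR (-1)) = (- (1))%C) by (rewrite <- RtoC_opp; reflexivity).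
rewrite E1; unfold Sz; field; auto.
Qed.

Lemma real_coefficients (k : nat) (F : C -> C) (a : nat -> C) : (k mod 4 = 0)%nat -> (0 < k)%nat ->
  has_q_expansion F a ->
  (forall w, upper_half_plane w -> F (Sz w) = (w ^ k * F w)%C) ->
  a 0%nat = RtoC 1 -> (forall m, (1 <= m <= k / 12)%nat -> a m = RtoC 0) ->
  forall n, Im (a n) = 0.
Proof.
intros Hk4 Hk HF HS A0 Am n.
assert (He : Nat.Even k).
{ exists (2 * (k / 4))%nat; pose proof (Nat.div_mod_eq k 4); lia. }
assert (Z : (a n + (-1) * Cconj (a n))%C = 0%C).
{ apply (Sturm_bound k (fun z => F z + (-1) * mirror F z)%C (fun n => a n + (-1) * Cconj (a n))%C); auto.
  - apply (q_expansion_plus F (fun z => (-1) * mirror F z)%C a (fun n => (-1) * Cconj (a n))%C); auto.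
    apply q_expansion_scal, q_expansion_mirror; auto.
  - intros w Hw; rewrite HS, (mirror_Sz k) by auto; ring.
  - intros m Hm; destruct (Nat.eq_dec m 0) as [-> | Hm0].
    + rewrite A0; apply C_eq; simpl; ring.
    + rewrite Am by lia; apply C_eq; simpl; ring. }
apply (f_equal Im) in Z; simpl in Z; unfold Im; lra.
Qed.

(** For k divisible by 4 this is the classical factor - 2k / B_k in front of the divisor sums in
    E_k. *)
Definition eis_const (k : nat) : R := (2 * PI) ^ k / (INR (fact (k - 1)) * zeta k).

Lemma eis_const_pos (k : nat) : (2 <= k)%nat -> 0 < eis_const k.
Proof.
intros Hk; pose proof PI_RGT_0; pose proof (zeta_ge_1 k Hk); pose proof (INR_fact_lt_0 (k - 1)).
apply Rdiv_lt_0_compat; [apply pow_lt; lra | apply Rmult_lt_0_compat; lra].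
Qed.

(** Divisibility by 4 makes (- 2 pi i)^k equal to (2 pi)^k, and this is where the Eisenstein
    coefficients become positive. *)
Lemma lipschitz_const_zeta (k : nat) : (k mod 4 = 0)%nat -> (2 <= k)%nat -> (lipschitz_const k / RtoC (zeta k))%C = RtoC (eis_const k).
Proof.
intros Hk4 Hk; pose proof (zeta_neq_0 k Hk) as Z0.
pose proof (zeta_ge_1 k Hk).
assert (F0 : RtoC (INR (fact (k - 1))) <> 0%C) by (apply RtoC_neq_0, INR_fact_neq_0).
assert (E : ((- I2pi) ^ k)%C = RtoC ((2 * PI) ^ k)).
{ pose proof (Nat.div_mod_eq k 4) as Q; replace k with (4 * (k / 4))%nat by lia.
  rewrite Cpow_mult_r, RtoC_pow, Cpow_mult_r; f_equal.
  unfold I2pi; apply C_eq; simpl; ring. }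
unfold lipschitz_const, eis_const; rewrite E, RtoC_div, RtoC_mult by (apply Rmult_integral_contrapositive_currified; [apply INR_fact_neq_0 | lra]).
field; auto.
Qed.

Lemma Re_csumn_nn_term (a : nat -> C) (n i : nat) : (forall j, nnC (a j)) -> (i < n)%nat ->
  Re (a i) <= Re (csumn a n).
Proof.
intros H; assert (P : forall j, 0 <= Re (a j)).
{ intros j; rewrite (f_equal Re (H j)); simpl; apply Cmod_ge_0. }
assert (Q : forall m, 0 <= Re (csumn a m)).
{ induction m; simpl; [lra | specialize (P m)]; unfold Re in *; lra. }
induction n; intros Hi; [lia | ].
simpl; destruct (Nat.eq_dec i n) as [-> | Hne].
- specialize (Q n); unfold Re in *; lra.
- specialize (IHn ltac:(lia)); specialize (P n); unfold Re in *; lra.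
Qed.

(** Only the divisor [n] itself is kept, complementary to [S 0]. *)
Lemma sigma_coef_lower (j n : nat) : (0 < n)%nat -> INR n ^ j <= Re (sigma_coef j n) /\ Im (sigma_coef j n) = 0.
Proof.
intros Hn; split.
- unfold sigma_coef, divsum.
  set (t := fun c => if Nat.eqb (n mod S c) 0 then powcoef j (n / S c) else RtoC 0).
  assert (T0 : t 0%nat = RtoC (INR n ^ j)).
  { unfold t; rewrite Nat.mod_1_r, Nat.div_1_r; simpl Nat.eqb; cbv iota; destruct n; [lia | reflexivity]. }
  replace (INR n ^ j) with (Re (t 0%nat)) by (rewrite T0; reflexivity).
  apply Re_csumn_nn_term; auto.
  intros c; unfold t; destruct (Nat.eqb (n mod S c) 0); [ | apply nnC_R; lra].
  unfold powcoef; destruct (n / S c)%nat; apply nnC_R; [lra | apply pow_le, pos_INR].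
- exact (f_equal Im (sigma_coef_nn j n)).
Qed.

Lemma Cmod_csumn_maj (a : nat -> C) (f : nat -> R) (n : nat) :
  (forall i, Cmod (a i) <= f i) -> (forall i, 0 <= f i) -> Cmod (csumn a (S n)) <= sum_n f n.
Proof.
intros H P; induction n.
- rewrite sum_O; simpl; rewrite Cplus_0_l; auto.
- rewrite sum_Sn; unfold plus; simpl plus.
  change (csumn a (S (S n))) with (csumn a (S n) + a (S n))%C.
  eapply Rle_trans; [apply Cmod_triangle | apply Rplus_le_compat; auto].
Qed.

(** The sum of (n/c)^j over divisors c is at most n^j zeta(j), and zeta(j) <= 2. *)
Lemma sigma_coef_upper (j n : nat) : (2 <= j)%nat -> Cmod (sigma_coef j n) <= 2 * INR n ^ j.
Proof.
intros Hj; destruct n.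
- unfold sigma_coef, divsum; simpl csumn; rewrite Cmod_0.
  apply Rmult_le_pos; [lra | apply pow_le, pos_INR].
- unfold sigma_coef, divsum.
  eapply Rle_trans; [apply (Cmod_csumn_maj _ (fun c => INR (S n) ^ j * / (INR c + 1) ^ j)) | ].
  + intros c; rewrite <- S_INR.
    assert (Pc : 0 < INR (S c)) by (apply lt_0_INR; lia).
    assert (Pn : 0 <= INR (S n)) by apply pos_INR.
    destruct (Nat.eqb_spec (S n mod S c) 0) as [E | E].
    2:{ rewrite Cmod_0; apply Rmult_le_pos; [apply pow_le; auto | apply Rlt_le, Rinv_0_lt_compat, pow_lt; auto]. }
    assert (Q : INR (S n) * / INR (S c) = INR (S n / S c)).
    { assert (Q : (S n = S c * (S n / S c))%nat) by (pose proof (Nat.div_mod_eq (S n) (S c)); lia).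
      rewrite Q at 1; rewrite mult_INR; field; lra. }
    rewrite <- pow_inv, <- Rpow_mult_distr, Q.
    unfold powcoef; destruct (S n / S c)%nat eqn:D.
    * rewrite Cmod_0; apply pow_le, pos_INR.
    * rewrite Cmod_R, Rabs_pos_eq by (apply pow_le, pos_INR); lra.
  + intros c; pose proof (pos_INR c).
    apply Rmult_le_pos; [apply pow_le, pos_INR | apply Rlt_le, Rinv_0_lt_compat, pow_lt; lra].
  + apply Rle_trans with (Series (fun c => INR (S n) ^ j * / (INR c + 1) ^ j)).
    * apply Series_pos_partial.
      -- intros c; pose proof (pos_INR c).
         apply Rmult_le_pos; [apply pow_le, pos_INR | apply Rlt_le, Rinv_0_lt_compat, pow_lt; lra].
      -- apply (ex_series_scal_l (INR (S n) ^ j) (fun c => / (INR c + 1) ^ j)), ex_series_zeta; auto.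
    * rewrite Series_scal_l, Rmult_comm; apply Rmult_le_compat_r; [apply pow_le, pos_INR | ].
      apply zeta_ge_1; auto.
Qed.

(** * Numerical estimates *)

Lemma exp_5_3_lower : 189 <= exp 5.3.
Proof.
assert (H : 2.87 <= exp 1.06).
{ eapply Rle_trans; [ | apply (exp_ge_partial 1.06 4); lra].
  rewrite !sum_Sn, sum_O; unfold plus; simpl; lra. }
replace 5.3 with (INR 5 * 1.06) by (simpl; lra).
rewrite <- (ln_exp 1.06), exp_INR_ln by apply exp_pos.
apply Rle_trans with (2.87 ^ 5); [lra | apply pow_incr; lra].
Qed.

Lemma koebe_mono (r s : R) : 0 <= r <= s -> s < 1 -> koebe r <= koebe s.
Proof.
intros H Hs; unfold koebe, Rdiv.
apply Rmult_le_compat; try lra; [apply Rlt_le, Rinv_0_lt_compat, pow_lt; lra | ].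
apply Rinv_le_contravar; [apply pow_lt; lra | apply pow_incr; lra].
Qed.

(** 2 pi * 43/50 >= 6.2 * 0.86 > 5.3. For the top of the strip, 2 pi * 20/11 exceeds twice 5.3. *)
Lemma koebe_strip_bottom : 0 <= koebe (nome_abs (43 / 50)) <= 0.0054.
Proof.
pose proof PI_bounds; pose proof exp_5_3_lower.
assert (R : 0 < nome_abs (43 / 50) <= 0.0053).
{ split; [apply exp_pos | ]; unfold nome_abs; rewrite exp_Ropp.
  apply Rle_trans with (/ 189); [ | lra].
  apply Rinv_le_contravar; [lra | ].
  eapply Rle_trans; [eassumption | apply exp_le; lra]. }
split; [apply Rdiv_le_0_compat; [lra | apply pow_lt; lra] | ].
eapply Rle_trans; [apply (koebe_mono _ 0.0053); lra | unfold koebe; lra].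
Qed.

Lemma koebe_strip_top : 0 <= koebe (nome_abs (20 / 11)) <= 0.0001.
Proof.
pose proof PI_bounds; pose proof exp_5_3_lower.
assert (R : 0 < nome_abs (20 / 11) <= 0.00003).
{ split; [apply exp_pos | ]; unfold nome_abs; rewrite exp_Ropp.
  apply Rle_trans with (/ 35000); [ | lra].
  apply Rinv_le_contravar; [lra | ].
  apply Rle_trans with (exp (5.3 + 5.3)); [rewrite exp_plus; nra | apply exp_le; lra]. }
split; [apply Rdiv_le_0_compat; [lra | apply pow_lt; lra] | ].
eapply Rle_trans; [apply (koebe_mono _ 0.00003); lra | unfold koebe; lra].
Qed.

Lemma ln_le_sub1 (x : R) : 0 < x -> ln x <= x - 1.
Proof.
intros Hx; pose proof (exp_ineq1_le (ln x)) as H; rewrite exp_ln in H by auto; lra.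
Qed.

Lemma exp_1_lower : 2.5 <= exp 1.
Proof.
eapply Rle_trans; [ | apply (exp_ge_partial 1 3); lra].
rewrite !sum_Sn, sum_O; unfold plus; simpl; lra.
Qed.

(** Tangent to the logarithm at 1000, with ln 1000 <= 8. The slope is small because the leftover
    ln(l) / 2 of the final comparison has to fit into a thin margin linear in k. *)
Lemma ln_linear (x : R) : 0 < x -> ln x <= x / 1000 + 7.
Proof.
intros Hx.
replace x with ((x / 1000) * 1000) at 1 by field.
rewrite ln_mult by lra.
pose proof (ln_le_sub1 (x / 1000) ltac:(lra)).
assert (ln 1000 <= 8); [ | lra].
rewrite <- (ln_exp 8); apply ln_le; [lra | ].
pose proof exp_1_lower as E.
replace 8 with (1 + 1 + 1 + 1 + 1 + 1 + 1 + 1) by ring; rewrite !exp_plus.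
assert (6.25 <= exp 1 * exp 1) by nra.
set (e := exp 1) in *.
replace (e * e * e * e * e * e * e * e) with ((e * e) * (e * e) * ((e * e) * (e * e))) by ring.
assert (39 <= (e * e) * (e * e)) by nra.
nra.
Qed.

Lemma ln_rate : 0.0236 <= ln 1.0242382.
Proof.
pose proof (ln_le_sub1 (/ 1.0242382) ltac:(lra)) as H.
rewrite ln_Rinv in H by lra; lra.
Qed.

(** Merges the two contributions to the bound on the cusp form: 5 * 2 * exp 9 from [strip_const] and
    2 from [cusp_const]. *)
Lemma ten_exp_9 : 10 * exp 9 + 2 <= exp 12.
Proof.
pose proof exp_1_lower as E; pose proof (exp_pos 9).
replace 12 with (9 + (1 + 1 + 1)) by ring; rewrite exp_plus, !exp_plus.
assert (1 <= exp 9) by (rewrite <- exp_0; apply exp_le; lra).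
assert (12 <= exp 1 * exp 1 * exp 1) by nra.
nra.
Qed.

(* The numerical margin: 0.0236 / 2 exceeds 2 * 0.0056. *)
Lemma log_scale_inequality (kk l x A lnk lnl' : R) :
  1 <= l -> 12 * l <= kk -> 1 <= lnk -> ln l <= lnl' ->
  x = 58.366 / (kk - 2) + 1 / (kk - 2) * (3 * lnl' + ln lnk) + (ln 1.0242382 + lnl') ->
  x <= A ->
  12 + 2 + 2 * ln l + (kk / 2 - 1) * ln l + kk / 2 * A
    + 2 * kk * (koebe (nome_abs (43 / 50)) + 2 * koebe (nome_abs (20 / 11))) < (kk - 1) * A.
Proof.
intros Hl Hkl Hk Hll Hx HxA.
pose proof koebe_strip_bottom; pose proof koebe_strip_top; pose proof ln_rate as R.
pose proof (ln_linear l ltac:(lra)) as LL.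
assert (L0 : 0 <= ln l) by (rewrite <- ln_1; apply ln_le; lra).
assert (LK : 0 <= ln lnk) by (rewrite <- ln_1; apply ln_le; lra).
(* Multiplication by k/2 - 1, the excess of k - 1 over k/2, removes the denominators k - 2 of the
   threshold. *)
assert (H2 : (kk / 2 - 1) * x = 58.366 / 2 + (3 * lnl' + ln lnk) / 2 + (kk / 2 - 1) * (ln 1.0242382 + lnl')).
{ rewrite Hx; field; lra. }
assert (H3 : (kk / 2 - 1) * x <= (kk / 2 - 1) * A) by (apply Rmult_le_compat_l; lra).
assert (H4 : (kk / 2 - 1) * (0.0236 + ln l) <= (kk / 2 - 1) * (ln 1.0242382 + lnl')) by (apply Rmult_le_compat_l; lra).
assert (H5 : 2 * kk * (koebe (nome_abs (43 / 50)) + 2 * koebe (nome_abs (20 / 11))) <= 2 * kk * 0.0056) by (apply Rmult_le_compat_l; lra).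
(* Apart from the two rates in k, what is left is 14 + ln(l) / 2 against 58.366 / 2; the factor l^3
   of the threshold has absorbed the other 3/2 ln(l). *)
lra.
Qed.

Lemma ln_threshold (k l : nat) : (12 <= k)%nat -> (1 <= l)%nat ->
  0 < threshold k l /\
  ln (threshold k l) = 58.366 / (INR k - 2) + 1 / (INR k - 2) * (3 * ln (INR l) + ln (ln (INR k)))
    + (ln 1.0242382 + ln (INR l)).
Proof.
intros Hk Hl.
assert (Pl : 1 <= INR l) by (apply (le_INR 1); auto).
assert (Pk : 12 <= INR k).
{ apply (le_INR 12) in Hk; replace (INR 12) with 12 in Hk by (simpl; ring); auto. }
assert (LK : 1 <= ln (INR k)).
{ rewrite <- (ln_exp 1); apply ln_le; [apply exp_pos | pose proof exp_le_3; lra]. }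
assert (P3 : 0 < INR l ^ 3) by (apply pow_lt; lra).
assert (PX : 0 < INR l ^ 3 * ln (INR k)) by (apply Rmult_lt_0_compat; lra).
unfold threshold, rpow.
(* The special value of [rpow] at 0 is excluded, because l >= 1 and ln k >= 1. *)
destruct (Req_EM_T (INR l ^ 3 * ln (INR k)) 0) as [E | E]; [lra | ].
unfold Rpower.
split.
- apply Rmult_lt_0_compat; [apply Rmult_lt_0_compat; apply exp_pos | lra].
- rewrite !ln_mult, !ln_exp, ln_pow; try apply exp_pos; try lra;
    try (apply Rmult_lt_0_compat; try apply exp_pos; lra).
  simpl INR; ring.
Qed.

(** * Comparison of the cusp form with the Eisenstein coefficient *)

Section Main.
Variables (k : nat) (b : nat -> C).
Hypothesis Hk4 : (k mod 4 = 0)%nat.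
Hypothesis Hk12 : (1 <= k / 12)%nat.
Let L := (k / 12)%nat.
Let kk := INR k.
Let l := INR L.
Hypothesis Hb0 : b 0%nat = 0%C.
Hypothesis Hbm : forall m, (1 <= m <= L)%nat -> Cmod (b m) <= 2 * eis_const k * INR m ^ (k - 1).

Let size : 1 <= l /\ 12 * l <= kk <= 12 * l + 8 /\ (12 <= k)%nat.
Proof.
pose proof (Nat.div_mod_eq k 12) as E; fold L in E, Hk12.
pose proof (Nat.mod_upper_bound k 12 ltac:(lia)) as B.
pose proof (Nat.div_mod_eq k 4) as E4.
assert (H1 : (12 * L <= k)%nat) by lia; assert (H2 : (k <= 12 * L + 8)%nat) by lia.
split; [apply (le_INR 1); auto | split; [ | lia]].
apply le_INR in H1; apply le_INR in H2.
rewrite plus_INR, mult_INR in H2; rewrite mult_INR in H1.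
replace (INR 12) with 12 in * by (simpl; ring); replace (INR 8) with 8 in * by (simpl; ring).
unfold kk, l; lra.
Qed.

Let pow_ln (m : nat) : (1 <= m)%nat -> INR m ^ (k - 1) = exp ((kk - 1) * ln (INR m)).
Proof.
intros Hm; assert (P : 0 < INR m) by (apply lt_0_INR; lia).
rewrite <- exp_INR_ln by auto; destruct size as (_ & _ & K); rewrite minus_INR by lia; simpl (INR 1); reflexivity.
Qed.

Let e0p : 0 < eis_const k.
Proof. destruct size as (_ & _ & K); apply eis_const_pos; lia. Qed.

(** The constant [Q] of [coefficient_bound]. As pi <= 3.3, 2 pi * 20/11 <= 12, so the quantity to
    bound is m^(k-1) exp(k - 12 m). Since ln(m/l) <= m/l - 1, it exceeds l^(k-1) by at most exp(k -
    12 l + 1), and k - 12 l <= 8. *)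
Definition strip_const : R := 2 * eis_const k * exp ((kk - 1) * ln l + 9).
(** The constant [Q2] of [coefficient_bound]: y^(k/2) exp(- 2 pi m y) is largest at y = k / (4 pi
    m), which turns m^(k-1) into m^(k/2-1) (k / (4 pi e))^(k/2). *)
Definition cusp_const : R := 2 * eis_const k * exp ((kk / 2 - 1) * ln l + kk / 2 * (ln (kk / (4 * PI)) - 1)).

Lemma strip_const_bound (m : nat) : (m <= L)%nat ->
  Cmod (b m) * exp (2 * PI * (20 / 11) * (kk / 12 - INR m)) <= strip_const.
Proof.
intros Hm; destruct size as (S1 & [S2 S3] & S4); unfold strip_const.
destruct (Nat.eq_dec m 0) as [-> | Hm0].
- rewrite Hb0, Cmod_0, Rmult_0_l; apply Rmult_le_pos; [lra | apply Rlt_le, exp_pos].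
- eapply Rle_trans; [apply Rmult_le_compat_r; [apply Rlt_le, exp_pos | apply Hbm; lia] | ].
  rewrite pow_ln, Rmult_assoc, <- exp_plus by lia.
  apply Rmult_le_compat_l; [lra | apply exp_le].
  assert (M1 : 1 <= INR m) by (apply (le_INR 1); lia).
  assert (M2 : INR m <= l) by (apply le_INR; auto).
  pose proof PI_bounds as HPI.
  assert (X1 : 2 * PI * (20 / 11) * (kk / 12 - INR m) <= 12 * (kk / 12 - INR m)).
  { apply Rmult_le_compat_r; lra. }
  set (t := INR m / l).
  assert (Ht : 0 < t <= 1).
  { unfold t; split; [apply Rdiv_lt_0_compat; lra | ].
    apply Rmult_le_reg_r with l; [lra | ]; unfold Rdiv; rewrite Rmult_assoc, Rinv_l; lra. }
  assert (Em : INR m = t * l) by (unfold t; field; lra).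
  assert (X2 : ln (INR m) <= ln l + (t - 1)).
  { rewrite Em, ln_mult by lra; pose proof (ln_le_sub1 t ltac:(lra)); lra. }
  assert (X3 : (kk - 1) * ln (INR m) <= (kk - 1) * (ln l + (t - 1))) by (apply Rmult_le_compat_l; lra).
  assert (X4 : (kk - 12 * l) * t <= 8) by nra.
  rewrite Em in *; nra.
Qed.

Lemma cusp_const_bound (m : nat) (y : R) : (m <= L)%nat -> 0 < y ->
  Cmod (b m) * exp (- (2 * PI * y * INR m) + kk / 2 * ln y) <= cusp_const.
Proof.
intros Hm Hy; destruct size as (S1 & [S2 S3] & S4); unfold cusp_const.
destruct (Nat.eq_dec m 0) as [-> | Hm0].
- rewrite Hb0, Cmod_0, Rmult_0_l; apply Rmult_le_pos; [lra | apply Rlt_le, exp_pos].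
- eapply Rle_trans; [apply Rmult_le_compat_r; [apply Rlt_le, exp_pos | apply Hbm; lia] | ].
  rewrite pow_ln, Rmult_assoc, <- exp_plus by lia.
  apply Rmult_le_compat_l; [lra | apply exp_le].
  assert (M1 : 1 <= INR m) by (apply (le_INR 1); lia).
  assert (M2 : INR m <= l) by (apply le_INR; auto).
  pose proof PI_bounds as HPI.
  set (t := 4 * PI * INR m * y / kk).
  assert (Ht : 0 < t).
  { apply Rdiv_lt_0_compat; [ | lra]; apply Rmult_lt_0_compat; [apply Rmult_lt_0_compat | ]; lra. }
  assert (Ey : y = t * (kk / (4 * PI)) / INR m) by (unfold t; field; repeat split; lra).
  assert (X1 : ln y = ln t + ln (kk / (4 * PI)) - ln (INR m)).
  { rewrite Ey; unfold Rdiv at 1; rewrite ln_mult, ln_mult, ln_Rinv; try lra.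
    - apply Rdiv_lt_0_compat; lra.
    - apply Rmult_lt_0_compat; auto; apply Rdiv_lt_0_compat; lra.
    - apply Rinv_0_lt_compat; lra. }
  pose proof (ln_le_sub1 t Ht) as X2.
  assert (X3 : 2 * PI * y * INR m = kk / 2 * t) by (unfold t; field; lra).
  assert (X4 : ln (INR m) <= ln l) by (apply ln_le; lra).
  rewrite X1, X3.
  assert (X5 : (kk / 2 - 1) * ln (INR m) <= (kk / 2 - 1) * ln l) by (apply Rmult_le_compat_l; lra).
  assert (X6 : kk / 2 * ln t <= kk / 2 * (t - 1)) by (apply Rmult_le_compat_l; lra).
  lra.
Qed.

(** Both sides contain [eis_const k], which cancels, and logarithms reduce the claim to
    [log_scale_inequality]. Here l' stands for the dimension, and L <= l' gives ln l <= ln l'. *)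
Lemma eisenstein_dominates (l' n : nat) : (0 < n)%nat -> (L <= l')%nat -> threshold k l' <= INR n ->
  (5 * (INR (S L) ^ 2 * (exp (2 * kk * koebe (nome_abs (20 / 11))) * strip_const)) *
   exp (kk / 2 * (ln (3 / PI) - 1) + 2 * kk * koebe (nome_abs (43 / 50))) +
   INR (S L) ^ 2 * (exp (2 * kk * koebe (nome_abs (20 / 11))) * (exp (2 * kk * koebe (nome_abs (20 / 11))) * cusp_const))) *
  exp (kk / 2 * (ln (4 * PI * INR n / kk) + 1)) < eis_const k * INR n ^ (k - 1).
Proof.
intros Hn Hl' Hth; destruct size as (S1 & [S2 S3] & S4).
pose proof PI_bounds as HPI.
assert (Pn : 0 < INR n) by (apply lt_0_INR; auto).
set (hY := koebe (nome_abs (20 / 11))); set (hF := koebe (nome_abs (43 / 50))).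
destruct koebe_strip_top as [Y0 _]; destruct koebe_strip_bottom as [F0 _]; fold hY in Y0; fold hF in F0.
set (A := ln (INR n)).
set (T := (kk / 2 - 1) * ln l + kk / 2 * A + 2 * kk * (hF + 2 * hY)).
assert (L4 : ln (4 * PI * INR n / kk) = ln (4 * PI) + A - ln kk).
{ unfold Rdiv; rewrite (ln_mult (4 * PI * INR n)), (ln_mult (4 * PI)), ln_Rinv; try lra;
    try (apply Rinv_0_lt_compat; lra).
  - fold A; ring.
  - apply Rmult_lt_0_compat; lra. }
assert (L5 : ln (kk / (4 * PI)) = ln kk - ln (4 * PI)).
{ unfold Rdiv; rewrite ln_mult, ln_Rinv; try lra; apply Rinv_0_lt_compat; lra. }
(* The maximum 3/(pi e) of [Wc] and the factor 4 pi e n / k of Hecke's estimate multiply to 12 n / k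
   <= n / l. This trades k/2 of the exponent of l in [strip_const] for n^(k/2). *)
assert (L6 : ln (3 / PI) + ln (4 * PI) <= ln kk - ln l).
{ rewrite <- ln_mult by (try lra; apply Rdiv_lt_0_compat; lra).
  replace (3 / PI * (4 * PI)) with 12 by (field; lra).
  assert (ln (12 * l) <= ln kk) by (apply ln_le; lra).
  rewrite ln_mult in H by lra; lra. }
assert (T1 : (exp (2 * kk * hY) * strip_const) * exp (kk / 2 * (ln (3 / PI) - 1) + 2 * kk * hF)
   * exp (kk / 2 * (ln (4 * PI * INR n / kk) + 1)) <= 2 * eis_const k * exp 9 * exp T).
{ unfold strip_const; rewrite L4.
  replace (exp (2 * kk * hY) * (2 * eis_const k * exp ((kk - 1) * ln l + 9)) * exp (kk / 2 * (ln (3 / PI) - 1) + 2 * kk * hF)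
     * exp (kk / 2 * (ln (4 * PI) + A - ln kk + 1)))
    with (2 * eis_const k * (exp (2 * kk * hY) * (exp ((kk - 1) * ln l + 9) * (exp (kk / 2 * (ln (3 / PI) - 1) + 2 * kk * hF)
     * exp (kk / 2 * (ln (4 * PI) + A - ln kk + 1)))))) by ring.
  rewrite (Rmult_assoc (2 * eis_const k)), <- !exp_plus.
  apply Rmult_le_compat_l; [lra | apply exp_le]; unfold T.
  assert (kk / 2 * (ln (3 / PI) + ln (4 * PI)) <= kk / 2 * (ln kk - ln l)) by (apply Rmult_le_compat_l; lra).
  assert (0 <= kk * hY) by (apply Rmult_le_pos; lra).
  lra. }
assert (T2 : (exp (2 * kk * hY) * (exp (2 * kk * hY) * cusp_const)) * exp (kk / 2 * (ln (4 * PI * INR n / kk) + 1))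
   <= 2 * eis_const k * exp T).
{ unfold cusp_const; rewrite L4, L5.
  replace (exp (2 * kk * hY) * (exp (2 * kk * hY) * (2 * eis_const k * exp ((kk / 2 - 1) * ln l + kk / 2 * (ln kk - ln (4 * PI) - 1))))
     * exp (kk / 2 * (ln (4 * PI) + A - ln kk + 1)))
    with (2 * eis_const k * (exp (2 * kk * hY) * (exp (2 * kk * hY) * (exp ((kk / 2 - 1) * ln l + kk / 2 * (ln kk - ln (4 * PI) - 1))
     * exp (kk / 2 * (ln (4 * PI) + A - ln kk + 1)))))) by ring.
  rewrite <- !exp_plus.
  apply Rmult_le_compat_l; [lra | apply exp_le]; unfold T.
  assert (0 <= kk * hF) by (apply Rmult_le_pos; lra).
  lra. }
set (s := INR (S L) ^ 2).
(* (l + 1)^2 <= (2 l)^2 <= e^2 l^2. *)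
assert (Hs : 0 <= s <= exp (2 + 2 * ln l)).
{ unfold s; split; [apply pow2_ge_0 | ].
  replace (2 + 2 * ln l) with (1 + 1 + (ln l + ln l)) by ring.
  rewrite !exp_plus, !exp_ln by lra.
  pose proof exp_1_lower; rewrite S_INR; fold l.
  assert ((l + 1) ^ 2 <= (2 * l) ^ 2) by (apply pow_incr; lra).
  assert (4 * (l * l) <= exp 1 * exp 1 * (l * l)) by (apply Rmult_le_compat_r; nra).
  lra. }
set (X := exp (kk / 2 * (ln (4 * PI * INR n / kk) + 1))) in *.
apply Rle_lt_trans with (eis_const k * exp (2 + 2 * ln l + (12 + T))).
- replace ((5 * (s * (exp (2 * kk * hY) * strip_const)) * exp (kk / 2 * (ln (3 / PI) - 1) + 2 * kk * hF)
     + s * (exp (2 * kk * hY) * (exp (2 * kk * hY) * cusp_const))) * X)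
    with (s * (5 * ((exp (2 * kk * hY) * strip_const) * exp (kk / 2 * (ln (3 / PI) - 1) + 2 * kk * hF) * X)
     + (exp (2 * kk * hY) * (exp (2 * kk * hY) * cusp_const)) * X)) by ring.
  rewrite (exp_plus (2 + 2 * ln l)), (exp_plus 12).
  replace (eis_const k * (exp (2 + 2 * ln l) * (exp 12 * exp T)))
    with (exp (2 + 2 * ln l) * (eis_const k * exp 12 * exp T)) by ring.
  pose proof (exp_pos T) as PT; pose proof ten_exp_9 as E9.
  apply Rmult_le_compat; try lra.
  + assert (0 < X) by apply exp_pos.
    apply Rplus_le_le_0_compat.
    * unfold strip_const; repeat (apply Rmult_le_pos; try apply Rlt_le, exp_pos; try lra).
    * unfold cusp_const; repeat (apply Rmult_le_pos; try apply Rlt_le, exp_pos; try lra).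
  + apply Rle_trans with (eis_const k * exp T * (10 * exp 9 + 2)); [lra | ].
    replace (eis_const k * exp 12 * exp T) with (eis_const k * exp T * exp 12) by ring.
    apply Rmult_le_compat_l; auto; apply Rmult_le_pos; lra.
- rewrite pow_ln by lia; fold A.
  apply Rmult_lt_compat_l; auto; apply exp_increasing.
  destruct (ln_threshold k l' S4 ltac:(unfold L in *; lia)) as [Pt Et].
  assert (LK : 1 <= ln kk).
  { rewrite <- (ln_exp 1); apply ln_le; [apply exp_pos | pose proof exp_le_3; lra]. }
  assert (Hll : ln l <= ln (INR l')).
  { apply ln_le; [lra | apply le_INR; auto]. }
  assert (HA : ln (threshold k l') <= A) by (apply ln_le; auto).
  pose proof (log_scale_inequality kk l (ln (threshold k l')) A (ln kk) (ln (INR l')) S1 S2 LK Hll Et HA) as FI.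
  fold hF in FI; fold hY in FI; unfold T; lra.
Qed.

End Main.

Theorem theorem2 :
  forall (k l : nat) (F : C -> C) (a : nat -> C),
    (0 < k)%nat ->
    (k mod 4 = 0)%nat ->
    has_dimension (cusp_form k) l ->
    modular_form k F ->
    has_q_expansion F a ->
    a 0%nat = RtoC 1 ->
    (forall i : nat, (1 <= i <= l)%nat -> a i = RtoC 0) ->
    forall n : nat,
      threshold k l <= INR n ->
      Im (a n) = 0 /\ 0 < Re (a n).
Proof.
intros k l F a Hk Hk4 Hdim (_ & HW & _) HF A0 Ai n Hth.
pose proof (dimension_lower_bound k l Hk4 Hdim) as HL.
pose proof (Nat.div_mod_eq k 4) as E4.
assert (Hk4' : (4 <= k)%nat) by lia.
assert (He : Nat.Even k) by (exists (2 * (k / 4))%nat; lia).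
assert (FS : forall w, upper_half_plane w -> F (Sz w) = (w ^ k * F w)%C).
{ intros; apply weight_invariant_Sz; auto. }
assert (Am : forall m, (1 <= m <= k / 12)%nat -> a m = RtoC 0) by (intros; apply Ai; lia).
pose proof (real_coefficients k F a Hk4 Hk HF FS A0 Am n) as HIm.
split; auto.
(* The index 0 is reached when l = 0, since the threshold is then 0. *)
destruct (Nat.eq_dec n 0) as [-> | Hn]; [rewrite A0; simpl; lra | ].
set (g := fun z => (F z + (-1) * eisenstein k z)%C).
set (b := fun m => (a m + (-1) * eisenstein_coef k m)%C).
assert (Hg : has_q_expansion g b).
{ apply (q_expansion_plus F (fun z => (-1) * eisenstein k z)%C a (fun m => (-1) * eisenstein_coef k m)%C); auto.
  apply q_expansion_scal, eisenstein_q; lia. }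
assert (GS : forall w, upper_half_plane w -> g (Sz w) = (w ^ k * g w)%C).
{ intros w Hw; unfold g; rewrite FS, eisenstein_Sz by auto; ring. }
pose proof (eis_const_pos k ltac:(lia)) as E0.
assert (Een : forall m, (0 < m)%nat -> eisenstein_coef k m = (RtoC (eis_const k) * sigma_coef (k - 1) m)%C).
{ intros m Hm; unfold eisenstein_coef; rewrite lipschitz_const_zeta by (auto; lia).
  unfold delta0; destruct (Nat.eqb_spec m 0); [lia | ring]. }
assert (B0 : b 0%nat = 0%C).
{ unfold b; rewrite A0; unfold eisenstein_coef, sigma_coef, divsum, delta0; simpl; ring. }
assert (Bm : forall m, (1 <= m <= k / 12)%nat -> Cmod (b m) <= 2 * eis_const k * INR m ^ (k - 1)).
{ intros m Hm; unfold b; rewrite Am, Een by lia.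
  replace (0 + (-1) * (RtoC (eis_const k) * sigma_coef (k - 1) m))%C with (- (RtoC (eis_const k) * sigma_coef (k - 1) m))%C by ring.
  rewrite Cmod_opp, Cmod_mult, Cmod_R, Rabs_pos_eq by lra.
  pose proof (sigma_coef_upper (k - 1) m ltac:(lia)); nra. }
destruct (sigma_coef_lower (k - 1) n ltac:(lia)) as [SL _].
assert (Pn : 0 < INR n ^ (k - 1)) by (apply pow_lt, lt_0_INR; lia).
assert (Ea : Re (a n) = eis_const k * Re (sigma_coef (k - 1) n) + Re (b n)).
{ unfold b; rewrite (Een n) by lia; unfold Re; simpl; ring. }
assert (Main : Cmod (b n) < eis_const k * INR n ^ (k - 1)).
{ destruct (Nat.eq_dec (k / 12) 0) as [Z | Z].
  (* The weights 4 and 8, where the cusp form vanishes and F is the Eisenstein series itself. *)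
  - rewrite (Sturm_bound k g b Hk4 Hk Hg GS); [rewrite Cmod_0; apply Rmult_lt_0_compat; auto | ].
    intros m Hm; replace m with 0%nat by lia; auto.
  - eapply Rle_lt_trans; [ | apply (eisenstein_dominates k Hk4 ltac:(lia) l n ltac:(lia) HL Hth)].
    apply (coefficient_bound k g b Hk4 Hg GS (strip_const k) (cusp_const k) n); auto; try lia.
    + unfold strip_const; apply Rmult_le_pos; [lra | apply Rlt_le, exp_pos].
    + unfold cusp_const; apply Rmult_le_pos; [lra | apply Rlt_le, exp_pos].
    + intros m Hm; apply strip_const_bound; auto; lia.
    + intros m y Hm Hy; apply cusp_const_bound; auto; lia. }
pose proof (Re_le_Cmod (b n)) as RB; apply Rabs_le_between in RB.
assert (eis_const k * INR n ^ (k - 1) <= eis_const k * Re (sigma_coef (k - 1) n)) by (apply Rmult_le_compat_l; lra).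
lra.
Qed.
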